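(* Let $L,N\ge 1$ be integers with $2N<L$, let $p,q\ge 0$ with $p+q=1$, let $Y=(y_1,\dots,y_N)\in\mathcal X_{L,N}$, and let $X(t)$ be the PushASEP with $N$ particles on a ring of length $L$ started from $X(0)=Y$, with total current $Q(t)$. Let the radii $R,R',\epsilon',\epsilon_1,\epsilon_2$ be chosen according to the contour conditions in the context, with $\epsilon'$ sufficiently small. Then for all $t\ge 0$, all $X=(x_1,\dots,x_N)\in\mathcal X_{L,N}$ and all $\zeta\in\mathbb C$ with $|\zeta|=1$, $$\sum_{Q\in\mathbb Z}\zeta^Q\,\mathbb P_Y\big(X(t)=X,\ Q(t)=Q\big)=\oint^{(z)}\frac{dz}{z}\oint^{(w)}\frac{dw_1}{w_1}\cdots\oint^{(w)}\frac{dw_N}{w_N}\ \mathcal G_{\vec w}(Y;\zeta)\,u_{\vec w}(X;\zeta)\,e^{tE(\vec w)} .$$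
   Context: Model (PushASEP on a ring). $\mathcal X_{L,N}=\{(x_1,\dots,x_N)\in\mathbb Z^N: 0\le x_1<\dots<x_N\le L-1\}$ is the set of configurations of $N$ particles on $\mathbb Z/L\mathbb Z$. Each particle independently attempts to jump to its right neighbouring site at rate $p$, and the jump is suppressed if the target is occupied (exclusion). Each particle independently jumps to its left neighbouring site at rate $q$; if the target is occupied, the particle there is simultaneously pushed one step to the left, and so on, until an unoccupied site is reached (push). $\mathbb P_Y$ is the law started from $Y$. For $x\in\mathbb Z/L\mathbb Z$, the local current $Q_x(t)$ is the number of particle moves from $x$ to $x+1$ minus the number of particle moves from $x+1$ to $x$ during $[0,t]$ (pushed moves included), and $Q(t)=\sum_{x}Q_x(t)$. Functions. For $\vec w=(w_1,\dots,w_N)$: $h_{\vec w}(Y;\zeta)=\prod_{i=1}^N(\zeta^{-1}w_i)^{y_i}$; $A_\sigma(\vec w)=(-1)^\sigma\prod_{j=1}^N(1-w_{\sigma(j)}^{-1})^{\sigma(j)-j}$ for $\sigma\in S_N$, where $(-1)^\sigma$ is the sign; $u_{\vec w}(X;\zeta)=\sum_{\sigma\in S_N}A_\sigma(\vec w)\prod_{i=1}^N(\zeta^{-1}w_{\sigma(i)})^{-x_i}$; $E(\vec w)=\sum_{i=1}^N(pw_i+qw_i^{-1}-1)$; $p_z(\vec w;\zeta)=1+(-1)^N\zeta^Lz^{-L}\prod_{i=1}^N(1-w_i^{-1})$; $q_z(w)=1-z^Lw^{-L}(1-w^{-1})^{-N}$; $\mathcal G_{\vec w}(Y;\zeta)=\dfrac{h_{\vec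 w}(Y;\zeta)}{p_z(\vec w;\zeta)\prod_{i=1}^Nq_z(w_i)}$. Contours. $C_r$ is the positively oriented circle of radius $r$ centred at $0$ and $1+C_r$ its translate centred at $1$. $\oint^{(z)}=\frac1{2\pi\mathrm i}\big(\oint_{C_{R'}}-\oint_{C_{\epsilon'}}\big)$ and $\oint^{(w)}=\frac1{2\pi\mathrm i}\big(\oint_{C_R}-\oint_{C_{\epsilon_1}}-\oint_{1+C_{\epsilon_2}}\big)$. Contour conditions: $R'=1/\epsilon'$, $R=(R')^\beta$, $\epsilon_1=(\epsilon')^{\beta_1}$, $\epsilon_2=(\epsilon')^{\beta_2}$ with fixed exponents satisfying $\beta>1$, $\frac{L}{L-N}<\beta_1<\frac LN$, $\frac LN<\beta_2<\frac L{N-1}$ (the last upper bound being $+\infty$ if $N=1$), and $\epsilon'>0$ arbitrarily small. *)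

(* Defs.v *)
From HB Require Import structures.
From mathcomp Require Import all_boot all_order all_algebra all_fingroup.
From mathcomp Require Import finmap complex.
From mathcomp Require Import all_classical all_reals all_analysis.
From mathcomp Require Import summability.

Set Implicit Arguments.
Unset Strict Implicit.
Unset Printing Implicit Defensive.

Import Order.TTheory GRing.Theory Num.Theory.
Import numFieldNormedType.Exports.

Local Open Scope classical_set_scope.
Local Open Scope complex_scope.
Local Open Scope ring_scope.

(* Only the off-diagonal entries of [rate] are used; the exit rate of [z] is
   the sum of the rates [rate z z'] over [z' != z]. *)
Record is_transition_function (R : realType) (S : countType)
    (rate : S -> S -> R) (P : R -> S -> S -> R) : Prop := {
  transition_ge0 : forall (t : R) z z', 0 <= t -> 0 <= P t z z' ;
  transition_sum1 : forall (t : R) z, 0 <= t ->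
    (\esum_(z' in [set: S]) (P t z z')%:E = 1)%E ;
  transition0 : forall z z', P 0 z z' = (z == z')%:R ;
  transitionD : forall (s t : R) z z', 0 <= s -> 0 <= t ->
    ((P (s + t) z z')%:E = \esum_(k in [set: S]) (P s z k * P t k z')%:E)%E ;
  transition_rate : forall z z', z != z' ->
    P h z z' / h @[h --> 0^'+] --> rate z z' ;
  transition_exit_rate : forall z,
    ((1 - P h z z) / h)%:E @[h --> 0^'+] -->
      (\esum_(z' in [set z' | z' != z]) (rate z z')%:E)%E }.

(* The probability, starting from [z] at time [s], of visiting each state [z_k]
   at time [t_k], for [l = [:: (t_1, z_1); ...; (t_n, z_n)]]. *)
Fixpoint path_prob (R : realType) (S : countType) (P : R -> S -> S -> R)
    (s : R) (z : S) (l : seq (R * S)) : R :=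
  if l is (t, z') :: l' then P (t - s) z z' * path_prob P t z' l' else 1.

Record is_markov_chain (R : realType) (S : countType) (rate : S -> S -> R)
    (z0 : S) (d : measure_display) (T : measurableType d)
    (Pr : probability T R) (Z : R -> T -> S) : Prop := {
  chain_measurable : forall (t : R) z, 0 <= t -> measurable (Z t @^-1` [set z]) ;
  chain_right_continuous : forall omega (t : R), 0 <= t ->
    \forall s \near t^'+, Z s omega = Z t omega ;
  chain_law : exists2 P : R -> S -> S -> R, is_transition_function rate P &
    forall l : seq (R * S), path <=%R 0 (unzip1 l) ->
      Pr [set omega | all (fun tz => Z tz.1 omega == tz.2) l]
        = (path_prob P 0 z0 l)%:E }.

Definition config (L N : nat) : finType :=
  {x : N.-tuple 'I_L | sorted ltn [seq val i | i <- x]}.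

Definition pos (L N : nat) (x : config L N) (i : 'I_N) : 'I_L := tnth (val x) i.

Definition occupied (L N : nat) (x : config L N) : {set 'I_L} :=
  [set pos x i | i : 'I_N]%SET.

Definition move_right (L : nat) (A : {set 'I_L}) (s : 'I_L) : {set 'I_L} :=
  (ordS s |: A :\ s)%SET.

(* The sites [s], [s - 1], ... visited until an unoccupied one is reached; the
   first argument is fuel, which does not run out from [L] unless all the sites
   are occupied. *)
Fixpoint pushed_from (L k : nat) (A : {set 'I_L}) (s : 'I_L) : seq 'I_L :=
  if k is k'.+1 then
    if s \in A then s :: pushed_from k' A (ord_pred s) else [::]
  else [::].

Definition pushed (L : nat) (A : {set 'I_L}) (s : 'I_L) : seq 'I_L :=
  pushed_from L A s.

Definition move_left (L : nat) (A : {set 'I_L}) (s : 'I_L) : {set 'I_L} :=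
  [set (if a \in pushed A s then ord_pred a else a) | a in A]%SET.

(* A state is a configuration together with the local currents: the component
   [x] of the second part counts the moves from [x] to [x + 1] minus the moves
   from [x + 1] to [x]. *)
Definition state (L N : nat) : countType :=
  (config L N * {ffun 'I_L -> int})%type.

Definition right_jump (L N : nat) (z z' : state L N) (s : 'I_L) : bool :=
  [&& ordS s \notin occupied z.1,
      occupied z'.1 == move_right (occupied z.1) s
    & z'.2 == [ffun x => z.2 x + (x == s)%:R]].

Definition left_jump (L N : nat) (z z' : state L N) (s : 'I_L) : bool :=
  (occupied z'.1 == move_left (occupied z.1) s) &&
  (z'.2 == [ffun x => z.2 x - (ordS x \in pushed (occupied z.1) s)%:R]).

Definition pushASEP_rate (R : realType) (L N : nat) (p q : R)
    (z z' : state L N) : R :=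
  \sum_(i < N) (p * (right_jump z z' (pos z.1 i))%:R
              + q * (left_jump z z' (pos z.1 i))%:R).

(* [X t] is the configuration at time [t], and [Qloc t x] the local current
   through the edge between [x] and [x + 1] during [0, t]. *)
Definition is_pushASEP (R : realType) (L N : nat) (p q : R) (Y : config L N)
    (d : measure_display) (T : measurableType d) (Pr : probability T R)
    (X : R -> T -> config L N) (Qloc : R -> T -> {ffun 'I_L -> int}) : Prop :=
  is_markov_chain (pushASEP_rate p q) ((Y, [ffun=> 0]) : state L N) Pr
    (fun t omega => (X t omega, Qloc t omega)).

Definition total_current (L : nat) (T : Type)
    (Qloc : T -> {ffun 'I_L -> int}) (omega : T) : int :=
  \sum_(x < L) Qloc omega x.

Definition cexp (R : realType) (z : R[i]) : R[i] :=
  (expR (complex.Re z))%:C * (cos (complex.Im z) +i* sin (complex.Im z)).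

Definition cintegral (R : realType) (a b : R) (f : R -> R[i]) : R[i] :=
  (\int[lebesgue_measure]_(x in `[a, b]) complex.Re (f x))
    +i* (\int[lebesgue_measure]_(x in `[a, b]) complex.Im (f x)).

(* The integral of [f] over the positively oriented circle of centre [c] and
   radius [r]. *)
Definition circle_integral (R : realType) (c : R[i]) (r : R)
    (f : R[i] -> R[i]) : R[i] :=
  cintegral 0 (2 * pi) (fun theta =>
    let e := r%:C * cexp ('i * theta%:C) in f (c + e) * ('i * e)).

Definition oint_z (R : realType) (R' eps' : R) (f : R[i] -> R[i]) : R[i] :=
  ((2 * pi)%:C * 'i)^-1 * (circle_integral 0 R' f - circle_integral 0 eps' f).

Definition oint_w (R : realType) (r eps1 eps2 : R) (f : R[i] -> R[i]) : R[i] :=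
  ((2 * pi)%:C * 'i)^-1 *
    (circle_integral 0 r f - circle_integral 0 eps1 f
     - circle_integral 1 eps2 f).

(* [iter_oint I N F] is [I (fun w_1 => ... I (fun w_N => F [w_1, ..., w_N]))]. *)
Fixpoint iter_oint (C : Type) (I : (C -> C) -> C) (N : nat) :
    (N.-tuple C -> C) -> C :=
  match N return (N.-tuple C -> C) -> C with
  | 0 => fun F => F [tuple]
  | N'.+1 => fun F =>
      I (fun w => iter_oint I (fun ws : N'.-tuple C => F [tuple of w :: ws]))
  end.

Definition has_sum (R : realType) (J : choiceType) (f : J -> R[i]) (s : R[i])
    : Prop :=
  partial_sum (f : J -> R[i]^o) @ totally --> (s : R[i]^o).

Definition h_fun (R : realType) (L N : nat) (w : N.-tuple R[i])
    (Y : config L N) (zeta : R[i]) : R[i] :=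
  \prod_(i < N) (zeta^-1 * tnth w i) ^+ pos Y i.

Definition A_fun (R : realType) (N : nat) (sigma : 'S_N) (w : N.-tuple R[i])
    : R[i] :=
  (-1) ^+ sigma *
  \prod_(j < N) (1 - (tnth w (sigma j))^-1) ^ ((sigma j)%:Z - j%:Z).

Definition u_fun (R : realType) (L N : nat) (w : N.-tuple R[i])
    (X : config L N) (zeta : R[i]) : R[i] :=
  \sum_(sigma : 'S_N)
    A_fun sigma w * \prod_(i < N) (zeta^-1 * tnth w (sigma i)) ^- pos X i.

Definition E_fun (R : realType) (N : nat) (p q : R) (w : N.-tuple R[i])
    : R[i] :=
  \sum_(i < N) (p%:C * tnth w i + q%:C * (tnth w i)^-1 - 1).

Definition p_fun (R : realType) (L N : nat) (z : R[i]) (w : N.-tuple R[i])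
    (zeta : R[i]) : R[i] :=
  1 + (-1) ^+ N * zeta ^+ L * z ^- L * \prod_(i < N) (1 - (tnth w i)^-1).

Definition q_fun (R : realType) (L N : nat) (z w : R[i]) : R[i] :=
  1 - z ^+ L * w ^- L * (1 - w^-1) ^- N.

Definition G_fun (R : realType) (L N : nat) (z : R[i]) (w : N.-tuple R[i])
    (Y : config L N) (zeta : R[i]) : R[i] :=
  h_fun w Y zeta / (p_fun L z w zeta * \prod_(i < N) q_fun L N z (tnth w i)).

Definition contour_exponents (R : realType) (L N : nat) (beta beta1 beta2 : R)
    : Prop :=
  [/\ 1 < beta,
      L%:R / (L%:R - N%:R) < beta1 < L%:R / N%:R,
      L%:R / N%:R < beta2
    & (1 < N)%N -> beta2 < L%:R / (N%:R - 1)].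

(* Main.v *)
Require Import Defs.
From HB Require Import structures.
From mathcomp Require Import all_boot all_order all_algebra all_fingroup.
From mathcomp Require Import finmap complex.
From mathcomp Require Import all_classical all_reals all_analysis.
From mathcomp Require Import summability.
From mathcomp Require Import zify ring lra.

Set Implicit Arguments.
Unset Strict Implicit.
Unset Printing Implicit Defensive.

Import Order.TTheory GRing.Theory Num.Theory.
Import numFieldNormedType.Exports.

Local Open Scope classical_set_scope.
Local Open Scope complex_scope.
Local Open Scope ring_scope.

(** The proof is a coordinate Bethe ansatz, carried out in discrete time so that both sides are
    limits of finite computations.

    For fixed [zeta], consider the vector indexed by [x] whose entries are the sums over Q of zeta^Q
    times the probability of X(t) = x, Q(t) = Q. An Euler step of the chain acts linearly on such
    vectors. By [forward_equation] this action coincides with a free evolution on all of Z^N, where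
    each coordinate moves independently by one, for functions [U] on Z^N with two properties: U(x +
    e_{j+1}) = zeta U(x) whenever x_j = x_{j+1}, which absorbs both exclusion and pushing, and
    invariance under (x_1, ..., x_N) -> (x_2, ..., x_N, x_1 + L), which closes the line into a ring.

    Such [U] are produced as alternating sums [bethe_sum] over permutations of a single function
    [psi a b]. The first property follows from a Pascal rule for [psi] ([bethe_sum_boundary]), the
    second from a cyclic shift rule ([bethe_sum_rotate]). Here [psi a b] is the contour integral of
    the product of the w_i^{b_i} (1 - 1/w_i)^{a_i} divided by p_z and all the q_z(w_i); the
    integrand of the theorem without its exponential is the corresponding alternating sum
    ([integrandE]). The Pascal rule is an identity between integrands.

    The shift rule and the value at time 0 come from expanding 1/p_z and 1/q_z in geometric series.
    The radii make each ratio at most 1/2 or at least 2 in modulus, depending on the circles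
    ([q_ratio_dominated], [p_ratio_dominated]), and the signs of the circles are such that, whatever
    the sign of the exponent, the integral in w becomes the one over the large circle
    ([monomial_branch], from the contour deformation [mean_split]). The integral in z ties the
    exponent in the series of 1/p_z to the sum of the others. What remains is [winding_sum], a sum
    over integer vectors k of products of one-variable integrals I(A, B), which vanish for B < 0 and
    for 0 <= A < B. These vanishings leave finitely many terms, so translating k gives the shift
    rule ([winding_sum_shift]). At time 0 they leave only the identity permutation with k = 0, and
    only when X = Y; this is a statement on affine permutations ([initial_shift_unique]).

    On the probabilistic side, the Chapman-Kolmogorov equation and the behaviour at time 0 bound the
    transition function below by a killed Euler scheme of almost full mass, so expectations of
    bounded functions of (X(t), Q(t)) are within O(1/n) of their values after n Euler steps
    ([lumped_error]). On the analytic side n Euler steps insert the factor (1 + (t/n) E)^n into the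
    integral ([bethe_fun_integral]), which differs from e^{tE} by O(1/n) uniformly on the contours
    ([exponential_limit]). Multiple integrals are handled by uniform approximation with finite sums
    of products of one-variable functions ([total_integral_approx]). Letting n grow gives the
    formula. *)

Section AffinePermutations.

(** * Affine permutations of the integers and periodic configurations *)

Variables (N : nat) (N_gt0 : (0 < N)%N).

Lemma residue_subproof (v : int) : (`|(v %% N)%Z| < N)%N.
Proof. by move: (modz_ge0 v (d := N)) (ltz_pmod v (d := N)); lia. Qed.

Definition residue (v : int) : 'I_N := Ordinal (residue_subproof v).

Lemma residueE (v : int) : (residue v)%:Z = (v %% N)%Z.
Proof. by rewrite /residue /=; move: (modz_ge0 v (d := N)); lia. Qed.

Lemma residueD (r : 'I_N) (t : int) : residue (r%:Z + N%:Z * t) = r.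
Proof.
apply: val_inj; apply/eqP; rewrite -eqz_nat; apply/eqP; rewrite residueE.
by rewrite addrC mulrC modzMDl modz_small //; have := ltn_ord r; lia.
Qed.

Lemma div_residueD (r : 'I_N) (t : int) : ((r%:Z + N%:Z * t) %/ N)%Z = t.
Proof.
rewrite addrC mulrC divzMDl; last by lia.
by rewrite divz_small ?addr0 //; have := ltn_ord r; lia.
Qed.

Lemma sum_residue (f : 'I_N -> int) :
  injective (residue \o f) -> \sum_r (f r %% N)%Z = \sum_(r < N) r%:Z.
Proof.
move=> inj; rewrite [RHS](reindex_inj inj) /=.
by apply: eq_bigr => r _; rewrite residueE.
Qed.

(* [r + N t |-> s r + N t] is an affine permutation with mean displacement 0:
   no half-line is mapped into itself minus its end point. *)
Lemma affine_descent (s : 'I_N -> int) (j : int) :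
    injective (residue \o s) -> \sum_r s r = \sum_(r < N) r%:Z ->
  exists (r : 'I_N) t, j <= r%:Z + N%:Z * t /\ s r + N%:Z * t <= j.
Proof.
move=> inj_s sum_s; apply: contrapT => no_descent.
have shift_inj (f : 'I_N -> int) (c : int) :
    injective (residue \o f) -> injective (residue \o (fun r => f r - c)).
  move=> inj r r' /= /(congr1 (fun x : 'I_N => x%:Z)); rewrite !residueE => e.
  apply: inj; apply: val_inj; apply/eqP; rewrite -eqz_nat !residueE.
  have -> : f r = f r - c + c by lia.
  have -> : f r' = f r' - c + c by lia.
  by apply/eqP; rewrite -modzDml e modzDml.
have inj_id : injective (residue \o (fun r : 'I_N => r%:Z)).
  by move=> r r' /=; rewrite -[r%:Z]addr0 -[r'%:Z]addr0 -(mulr0 N%:Z) !residueD.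
(* [r + N t r] is the least point of the class of [r] that is at least [j]. If all these points were
   mapped above [j], their images minus [j + 1] would be nonnegative with distinct residues, so the
   images would sum to at least N more than they do. *)
pose t (r : 'I_N) := - ((r%:Z - j) %/ N)%Z.
have tE (r : 'I_N) : r%:Z + N%:Z * t r = j + ((r%:Z - j) %% N)%Z.
  by have := divz_eq (r%:Z - j) N; rewrite /t; lia.
have sum_t : \sum_r (s r + N%:Z * t r) = \sum_(r < N) j + \sum_(r < N) r%:Z.
  rewrite big_split /= sum_s -big_split /= (eq_bigr _ (fun r _ => tE r)).
  by rewrite big_split /= (sum_residue (shift_inj _ _ inj_id)).
have : \sum_(r < N) (j + 1) + \sum_(r < N) r%:Z <= \sum_r (s r + N%:Z * t r).
  rewrite -(sum_residue (shift_inj s (j + 1) inj_s)) -big_split /=.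
  apply: ler_sum => r _.
  have lt_j : j < s r + N%:Z * t r.
    rewrite ltNge; apply/negP => le_j; apply: no_descent; exists r, (t r).
    by split=> //; rewrite tE; have := modz_ge0 (r%:Z - j) (d := N); lia.
  have -> : ((s r - (j + 1)) %% N)%Z = ((s r + N%:Z * t r - (j + 1)) %% N)%Z.
    by rewrite addrAC [N%:Z * _]mulrC addrC modzMDl.
  set v := s r + N%:Z * t r - (j + 1).
  have v_ge0 : 0 <= v by rewrite /v; lia.
  have : (v %% N)%Z <= v.
    have := divz_eq v N; have : 0 <= (v %/ N)%Z by rewrite divz_ge0; lia.
    nia.
  by rewrite /v; lia.
rewrite sum_t lerD2r !sumr_const card_ord -(mulr_natr (j + 1)) -(mulr_natr j) !natz.
rewrite mulrDl mul1r; have : 0 < N%:Z by lia.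
by move: (j * N%:Z) N%:Z => u v; lia.
Qed.

Variable L : nat.

(** The configuration unrolled on the universal cover of the ring: a bi-infinite sequence of
    positions, where N further indices make one turn of length L. *)
Definition periodic_lift (x : 'I_N -> int) (n : int) : int :=
  x (residue n) + L%:Z * (n %/ N)%Z.

Lemma periodic_liftD (x : 'I_N -> int) (r : 'I_N) (t : int) :
  periodic_lift x (r%:Z + N%:Z * t) = x r + L%:Z * t.
Proof. by rewrite /periodic_lift residueD div_residueD. Qed.

Lemma int_residueP (n : int) : exists (r : 'I_N) t, n = r%:Z + N%:Z * t.
Proof.
exists (residue n), (n %/ N)%Z; rewrite residueE.
by have := divz_eq n N; lia.
Qed.

Definition cyclically_increasing (x : 'I_N -> int) :=
  (forall i j : 'I_N, (i < j)%N -> x i < x j) /\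
  (forall i j : 'I_N, x i < x j + L%:Z).

Lemma periodic_lift_step (x : 'I_N -> int) (n : int) :
  cyclically_increasing x -> periodic_lift x n + 1 <= periodic_lift x (n + 1).
Proof.
move=> [x_incr x_cyc]; have [r [t ->]] := int_residueP n.
have [lt_rN|le_Nr] := ltnP r.+1 N.
  have -> : r%:Z + N%:Z * t + 1 = (Ordinal lt_rN)%:Z + N%:Z * t by rewrite /=; lia.
  by rewrite !periodic_liftD; have := x_incr r (Ordinal lt_rN) (leqnn _); lia.
have -> : r%:Z + N%:Z * t + 1 = (Ordinal N_gt0)%:Z + N%:Z * (t + 1).
  by rewrite /=; have := ltn_ord r; lia.
by rewrite !periodic_liftD; have := x_cyc r (Ordinal N_gt0); lia.
Qed.

Lemma periodic_lift_expand (x : 'I_N -> int) (m n : int) :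
    cyclically_increasing x -> m <= n ->
  periodic_lift x m + (n - m) <= periodic_lift x n.
Proof.
move=> hx le_mn; have -> : n = m + `|n - m|%N by lia.
elim: `|n - m|%N => [|d IH]; first by rewrite addr0; lia.
have := periodic_lift_step (m + d) hx.
have -> : m + d.+1 = m + d + 1 by lia.
by lia.
Qed.

(** The pair (tau, k) encodes an affine permutation s of mean displacement 0. With xh and yh the
    lifts of x and of y (the latter with its index shifted by m) and j = tau i, one has A = s(j) - j
    and B = yh(s(j)) - xh(j). Nonnegativity of B and the existence of descents give xh <= yh
    everywhere; B <= A gives equality at every j with s(j) >= j. A strict ascent would then
    contradict strict monotonicity of xh, so s <= id, and s = id since the displacements sum to 0.
    The bounds on the positions finally force m = 0. *)
Lemma initial_shift_unique (x y : 'I_N -> int) (tau : 'S_N) (k : 'I_N -> int) :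
    cyclically_increasing x -> cyclically_increasing y ->
    (forall i, 0 <= x i < L%:Z) -> (forall i, 0 <= y i < L%:Z) ->
    (forall i : 'I_N, let A := i%:Z - (tau i)%:Z + \sum_j k j - N%:Z * k i in
               let B := y i - x (tau i) - L%:Z * k i in
               0 <= B /\ (A < 0 \/ B <= A)) ->
  [/\ tau = 1%g, forall i, k i = 0 & x =1 y].
Proof.
move=> hx hy x_bnd y_bnd; set m := \sum_j k j => AB /=.
pose s (r : 'I_N) : int := ((tau^-1)%g r)%:Z - N%:Z * k ((tau^-1)%g r) + m.
pose xh := periodic_lift x; pose yh n := periodic_lift y (n - m).
have s_tau (i : 'I_N) : s (tau i) = i%:Z - N%:Z * k i + m by rewrite /s permK.
have inj_s : injective (residue \o s).
  move=> r r' /= /(congr1 (fun x : 'I_N => x%:Z)); rewrite !residueE => e.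
  apply: (@perm_inj _ (tau^-1)%g).
  rewrite -(residueD ((tau^-1)%g r) (- k ((tau^-1)%g r))).
  rewrite -(residueD ((tau^-1)%g r') (- k ((tau^-1)%g r'))).
  apply: val_inj; apply/eqP; rewrite -eqz_nat !residueE; apply/eqP.
  have -> : ((tau^-1)%g r)%:Z + N%:Z * - k ((tau^-1)%g r) = s r - m.
    by rewrite /s; lia.
  have -> : ((tau^-1)%g r')%:Z + N%:Z * - k ((tau^-1)%g r') = s r' - m.
    by rewrite /s; lia.
  by rewrite -modzDml e modzDml.
(* The terms - N k and m cancel in total because m is the sum of the k. *)
have sum_s : \sum_r s r = \sum_(r < N) r%:Z.
  rewrite (reindex_inj (@perm_inj _ tau)) /=.
  under eq_bigr do rewrite s_tau.
  rewrite !big_split /= sumrN -mulr_sumr -/m sumr_const card_ord -mulr_natl.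
  rewrite -addrA; apply: (canLR (subrK _)); rewrite opprD opprK.
  by rewrite -natz; ring.
have xy (r : 'I_N) (t : int) : xh (r%:Z + N%:Z * t) <= yh (s r + N%:Z * t).
  have [i ->] : exists i, r = tau i by exists ((tau^-1)%g r); rewrite permKV.
  rewrite /xh /yh s_tau.
  have -> : i%:Z - N%:Z * k i + m + N%:Z * t - m = i%:Z + N%:Z * (t - k i) by lia.
  by rewrite !periodic_liftD; have [] := AB i; lia.
have x_lt a b : a < b -> xh a < xh b.
  by move=> lt_ab; have := periodic_lift_expand hx (ltW lt_ab); rewrite /xh; lia.
have y_le a b : a <= b -> yh a + (b - a) <= yh b.
  move=> le_ab; have -> : b - a = (b - m) - (a - m) by ring.
  by apply: periodic_lift_expand; rewrite // lerD2r.
have x_le a b : a <= b -> xh a <= xh b.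
  by rewrite le_eqVlt => /orP[/eqP->|/x_lt/ltW].
(* For a descent a >= j >= s(a): xh(j) <= xh(a) <= yh(s(a)) <= yh(j). *)
have le_xy j : xh j <= yh j.
  have [r [t [le_j s_le]]] := affine_descent j inj_s sum_s.
  apply: le_trans (x_le _ _ le_j) (le_trans (xy r t) _).
  by apply: le_trans (y_le _ _ s_le); rewrite lerDl subr_ge0.
have eq0 (i : 'I_N) : i%:Z = i%:Z + N%:Z * 0 by rewrite mulr0 addr0.
have sE (i : 'I_N) : s (tau i) - (tau i)%:Z = i%:Z - (tau i)%:Z + m - N%:Z * k i.
  by rewrite s_tau; lia.
have BE (i : 'I_N) : yh (s (tau i)) - xh (tau i)%:Z = y i - x (tau i) - L%:Z * k i.
  rewrite /yh /xh s_tau (eq0 (tau i)) periodic_liftD.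
  have -> : i%:Z - N%:Z * k i + m - m = i%:Z + N%:Z * - k i by lia.
  by rewrite periodic_liftD; lia.
(* The lift yh expands distances, so yh(j) + A <= yh(s(j)) = xh(j) + B, and B <= A here. *)
have xy_eq (i : 'I_N) : (tau i)%:Z <= s (tau i) -> xh (tau i)%:Z = yh (tau i)%:Z.
  move=> le_s; have := le_xy (tau i)%:Z; have := y_le _ _ le_s.
  by have [_] := AB i; rewrite -BE -sE; lia.
(* At an ascent j both lifts agree, so the descent found over j must be j itself, which is
   absurd. *)
have s_le (i : 'I_N) : s (tau i) <= (tau i)%:Z.
  rewrite leNgt; apply/negP => lt_s.
  have [r [t [le_j s_le]]] := affine_descent (tau i)%:Z inj_s sum_s.
  have := xy_eq i (ltW lt_s); have := xy r t; have := y_le _ _ s_le.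
  move: le_j; rewrite le_eqVlt => /orP[/eqP e|/x_lt]; last by lia.
  move: s_le lt_s; have re : r = tau i.
    by rewrite -(residueD r t) -e (eq0 (tau i)) residueD.
  move: e; rewrite re => e; have -> : N%:Z * t = 0 by lia.
  lia.
have s_eq (r : 'I_N) : s r = r%:Z.
  have le_s (q : 'I_N) : s q <= q%:Z by have := s_le ((tau^-1)%g q); rewrite permKV.
  apply/eqP; rewrite eq_le le_s /= -subr_le0.
  have := sum_s; rewrite (bigD1 r) //= [RHS](bigD1 r) //= => e.
  have : \sum_(i < N | i != r) s i <= \sum_(i < N | i != r) i%:Z.
    by apply: ler_sum => i _; exact: le_s.
  move: (\sum_(i < N | i != r) s i) (\sum_(i < N | i != r) i%:Z) e => u v.
  by move: (s r) => w; lia.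
have xy_r (r : 'I_N) : x r = yh r%:Z.
  have := xy_eq ((tau^-1)%g r); rewrite permKV s_eq => /(_ (lexx _)) <-.
  by rewrite /xh (eq0 r) periodic_liftD mulr0 addr0.
(* Positions in [0, L) have indices in the window 0, ..., N - 1, and the shift by m maps this window
   into itself. *)
have m0 : m = 0.
  have ltN : (N.-1 < N)%N by lia.
  have in_window (r : 'I_N) : exists2 a : 'I_N, r%:Z - m = a%:Z & True.
    have [a [u e]] := int_residueP (r%:Z - m); exists a => //.
    have := x_bnd r; rewrite xy_r /yh e periodic_liftD; have := y_bnd a.
    move: (y a) => v /andP[v0 vL] /andP[w0 wL].
    suff -> : u = 0 by rewrite mulr0 addr0.
    by move: v0 vL w0 wL; clear; nia.
  have [a ea _] := in_window (Ordinal N_gt0).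
  have [b eb _] := in_window (Ordinal ltN).
  by move: ea eb; have := ltn_ord a; have := ltn_ord b; rewrite /=; lia.
have tauE (i : 'I_N) : i%:Z - (tau i)%:Z = N%:Z * k i by have := sE i; rewrite s_eq; lia.
have k0 (i : 'I_N) : k i = 0.
  have := tauE i; have := ltn_ord i; have := ltn_ord (tau i); nia.
split=> //.
  by apply/permP => i; rewrite perm1; apply: val_inj; have := tauE i; rewrite k0 /=; lia.
by move=> r; rewrite xy_r /yh m0 subr0 (eq0 r) periodic_liftD mulr0 addr0.
Qed.
End AffinePermutations.

(** * Sums over winding vectors *)

Lemma eq_sum_support (K : nmodType) (T : eqType) (s1 s2 : seq T) (F : T -> K) :
    uniq s1 -> uniq s2 -> (forall k, F k != 0 -> k \in s1) ->
    (forall k, F k != 0 -> k \in s2) ->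
  \sum_(k <- s1) F k = \sum_(k <- s2) F k.
Proof.
move=> u1 u2 h1 h2.
have restrict s : \sum_(k <- s) F k = \sum_(k <- [seq k <- s | F k != 0]) F k.
  rewrite big_filter [RHS]big_mkcond /=; apply: eq_bigr => k _.
  by case: ifPn => // /negPn /eqP.
rewrite restrict [RHS]restrict; apply: perm_big; apply: uniq_perm.
- exact: filter_uniq.
- exact: filter_uniq.
move=> k; rewrite !mem_filter; case: (boolP (F k != 0)) => //= nz.
by rewrite h1 // h2.
Qed.

Section WindingSums.
Variables (K : fieldType) (N L : nat) (I : int -> int -> K) (c : K).
Hypotheses (N_gt0 : (0 < N)%N) (ltNL : (N < L)%N) (c_neq0 : c != 0).
Hypothesis I_neg : forall A B, B < 0 -> I A B = 0.
Hypothesis I_gap : forall A B, 0 <= A -> A < B -> I A B = 0.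
Hypothesis I00 : I 0 0 = 1.

(** One term of the expanded integral: [k i] is the exponent in the geometric series of 1/q_z(w_i),
    and the exponent in the series of 1/p_z has been forced by the integral in z to be the sum of
    the [k i]. [I A B] stands for the integral of w^B (1 - 1/w)^A dw/w over the large circle. *)
Definition winding_term (a b : 'I_N -> int) (k : {ffun 'I_N -> int}) : K :=
  c ^ (\sum_i k i) *
  \prod_i I (a i + \sum_j k j - N%:Z * k i) (b i - L%:Z * k i).

Definition box_point (m : nat) (kappa : {ffun 'I_N -> 'I_(m + m)}) :
  {ffun 'I_N -> int} := [ffun i => (kappa i)%:Z - m%:Z].

Definition winding_sum (m : nat) (a b : 'I_N -> int) : K :=
  \sum_(kappa : {ffun 'I_N -> 'I_(m + m)}) winding_term a b (box_point kappa).

Lemma winding_term_neq0 a b k i : winding_term a b k != 0 ->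
  let A := a i + \sum_j k j - N%:Z * k i in let B := b i - L%:Z * k i in
  0 <= B /\ (A < 0 \/ B <= A).
Proof.
rewrite /winding_term mulf_eq0 negb_or => /andP[_ /prodf_neq0 /(_ i isT) nz] /=.
split; first by rewrite leNgt; apply: contra nz => /I_neg ->.
have [|A_ge0] := ltP (a i + \sum_j k j - N%:Z * k i) 0; first by left.
right; rewrite leNgt; apply: contra nz => /I_gap -> //; exact: eqxx.
Qed.

(** The conditions B >= 0 bound every [k i] above. The numbers A sum to the sum of the [a i], which
    is nonnegative, so some A is nonnegative; for that index B <= A bounds the sum of the [k j]
    below, since N < L. Together the two bounds confine each [k j]. *)
Lemma winding_term_support a b : 0 <= \sum_i a i -> exists M : nat,
  forall k, winding_term a b k != 0 -> forall i, - M%:Z <= k i < M%:Z.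
Proof.
move=> a_ge0; pose M0 := (\sum_i (`|a i| + `|b i|))%N.
have M0_ge (i : 'I_N) : `|a i| + `|b i| <= M0%:Z.
  by rewrite /M0 (bigD1 i) //=; lia.
exists ((N + L + 2) * M0.+1)%N => k nz.
have k_le i : k i <= M0%:Z.
  have [B_ge0 _] := winding_term_neq0 i nz; have := M0_ge i.
  by clear -B_ge0 ltNL; nia.
have [i A_ge0] : exists i, 0 <= a i + \sum_j k j - N%:Z * k i.
  apply: contrapT => noA; suff : \sum_i (a i + \sum_j k j - N%:Z * k i) < 0.
    rewrite !big_split /= sumrN -mulr_sumr sumr_const card_ord -mulr_natl natz.
    by rewrite addrK ltNge a_ge0.
  have A_le (i : 'I_N) : a i + \sum_j k j - N%:Z * k i <= -1.
    suff : a i + \sum_j k j - N%:Z * k i < 0 by lia.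
    by rewrite ltNge; apply/negP => ?; apply: noA; exists i.
  apply: (@le_lt_trans _ _ (\sum_(i < N) -1)); first by apply: ler_sum.
  by rewrite sumr_const card_ord -mulr_natl natz; lia.
have sum_ge : b i - a i <= \sum_j k j + (L%:Z - N%:Z) * k i.
  have [_] := winding_term_neq0 i nz; move: A_ge0.
  by clear; lia.
move=> j; rewrite andbC; apply/andP; split.
  by have := k_le j; clear; nia.
have sum_le : \sum_l k l <= k j + N%:Z * M0%:Z.
  rewrite (bigD1 j) //= lerD2l.
  apply: (@le_trans _ _ (\sum_(l < N | l != j) M0%:Z)).
    by apply: ler_sum => l _; exact: k_le.
  apply: (@le_trans _ _ (\sum_(l < N) M0%:Z)).
    by rewrite [leRHS](bigD1 j) //= lerDr.
  by rewrite sumr_const card_ord -mulr_natl natz.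
have := k_le i; have := M0_ge i; move: sum_ge sum_le ltNL; clear.
by nia.
Qed.

Lemma box_point_inj m : injective (@box_point m).
Proof.
move=> kappa kappa' /ffunP e; apply/ffunP => i; apply: val_inj.
by have := e i; rewrite !ffunE /=; lia.
Qed.

Lemma box_pointP m (k : {ffun 'I_N -> int}) :
  (forall i, - m%:Z <= k i < m%:Z) -> exists kappa, k = @box_point m kappa.
Proof.
move=> k_bnd; have lt_k i : (`|(k i + m%:Z)%R| < m + m)%N.
  by have := k_bnd i; lia.
exists [ffun i => Ordinal (lt_k i)]; apply/ffunP => i; rewrite !ffunE /=.
by have := k_bnd i; lia.
Qed.

(** Translating [k] by the i-th unit vector produces the factor c and exactly the stated change of a
    and b. Once the box contains the support with a margin of one, the translation does not change
    the sum. *)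
Lemma winding_sum_shift a b i : 0 <= \sum_i a i -> exists m0,
  forall m, (m0 <= m)%N ->
  c * winding_sum m (fun j => a j + 1 - (j == i)%:R * N%:Z)
                    (fun j => b j - (j == i)%:R * L%:Z) = winding_sum m a b.
Proof.
move=> /(winding_term_support b) [M supp]; exists M.+1 => m lt_Mm.
pose shift (k : {ffun 'I_N -> int}) := [ffun j => k j + (j == i)%:R].
have shift_inj : injective shift.
  move=> k k' /ffunP e; apply/ffunP => j; have := e j; rewrite !ffunE.
  exact: addIr.
have sum_shift k : \sum_j shift k j = \sum_j k j + 1.
  under eq_bigr do rewrite ffunE; rewrite big_split /=; congr (_ + _).
  rewrite (bigD1 i) //= eqxx big1 ?addr0 // => j /negPf ->.
  by [].
pose box := [seq @box_point m kappa | kappa : {ffun 'I_N -> 'I_(m + m)}].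
have box_uniq : uniq box.
  by rewrite map_inj_uniq ?enum_uniq //; exact: box_point_inj.
have sum_box F : \sum_(kappa : {ffun 'I_N -> 'I_(m + m)}) F (box_point kappa)
    = \sum_(k <- box) F k :> K.
  by rewrite big_map big_enum.
rewrite /winding_sum !(sum_box) mulr_sumr.
have -> : \sum_(k <- box) c * winding_term
      (fun j => a j + 1 - (j == i)%:R * N%:Z)
      (fun j => b j - (j == i)%:R * L%:Z) k
    = \sum_(k <- [seq shift k | k <- box]) winding_term a b k.
  rewrite [RHS]big_map; apply: eq_bigr => k _.
  rewrite /winding_term sum_shift expfzDr // expr1z [_ * c]mulrC -mulrA.
  congr (c * (_ * _)).
  by apply: eq_bigr => j _; rewrite !ffunE; congr (I _ _); ring.
apply: eq_sum_support => //.
- by rewrite map_inj_uniq.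
- move=> k nz; apply/mapP; exists [ffun j => k j - (j == i)%:R].
    have [|kappa e] := @box_pointP m [ffun j => k j - (j == i)%:R].
      by move=> j; rewrite ffunE; have := supp _ nz j; case: (j == i) => /=; rewrite ?mulr1n ?mulr0n; move: (k j) lt_Mm => u; lia.
    by rewrite e; apply/mapP; exists kappa => //; rewrite mem_enum.
  by apply/ffunP => j; rewrite !ffunE; ring.
- move=> k nz; have [|kappa ->] := @box_pointP m k.
    by move=> j; have := supp _ nz j; lia.
  by apply/mapP; exists kappa => //; rewrite mem_enum.
Qed.

Lemma winding_sum_initial m (x y : 'I_N -> int) : (0 < m)%N ->
    cyclically_increasing L x -> cyclically_increasing L y ->
    (forall i, 0 <= x i < L%:Z) -> (forall i, 0 <= y i < L%:Z) ->
  \sum_(tau : 'S_N) (-1) ^+ tau *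
    winding_sum m (fun i => i%:Z - (tau i)%:Z) (fun i => y i - x (tau i))
  = [forall i, x i == y i]%:R.
Proof.
move=> m_gt0 hx hy x_bnd y_bnd.
have uniq_term (tau : 'S_N) (kappa : {ffun 'I_N -> 'I_(m + m)}) :
    winding_term (fun i => i%:Z - (tau i)%:Z) (fun i => y i - x (tau i))
      (box_point kappa) != 0 ->
    [/\ tau = 1%g, (forall i, box_point kappa i = 0) & x =1 y].
  move=> nz; apply: (initial_shift_unique N_gt0 hx hy x_bnd y_bnd).
  by move=> i; apply: (winding_term_neq0 i nz).
have lt0 : (m < m + m)%N by lia.
pose kappa0 : {ffun 'I_N -> 'I_(m + m)} := [ffun=> Ordinal lt0].
rewrite (bigD1 1%g) //= big1 ?addr0; last first.
  move=> tau ntau; rewrite /winding_sum big1 ?mulr0 // => kappa _.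
  by apply/eqP; apply: contraTT ntau => /uniq_term[-> _ _]; rewrite eqxx.
rewrite odd_perm1 expr0 mul1r /winding_sum (bigD1 kappa0) //= big1 ?addr0.
  case: forallP => [xy|nxy].
    have k0 i : box_point kappa0 i = 0 by rewrite !ffunE subrr.
    have sum0 : \sum_j box_point kappa0 j = 0 by rewrite big1.
    rewrite /winding_term sum0 expr0z mul1r big1 // => i _.
    by rewrite k0 !mulr0 !subr0 perm1 (eqP (xy i)) !subrr.
  apply/eqP; apply: contrapT => /negP nz; apply: nxy => i.
  by have [_ _ ->] := uniq_term _ _ nz.
move=> kappa nk; apply/eqP; apply: contraTT nk => /uniq_term[_ k0 _].
rewrite negbK; apply/eqP; apply: box_point_inj; apply/ffunP => i.
by rewrite k0 !ffunE subrr.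
Qed.
End WindingSums.

(** * The Bethe ansatz *)

Definition bump_at (N : nat) (x : 'I_N -> int) (j : 'I_N) (d : int) :
  'I_N -> int := fun i => x i + (i == j)%:R * d.

(** The same set of particles on the ring, relabelled: the first particle becomes the last, one turn
    ahead. *)
Definition rotate_coord (N L : nat) (x : 'I_N -> int) : 'I_N -> int :=
  fun i => x (ordS i) + (i.+1 == N)%:R * L%:Z.

Definition cycle_perm (N : nat) : 'S_N := perm (@ordS_inj N).

Lemma odd_cycle_perm (N : nat) : (0 < N)%N -> odd_perm (cycle_perm N) = odd N.-1.
Proof.
case: N => // n _.
have -> : cycle_perm n.+1 = lift_perm ord_max ord0 1%g.
  apply/permP => i; rewrite permE; have [j ->|->] := unliftP ord_max i.
    rewrite lift_perm_lift perm1; apply: val_inj => /=.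
    by rewrite /bump leqNgt ltn_ord add0n leq0n add1n modn_small // ltnS.
  by rewrite lift_perm_id; apply: val_inj; rewrite /= modnn.
by rewrite odd_lift_perm odd_perm1 addbF /= addbF.
Qed.

Lemma sum_bump_at (N : nat) (x : 'I_N -> int) (j : 'I_N) (d : int) :
  \sum_i bump_at x j d i = \sum_i x i + d.
Proof.
rewrite big_split /=; congr (_ + _).
rewrite (bigD1 j) //= eqxx mul1r big1 ?addr0 // => i /negPf ->.
by rewrite mul0r.
Qed.

Section BetheAnsatz.
Variables (K : numFieldType) (N L : nat) (zeta : K) (y : 'I_N -> int).
Hypotheses (N_gt0 : (0 < N)%N) (zeta_neq0 : zeta != 0).

(** The sum over sigma in u, with tau the inverse of sigma and the exponents of each w_i collected:
    i - tau(i) on 1 - 1/w_i and y_i - x_{tau(i)} on w_i. *)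
Definition bethe_sum (psi : ('I_N -> int) -> ('I_N -> int) -> K)
    (x : 'I_N -> int) : K :=
  zeta ^ (\sum_i x i - \sum_i y i) * \sum_(tau : 'S_N) (-1) ^+ tau *
    psi (fun i => i%:Z - (tau i)%:Z) (fun i => y i - x (tau i)).

Lemma bump_perm (x : 'I_N -> int) (tau : 'S_N) (j : 'I_N) (d : int) :
  (fun i => y i - bump_at x j d (tau i))
  = bump_at (fun i => y i - x (tau i)) ((tau^-1)%g j) (- d).
Proof.
apply/funext => i; rewrite /bump_at (canF_eq (permK tau)).
by rewrite opprD addrA mulrN.
Qed.

(** By the Pascal rule the difference of the two sides is, up to a factor, an alternating sum of
    [g tau], where the exponent a at the preimage of [j'] has been raised by one. As j' = j + 1,
    that exponent now has the form i - j, as has the one at the preimage of [j]; since also x_j =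
    x_{j'}, composing tau with the transposition leaves [g] unchanged. The sum is thus its own
    opposite. *)
Lemma bethe_sum_boundary (psi : ('I_N -> int) -> ('I_N -> int) -> K)
    (x : 'I_N -> int) (j j' : 'I_N) :
    (forall a b i, psi (bump_at a i 1) b = psi a b - psi a (bump_at b i (- 1))) ->
    j' = j.+1 :> nat -> x j = x j' ->
  bethe_sum psi (bump_at x j' 1) = zeta * bethe_sum psi x.
Proof.
move=> pascal jj' x_jj'; rewrite /bethe_sum sum_bump_at addrAC.
rewrite expfzDr // expr1z mulrAC -mulrA [RHS]mulrCA; congr (_ * _).
rewrite mulrC; congr (_ * _); apply/eqP; rewrite -subr_eq0 -opprB oppr_eq0.
rewrite -sumrB; under eq_bigr do rewrite bump_perm -mulrBr -pascal.
pose g (tau : 'S_N) := psi (bump_at (fun i => i%:Z - (tau i)%:Z) ((tau^-1)%g j') 1)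
  (fun i => y i - x (tau i)).
have g_swap tau : g (tau * tperm j j')%g = g tau.
  rewrite /g invMg tpermV permM; congr psi; apply/funext => i.
    rewrite /bump_at permM tpermR -!(canF_eq (permK tau)).
    case: tpermP => [->|->|/eqP/negPf nj /eqP/negPf nj'].
    - by rewrite eqxx; case: eqP jj' => [/(congr1 val) /=|_]; lia.
    - by rewrite eqxx; case: eqP jj' => [/(congr1 val) /=|_]; lia.
    - by rewrite nj nj'.
  by rewrite permM; case: tpermP => // ->; rewrite x_jj'.
rewrite -/(\sum_(tau : 'S_N) (-1) ^+ tau * g tau).
set S := \sum_tau _; have : S = - S.
  rewrite {1}/S (reindex_inj (mulIg (tperm j j'))) /= -sumrN.
  apply: eq_bigr => tau _; rewrite g_swap odd_permM odd_tperm.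
  have -> : (j != j') by apply/eqP => /(congr1 val) /=; lia.
  by rewrite addbT signrN mulNr.
by move/eqP; rewrite -addr_eq0 -mulr2n mulrn_eq0.
Qed.

(** Rotation amounts to composing tau with the N-cycle, of sign (-1)^(N-1), and raises the total of
    the coordinates by L. The factor (-1)^(N+1) zeta^L in the hypothesis absorbs both. *)
Lemma bethe_sum_rotate (psi : ('I_N -> int) -> ('I_N -> int) -> K)
    (x : 'I_N -> int) :
    (forall a b i, \sum_j a j = 0 ->
      (-1) ^+ N.+1 * zeta ^+ L *
        psi (fun j => a j + 1 - (j == i)%:R * N%:Z)
            (fun j => b j - (j == i)%:R * L%:Z) = psi a b) ->
  bethe_sum psi (rotate_coord L x) = bethe_sum psi x.
Proof.
move=> shift; rewrite /bethe_sum.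
have ltN : (N.-1 < N)%N by lia.
have lastP (i : 'I_N) : (i.+1 == N) = (i == Ordinal ltN).
  by rewrite -val_eqE /=; lia.
have -> : \sum_i rotate_coord L x i = \sum_i x i + L%:Z.
  rewrite big_split /= [in RHS](reindex_inj (@ordS_inj N)) /=; congr (_ + _).
  rewrite (bigD1 (Ordinal ltN)) // lastP eqxx mul1r big1 /= ?addr0 // => i.
  by rewrite lastP => /negPf ->; rewrite mul0r.
rewrite addrAC expfzDr // -mulrA; congr (_ * _).
rewrite [RHS](reindex_inj (mulIg (cycle_perm N))) mulr_sumr /=.
apply: eq_bigr => tau _; rewrite odd_permM odd_cycle_perm //.
rewrite -[in RHS](shift _ _ ((tau^-1)%g (Ordinal ltN))); last first.
  by rewrite sumrB; apply/eqP; rewrite subr_eq0; apply/eqP/(reindex_inj perm_inj).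
rewrite signr_addb !mulrA; congr (_ * _).
  rewrite [RHS]mulrC; congr (_ * _).
  rewrite signr_odd -mulrA -exprD.
  have -> : (N.-1 + N.+1 = 2 * N)%N by lia.
  by rewrite exprM sqrrN !expr1n mulr1.
congr psi; apply/funext => i.
  rewrite permM permE -(canF_eq (permK tau)) -lastP /=.
  have := ltn_ord (tau i); case: eqP => [e|nN] lt_N.
    by rewrite e modnn mul1r; lia.
  by rewrite modn_small ?mul0r; lia.
by rewrite /rotate_coord permM permE -(canF_eq (permK tau)) -lastP opprD addrA.
Qed.

(** Moving b at i by one is moving x at tau(i) by one in the opposite direction; the prefactor
    zeta^(sum x) turns this into the weights p zeta and q / zeta of the current. *)
Lemma bethe_sum_evolution (psi psi' : ('I_N -> int) -> ('I_N -> int) -> K)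
    (s p q : K) (x : 'I_N -> int) :
    (forall a b, psi' a b = psi a b + s * \sum_i
      (p * psi a (bump_at b i 1) + q * psi a (bump_at b i (- 1)) - psi a b)) ->
  bethe_sum psi' x = bethe_sum psi x + s * \sum_j
    (p * (zeta * bethe_sum psi (bump_at x j (- 1)))
     + q * (zeta^-1 * bethe_sum psi (bump_at x j 1)) - bethe_sum psi x).
Proof.
move=> evol; rewrite /bethe_sum; set Z := zeta ^ _.
have Z_shift d : zeta ^ (\sum_i x i + d - \sum_i y i) = zeta ^ d * Z.
  by rewrite addrAC expfzDr // mulrC.
under [X in _ = _ + s * X]eq_bigr => j _.
  rewrite !sum_bump_at !Z_shift exprN1 expr1z !mulrA mulfK // mulfVK // -!mulrA.
  over.
under [X in Z * X = _]eq_bigr do rewrite evol mulrDr.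
rewrite big_split mulrDr; congr (_ + _).
have S_up j : \sum_(tau : 'S_N) (-1) ^+ tau * psi (fun i => i%:Z - (tau i)%:Z)
      (fun i => y i - bump_at x j (- 1) (tau i))
    = \sum_(tau : 'S_N) (-1) ^+ tau * psi (fun i => i%:Z - (tau i)%:Z)
      (bump_at (fun i => y i - x (tau i)) ((tau^-1)%g j) 1).
  by apply: eq_bigr => tau _; rewrite bump_perm opprK.
have S_dn j : \sum_(tau : 'S_N) (-1) ^+ tau * psi (fun i => i%:Z - (tau i)%:Z)
      (fun i => y i - bump_at x j 1 (tau i))
    = \sum_(tau : 'S_N) (-1) ^+ tau * psi (fun i => i%:Z - (tau i)%:Z)
      (bump_at (fun i => y i - x (tau i)) ((tau^-1)%g j) (- 1)).
  by apply: eq_bigr => tau _; rewrite bump_perm.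
under [X in _ = _ * X]eq_bigr => j _.
  rewrite S_up S_dn ![_ * (Z * _)]mulrCA -!mulrDr -mulrBr !mulr_sumr -big_split -sumrB /=.
  over.
rewrite -mulr_sumr mulrCA; congr (_ * _).
rewrite exchange_big /= mulr_sumr; apply: eq_bigr => tau _.
rewrite mulrCA; congr (_ * _).
rewrite [RHS](reindex_inj (@perm_inj _ tau)) mulr_sumr /=.
apply: eq_bigr => i _; rewrite permK.
by rewrite mulrBr mulrDr !(mulrCA ((-1) ^+ tau)).
Qed.
End BetheAnsatz.

(** * Configurations and their lifts *)

Section Configurations.
Variables (L N : nat).
Implicit Types X : config L N.

Definition coord X : 'I_N -> int := fun i => (pos X i)%:Z.

Lemma pos_ltn X (i j : 'I_N) : (i < j)%N -> (pos X i < pos X j)%N.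
Proof.
move=> lt_ij; have := valP X => /(sorted_ltn_nth ltn_trans 0%N) mono.
have := mono i j; rewrite !inE size_map size_tuple !ltn_ord => /(_ isT isT lt_ij).
have nthE (k : 'I_N) : nth 0%N [seq val s | s <- val X] k = pos X k.
  by rewrite (nth_map (pos X k)) ?size_tuple // -tnth_nth.
by rewrite !nthE.
Qed.

Lemma pos_inj X : injective (pos X).
Proof.
move=> i j e; apply: val_inj => /=.
by case: (ltngtP i j) => // /(pos_ltn X); rewrite e ltnn.
Qed.

Lemma coord_cyclic X : cyclically_increasing L (coord X).
Proof.
split=> [i j /(pos_ltn X)|i j]; rewrite /coord; first by rewrite ltz_nat.
by have := ltn_ord (pos X i); lia.
Qed.

Lemma coord_bound X i : 0 <= coord X i < L%:Z.
Proof. by rewrite /coord; have := ltn_ord (pos X i); lia. Qed.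

Lemma card_occupied X : #|occupied X| = N.
Proof. by rewrite /occupied card_imset ?card_ord //; exact: pos_inj. Qed.

Lemma occupied_inj : injective (@occupied L N).
Proof.
move=> X X' e; apply/val_inj/val_inj/(inj_map val_inj).
apply: (irr_sorted_eq ltn_trans ltnn); [exact: (valP X)|exact: (valP X')|].
have mem_occ Y (s : 'I_L) : (s \in occupied Y) = (s \in val (val Y)).
  apply/imsetP/tnthP => -[ i]; first by move=> _ ->; exists i.
  by move=> ->; exists i.
move=> v; apply/mapP/mapP => -[s s_in ->]; exists s => //.
  by rewrite -mem_occ -e mem_occ.
by rewrite -mem_occ e mem_occ.
Qed.

Lemma config_of_set (A : {set 'I_L}) : #|A| = N -> exists X, occupied X = A.
Proof.
move=> cardA; have szA : size (enum A) == N by rewrite -cardE cardA.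
have sortA : sorted ltn [seq val i | i <- Tuple szA].
  apply: (subseq_sorted ltn_trans _ (iota_ltn_sorted 0 L)) => /=.
  by rewrite -val_enum_ord map_subseq // enumT filter_subseq.
exists (exist _ (Tuple szA) sortA); apply/setP => s; rewrite -[RHS]mem_enum.
apply/imsetP/(tnthP (Tuple szA)) => -[ i]; first by move=> _ ->; exists i.
by move=> ->; exists i.
Qed.

Lemma sum_occupied (K : nmodType) X (F : 'I_L -> K) :
  \sum_i F (pos X i) = \sum_(s in occupied X) F s.
Proof. by rewrite /occupied big_imset //= => i j _ _; exact: pos_inj. Qed.

Lemma sum_config_of_set (K : nmodType) (A : {set 'I_L}) (X : config L N)
    (F : config L N -> K) : occupied X = A ->
  \sum_(Y : config L N) F Y *+ (occupied Y == A) = F X.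
Proof.
move=> <-; rewrite (bigD1 X) //= eqxx big1 ?addr0 // => Y /negPf nYX.
by case: eqP => // /occupied_inj e; rewrite e eqxx in nYX.
Qed.

Variables (N_gt0 : (0 < N)%N) (L_gt0 : (0 < L)%N).
Local Notation lift := (periodic_lift N_gt0 L).
Local Notation site := (residue L_gt0).

Lemma lift_occupied X (v : int) :
  (exists n, lift (coord X) n = v) <-> site v \in occupied X.
Proof.
split=> [[n <-]|/imsetP[i _ e]].
  have [i [t ->]] := int_residueP N_gt0 n.
  by rewrite periodic_liftD residueD; apply/imsetP; exists i.
exists (i%:Z + N%:Z * (v %/ L)%Z); rewrite periodic_liftD /coord -e residueE.
by have := divz_eq v L; lia.
Qed.

Section Rotation.
Variables (K : Type) (U : ('I_N -> int) -> K).
Hypothesis U_rotate : forall x, U (rotate_coord L x) = U x.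

Lemma rotate_lift (x : 'I_N -> int) (m : int) :
  rotate_coord L (fun i : 'I_N => lift x (i%:Z + m)) = fun i : 'I_N => lift x (i%:Z + (m + 1)).
Proof.
apply/funext => i; rewrite /rotate_coord.
have -> : (ordS i)%:Z + m = i%:Z + (m + 1) - N%:Z * (i.+1 == N)%:R.
  rewrite /=; have := ltn_ord i; case: eqP => [e|nN] lt_iN.
    by rewrite e modnn mulr1; lia.
  by rewrite modn_small ?mulr0; lia.
have [r [t ->]] := int_residueP N_gt0 (i%:Z + (m + 1)).
move: ((i.+1 == N)%:R : int) => b.
have -> : r%:Z + N%:Z * t - N%:Z * b = r%:Z + N%:Z * (t - b) by ring.
by rewrite !periodic_liftD; ring.
Qed.

Lemma U_lift (x : 'I_N -> int) (m : int) : U (fun i : 'I_N => lift x (i%:Z + m)) = U x.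
Proof.
have U0 : U (fun i : 'I_N => lift x (i%:Z + 0)) = U x.
  by congr U; apply/funext => i; rewrite -(mulr0 N%:Z) periodic_liftD mulr0 addr0.
have US k : U (fun i : 'I_N => lift x (i%:Z + (k + 1))) = U (fun i : 'I_N => lift x (i%:Z + k)).
  by rewrite -rotate_lift U_rotate.
elim/int_ind: m => [//|n <-|n <-].
  by rewrite -(US n); congr U; apply/funext => i; congr (lift x); lia.
by rewrite -(US (- n.+1%:Z)); congr U; apply/funext => i; congr (lift x); lia.
Qed.

Lemma lift_lt_mono (x : 'I_N -> int) (m n : int) : cyclically_increasing L x ->
  (lift x m < lift x n) = (m < n).
Proof.
move=> hx; case: (ltP m n) => [lt_mn|le_nm].
  by have := periodic_lift_expand N_gt0 hx (ltW lt_mn); lia.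
by have := periodic_lift_expand N_gt0 hx le_nm; lia.
Qed.

(** The two lifts are strictly increasing enumerations of the same set of integers, namely the
    preimage of the occupied sites, so they differ by a shift m of the index. Hence z is a window of
    the lift of X, and rotation invariance applies. *)
Lemma U_same_sites (z : 'I_N -> int) X : cyclically_increasing L z ->
  (forall i, site (z i) \in occupied X) -> U z = U (coord X).
Proof.
move=> hz z_occ; have hx := coord_cyclic X.
have z_inj : injective (site \o z).
  move=> i j /= /(congr1 (fun s : 'I_L => s%:Z)); rewrite !residueE => e.
  have : (L%:Z %| z i - z j)%Z by rewrite -eqz_mod_dvd; apply/eqP.
  move=> /dvdzP[t zt].
  have [zi zj] := (hz.2 i j, hz.2 j i).
  have t0 : t = 0 by move: zt zi zj; move: (z i) (z j) => u v; nia.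
  apply: val_inj; case: (ltngtP i j) => // /(hz.1 _ _); move: zt; rewrite t0 mul0r.
    by move: (z i) (z j) => u v; lia.
  by move: (z i) (z j) => u v; lia.
have occE : occupied X = [set site (z i) | i : 'I_N]%SET.
  apply/esym/eqP; rewrite eqEcard card_occupied card_imset ?card_ord ?leqnn //.
  rewrite andbT; apply/fintype.subsetP => s /imsetP[i _ ->]; exact: z_occ.
have z_in_x n : exists m, lift (coord X) m = lift z n.
  apply/lift_occupied; have [i [t ->]] := int_residueP N_gt0 n.
  rewrite periodic_liftD; suff -> : site (z i + L%:Z * t) = site (z i) by [].
  by apply: val_inj; apply/eqP; rewrite -eqz_nat !residueE addrC mulrC modzMDl.
have x_in_z m : exists n, lift z n = lift (coord X) m.
  have : site (lift (coord X) m) \in occupied X by apply/lift_occupied; exists m.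
  rewrite occE => /imsetP[i _ e].
  have [t et] : exists t, lift (coord X) m = z i + L%:Z * t.
    have := congr1 (fun s : 'I_L => s%:Z) e; rewrite !residueE => e'.
    have := divz_eq (lift (coord X) m) L; have := divz_eq (z i) L; rewrite e'.
    move: (lift _ m) (z i) => u v ev eu.
    by exists ((u %/ L)%Z - (v %/ L)%Z); rewrite {1}ev {1}eu; ring.
  by exists (i%:Z + N%:Z * t); rewrite periodic_liftD.
have [m zm] := z_in_x 0.
(* Both enumerations send successors to successors, so agreement at one index propagates. *)
have zk (k : nat) : lift z k%:Z = lift (coord X) (k%:Z + m).
  elim: k => [|k IH]; first by rewrite add0r.
  have [m' em'] := z_in_x k.+1%:Z.
  have lt_m' : k%:Z + m < m'.
    by rewrite -(lift_lt_mono _ _ hx) em' -IH lift_lt_mono //; lia.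
  have [n' en'] := x_in_z (k.+1%:Z + m).
  have lt_n' : k%:Z < n'.
    by rewrite -(lift_lt_mono _ _ hz) IH en' lift_lt_mono //; lia.
  rewrite -em'; apply/eqP; rewrite eq_le !leNgt !lift_lt_mono //.
  rewrite andbC; apply/andP; split; first by apply/negP; lia.
  rewrite -(lift_lt_mono _ _ hx) em' -en' lift_lt_mono //.
  by apply/negP; lia.
rewrite -(U_lift (coord X) m); congr U; apply/funext => i.
by rewrite -zk -[i%:Z]addr0 -(mulr0 N%:Z) periodic_liftD mulr0 addr0.
Qed.
End Rotation.
End Configurations.

(** * Arithmetic of residues *)

Section Residues.
Variables (N : nat) (N_gt0 : (0 < N)%N).
Local Notation res := (residue N_gt0).

Lemma residue_eqP (u v : int) : reflect ((u %% N)%Z = (v %% N)%Z) (res u == res v).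
Proof. by rewrite -val_eqE -eqz_nat !residueE; exact: eqP. Qed.

Lemma residue_shift (u v w : int) : (res (u + w) == res (v + w)) = (res u == res v).
Proof.
apply/residue_eqP/residue_eqP => e; apply/eqP; last by rewrite eqz_modDr; apply/eqP.
by rewrite -(eqz_modDr w); apply/eqP.
Qed.

Lemma residue_small (m : nat) : (m < N)%N -> res m%:Z = m :> nat.
Proof. by move=> lt_mN; rewrite /= modz_small //; lia. Qed.

Lemma residue_ord (i : 'I_N) : res i%:Z = i.
Proof. by apply: val_inj; exact: residue_small. Qed.

Lemma residueB (u v : int) : res ((res u)%:Z - v) = res (u - v).
Proof.
apply: val_inj; apply/eqP; rewrite -eqz_nat !residueE; apply/eqP.
by rewrite modzDml.
Qed.

Lemma residueDr (u v : int) : res (u + (res v)%:Z) = res (u + v).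
Proof.
apply: val_inj; apply/eqP; rewrite -eqz_nat !residueE; apply/eqP.
by rewrite modzDmr.
Qed.

Lemma residueP (u : int) (k : nat) :
  res u = k :> nat -> exists t, u = k%:Z + N%:Z * t.
Proof.
move=> e; exists (u %/ N)%Z; rewrite -e residueE.
by have := divz_eq u N; move: (u %/ N)%Z (u %% N)%Z => a b ->; ring.
Qed.
End Residues.

(** * Exclusion and pushing as consequences of the boundary condition *)

Section PushChain.
Variables (K : numFieldType) (L N : nat) (zeta : K) (U : ('I_N -> int) -> K).
Hypotheses (N_gt0 : (0 < N)%N) (L_gt0 : (0 < L)%N) (ltNL : (N < L)%N).
Hypothesis U_rotate : forall x, U (rotate_coord L x) = U x.
Hypothesis U_boundary : forall x (j j' : 'I_N),
  j' = j.+1 :> nat -> x j = x j' -> U (bump_at x j' 1) = zeta * U x.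
Local Notation lift := (periodic_lift N_gt0 L).
Local Notation res := (residue N_gt0).
Local Notation site := (residue L_gt0).

Lemma lift_bump (x : 'I_N -> int) (j : 'I_N) (d n : int) :
  lift (bump_at x j d) n = lift x n + (res n == j)%:R * d.
Proof. by rewrite /periodic_lift /bump_at addrAC. Qed.

Lemma lift_ord (x : 'I_N -> int) (i : 'I_N) : lift x i%:Z = x i.
Proof. by rewrite -[i%:Z]addr0 -(mulr0 N%:Z) periodic_liftD mulr0 addr0. Qed.

Lemma liftDN (x : 'I_N -> int) (n t : int) :
  lift x (n + N%:Z * t) = lift x n + L%:Z * t.
Proof.
have [r [u ->]] := int_residueP N_gt0 n.
by rewrite -addrA -mulrDr !periodic_liftD mulrDr addrA.
Qed.

(** Rotation invariance moves the colliding pair to the first two indices, so the condition also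
    holds across the end of the period. For N = 1 no collision exists, as consecutive lifted
    positions differ by L. *)
Lemma U_boundary_lift (x : 'I_N -> int) (n : int) :
  lift x n = lift x (n + 1) -> U (bump_at x (res (n + 1)) 1) = zeta * U x.
Proof.
have [lt1N|leN1] := ltnP 1 N; last first.
  have -> : n + 1 = n + N%:Z * 1 by lia.
  by rewrite liftDN; move: (lift x n) => u; lia.
move=> xn; pose y (i : 'I_N) := lift x (i%:Z + n).
have yE : y (Ordinal N_gt0) = y (Ordinal lt1N).
  by rewrite /y /= add0r [1 + n]addrC.
have := U_boundary (j := Ordinal N_gt0) (j' := Ordinal lt1N) erefl yE.
rewrite [X in _ = _ * X](U_lift N_gt0 L_gt0 U_rotate) => <-.
rewrite -(U_lift N_gt0 L_gt0 U_rotate (bump_at x _ 1) n); congr U.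
apply/funext => i; rewrite lift_bump /bump_at /y; congr (_ + _%:R * 1).
rewrite [n + 1]addrC residue_shift residue_ord; congr (nat_of_bool (_ == _)).
by apply: val_inj; rewrite /= modz_small //; lia.
Qed.

(** The particles with indices n0, ..., n0 + k - 1 modulo N move one step to the right. *)
Definition block_bump (x : 'I_N -> int) (n0 : int) (k : nat) : 'I_N -> int :=
  fun i => x i + (res (i%:Z - n0) < k)%N%:R.

Lemma lift_block_bump (x : 'I_N -> int) (n0 n : int) (k : nat) :
  lift (block_bump x n0 k) n = lift x n + (res (n - n0) < k)%N%:R.
Proof. by rewrite /periodic_lift /block_bump residueB addrAC. Qed.

(** A packed block moves particle by particle from its left end: each bumped particle lands on its
    neighbour, and the boundary condition then moves that neighbour at the price of one factor
    zeta. *)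
Lemma U_block_bump (x : 'I_N -> int) (n0 : int) (k : nat) :
    (k < N)%N -> (forall l, (l <= k)%N -> lift x (n0 + l%:Z) = lift x n0 + l%:Z) ->
  U (block_bump x n0 k.+1) = zeta ^+ k * U (bump_at x (res n0) 1).
Proof.
have bump_eq l (i : 'I_N) : (l < N)%N ->
    (res (i%:Z - n0) == l :> nat) = (i == res (n0 + l%:Z)).
  move=> lt_lN; have -> : (i == res (n0 + l%:Z)) = (res (i%:Z - n0) == res l%:Z).
    by rewrite -[RHS](residue_shift _ _ _ n0) subrK residue_ord [l%:Z + _]addrC.
  by rewrite -[in RHS]val_eqE [val (res l%:Z)]residue_small.
elim: k => [|k IH] lt_kN run.
  rewrite expr0 mul1r; congr U; apply/funext => i; rewrite /block_bump /bump_at.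
  by rewrite ltnS leqn0 bump_eq // addr0 mulr1.
rewrite exprS -mulrA -IH; [|lia|by move=> l le_lk; apply: run; lia].
have -> : block_bump x n0 k.+2 = bump_at (block_bump x n0 k.+1) (res (n0 + k%:Z + 1)) 1.
  apply/funext => i; rewrite /bump_at /block_bump mulr1 -addrA; congr (_ + _).
  have -> : n0 + k%:Z + 1 = n0 + k.+1%:Z by lia.
  by rewrite -bump_eq // [(_ < k.+2)%N]ltnS leq_eqVlt; case: ltngtP.
apply: U_boundary_lift; rewrite !lift_block_bump.
have -> : n0 + k%:Z - n0 = k%:Z by ring.
have -> : n0 + k%:Z + 1 - n0 = k.+1%:Z by lia.
have -> : n0 + k%:Z + 1 = n0 + k.+1%:Z by lia.
by rewrite !run // !residue_small; lia.
Qed.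

Lemma cyclically_increasing_lift (z : 'I_N -> int) :
  (forall n, lift z n < lift z (n + 1)) -> cyclically_increasing L z.
Proof.
move=> step; have mono (m : int) (k : nat) : lift z m < lift z (m + k.+1%:Z).
  elim: k => [|k IH]; first exact: step.
  apply: lt_trans IH _; have -> : m + k.+2%:Z = m + k.+1%:Z + 1 by lia.
  exact: step.
split=> i j; first move=> lt_ij; rewrite -(lift_ord z i).
  rewrite -(lift_ord z j); have -> : j%:Z = i%:Z + (j - i.+1).+1%:Z by lia.
  exact: mono.
rewrite -(lift_ord z j) -[L%:Z]mulr1 -liftDN.
have -> : j%:Z + N%:Z * 1 = i%:Z + (j + N - i.+1).+1%:Z.
  by have := ltn_ord i; lia.
exact: mono.
Qed.

Lemma lift_step (x : 'I_N -> int) (n : int) : cyclically_increasing L x ->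
  lift x n < lift x (n + 1).
Proof. by move=> hx; have := periodic_lift_step N_gt0 n hx; lia. Qed.

(** Only the last particle of the block could collide with its successor, and the last hypothesis
    says that the site in front of it is free. *)
Lemma block_bump_increasing (x : 'I_N -> int) (n0 : int) (k : nat) :
    cyclically_increasing L x ->
    (forall l, (l <= k)%N -> lift x (n0 + l%:Z) = lift x n0 + l%:Z) ->
    lift x (n0 + k.+1%:Z) != lift x n0 + k.+1%:Z ->
  cyclically_increasing L (block_bump x n0 k.+1).
Proof.
move=> hx run stop; apply: cyclically_increasing_lift => n.
rewrite !lift_block_bump; have := lift_step n hx.
case: (ltnP (res (n - n0)) k.+1) => [lt_k|_]; last first.
  by case: (_ < _)%N; move: (lift x n) (lift x (n + 1)) => u v; lia.
case: ltnP => [_|le_k]; first by move: (lift x n) (lift x (n + 1)) => u v; lia.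
have resk : res (n - n0) = k :> nat.
  have [t et] := residueP (erefl (res (n - n0) : nat)).
  have : n + 1 - n0 = (res (n - n0)).+1%:Z + N%:Z * t by lia.
  have := ltn_ord (res (n - n0)); rewrite leq_eqVlt => /orP[/eqP eN|lt_N] e.
    have : (res (n + 1 - n0) == Ordinal N_gt0).
      rewrite -(residueD N_gt0 (Ordinal N_gt0) (1 + t)) e eN; apply/eqP.
      by congr res; rewrite /=; ring.
    by rewrite -val_eqE /= => /eqP e0; move: le_k; rewrite /= e0; lia.
  have : (res (n + 1 - n0) == Ordinal lt_N).
    by rewrite -(residueD N_gt0 (Ordinal lt_N) t) e.
  by rewrite -val_eqE /= => /eqP e0; move: le_k lt_k; rewrite /= e0; lia.
have [t et] := residueP resk.
have -> : n = n0 + k%:Z + N%:Z * t by lia.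
have -> : n0 + k%:Z + N%:Z * t + 1 = n0 + k.+1%:Z + N%:Z * t by lia.
rewrite !liftDN run //.
have := lift_step (n0 + k%:Z) hx; rewrite run // => lt_run.
have e1 : n0 + k%:Z + 1 = n0 + k.+1%:Z by lia.
move: lt_run stop; rewrite e1; move: (lift x (n0 + k.+1%:Z)) (lift x n0) => u v.
by move=> ? /eqP ?; lia.
Qed.

Lemma site_coord (X : config L N) i : site (coord X i) = pos X i.
Proof. exact: residue_ord. Qed.

Lemma site_eq_small (e : int) (m : nat) :
  (0 < m)%N -> (m < L)%N -> site (e + m%:Z) != site e.
Proof.
move=> m_gt0 lt_mL; rewrite addrC -{2}[e]add0r residue_shift.
by rewrite -val_eqE /= modz_small ?mod0z; lia.
Qed.

Lemma lift_next (X : config L N) (n : int) :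
  site (lift (coord X) n + 1) \in occupied X ->
  lift (coord X) (n + 1) = lift (coord X) n + 1.
Proof.
have hx := coord_cyclic X => /lift_occupied -/(_ N_gt0)[m em].
have lt_nm : n < m by rewrite -(lift_lt_mono N_gt0 L_gt0 _ _ hx) em; lia.
have le_nm : n + 1 <= m by lia.
have := periodic_lift_expand N_gt0 hx le_nm; have := lift_step n hx; rewrite em.
by move: (lift _ n) (lift _ (n + 1)) => u v; lia.
Qed.

Lemma lift_prev (X : config L N) (n : int) :
  site (lift (coord X) n - 1) \in occupied X ->
  lift (coord X) (n - 1) = lift (coord X) n - 1.
Proof.
have hx := coord_cyclic X => /lift_occupied -/(_ N_gt0)[m em].
have lt_nm : m < n by rewrite -(lift_lt_mono N_gt0 L_gt0 _ _ hx) em; lia.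
have le_nm : m <= n - 1 by lia.
have := periodic_lift_expand N_gt0 hx le_nm; have := lift_step (n - 1) hx.
by rewrite subrK em; move: (lift _ n) (lift _ (n - 1)) => u v; lia.
Qed.

(** X' is the configuration from which a left jump out of the site k + 1 steps to the right of
    particle j, pushing k others, leads to X. On the ring X' has the same sites as X with the whole
    block moved right, so [U_block_bump] applies. *)
Lemma U_push (X X' : config L N) (j : 'I_N) (k : nat) :
    (forall l, (l <= k)%N -> site (coord X j + l%:Z) \in occupied X) ->
    site (coord X j + k.+1%:Z) \notin occupied X ->
    occupied X' = (site (coord X j + k.+1%:Z) |: occupied X :\ pos X j)%SET ->
  U (coord X') = zeta ^+ k * U (bump_at (coord X) j 1).
Proof.
move=> run stop occX'; have hx := coord_cyclic X.
have lift_run l : (l <= k)%N ->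
    lift (coord X) (j%:Z + l%:Z) = lift (coord X) j%:Z + l%:Z.
  elim: l => [|l IH] le_lk; first by rewrite !addr0.
  have e : lift (coord X) j%:Z + l.+1%:Z = lift (coord X) (j%:Z + l%:Z) + 1.
    by rewrite IH; lia.
  rewrite e -lift_next; first by congr (lift _); lia.
  by rewrite -e lift_ord; apply: run.
have lift_stop : lift (coord X) (j%:Z + k.+1%:Z) != lift (coord X) j%:Z + k.+1%:Z.
  apply: contra stop => /eqP e; rewrite -(lift_ord (coord X) j) -e.
  by apply/(lift_occupied N_gt0); exists (j%:Z + k.+1%:Z).
(* A run of N + 1 particles would close up around the ring and give N = L. *)
have lt_kN : (k < N)%N.
  rewrite ltnNge; apply/negP => /lift_run.
  by rewrite -[N%:Z]mulr1 liftDN; move: (lift _ j%:Z) => u; lia.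
rewrite -(residue_ord N_gt0 j) -U_block_bump //; apply/esym.
apply: (U_same_sites N_gt0 U_rotate); first exact: block_bump_increasing.
move=> i; rewrite occX' !inE /block_bump.
case: ltnP => [lt_k|le_k]; last first.
  rewrite addr0 site_coord; apply/orP; right; rewrite imset_f // andbT.
  apply: contraTneq le_k => /pos_inj ->.
  by rewrite subrr -ltnNge /= mod0z.
have [t et] := residueP (erefl (res (i%:Z - j%:Z) : nat)).
set l : nat := res (i%:Z - j%:Z) in lt_k et.
have xi : coord X i = coord X j + l%:Z + L%:Z * t.
  have -> : coord X i = lift (coord X) (j%:Z + l%:Z + N%:Z * t).
    by rewrite -(lift_ord (coord X) i); congr (lift _); lia.
  by rewrite liftDN lift_run // lift_ord.
have -> : site (coord X i + 1) = site (coord X j + l.+1%:Z).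
  apply/eqP/residue_eqP; rewrite xi.
  have -> : coord X j + l%:Z + L%:Z * t + 1 = t * L%:Z + (coord X j + l.+1%:Z) by lia.
  by rewrite modzMDl.
move: lt_k; rewrite ltnS leq_eqVlt => /orP[/eqP ->|lt_k]; first by rewrite eqxx.
apply/orP; right; rewrite run // andbT -site_coord; apply: site_eq_small => //.
by apply: leq_ltn_trans ltNL; lia.
Qed.

(** Moving j back puts it on its left neighbour, and the boundary condition brings it forward again.
    These terms account for the suppressed right jumps. *)
Lemma U_right_blocked (X : config L N) (j : 'I_N) :
  site (coord X j - 1) \in occupied X ->
  zeta * U (bump_at (coord X) j (- 1)) = U (coord X).
Proof.
rewrite -(lift_ord (coord X) j) => /lift_prev e.
have N_neq1 : N != 1%N.
  apply: contraTneq ltNL => N1.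
  have : lift (coord X) (j%:Z - 1) = lift (coord X) j%:Z - L%:Z.
    have -> : j%:Z - 1 = j%:Z + N%:Z * (- 1) by lia.
    by rewrite liftDN; lia.
  by rewrite e; move: (lift _ _) => u; lia.
have j_shift : (res (j%:Z - 1) == j) = false.
  have -> : (res (j%:Z - 1) == j) = (res 0 == res 1).
    rewrite -(residue_shift _ 0 1 (j%:Z - 1)) add0r [1 + _]addrC subrK.
    by rewrite residue_ord.
  by rewrite -val_eqE /= mod0z modz_small //; lia.
rewrite -(U_boundary_lift (n := j%:Z - 1)).
  congr U; apply/funext => i; rewrite subrK residue_ord /bump_at.
  by case: (i == j); rewrite ?mul1r ?mul0r; ring.
by rewrite !lift_bump subrK residue_ord j_shift eqxx e mul0r mul1r addr0.
Qed.

Lemma U_right_free (X X' : config L N) (j : 'I_N) :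
    site (coord X j - 1) \notin occupied X ->
    occupied X' = (site (coord X j - 1) |: occupied X :\ pos X j)%SET ->
  U (coord X') = U (bump_at (coord X) j (- 1)).
Proof.
move=> free occX'; have hx := coord_cyclic X; apply/esym.
apply: (U_same_sites N_gt0 U_rotate).
  apply: cyclically_increasing_lift => n; rewrite !lift_bump.
  have := lift_step n hx; case: (res (n + 1) == j) / eqP => [e|_]; last first.
    by case: (_ == j); move: (lift _ n) (lift _ (n + 1)) => u v; lia.
  case: (res n == j); first by move: (lift _ n) (lift _ (n + 1)) => u v; lia.
  suff : lift (coord X) n != lift (coord X) (n + 1) - 1.
    by move: (lift _ n) (lift _ (n + 1)) => u v; lia.
  apply: contra free => /eqP en.
  have [t et] := residueP (erefl (res (n + 1) : nat)); rewrite e in et.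
  apply/(lift_occupied N_gt0); exists (n + N%:Z * - t).
  by rewrite liftDN en et liftDN lift_ord; ring.
move=> i; rewrite occX' !inE /bump_at; have [->|nij] := eqVneq i j.
  by rewrite mul1r eqxx.
rewrite mul0r addr0 site_coord imset_f // andbT; apply/orP; right.
by apply: contra_neq nij => /pos_inj.
Qed.
End PushChain.

(** * Jumps as runs of occupied sites *)

Section Moves.
Variables (L N : nat) (L_gt0 : (0 < L)%N).
Local Notation site := (residue L_gt0).
Implicit Types (A : {set 'I_L}) (s e : 'I_L) (eps : int).

Lemma ordSE s : ordS s = site (s%:Z + 1).
Proof.
by apply: val_inj; apply/eqP; rewrite -eqz_nat residueE /= -modz_nat; apply/eqP; congr modz; lia.
Qed.

Lemma ord_predE s : ord_pred s = site (s%:Z - 1).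
Proof. by apply: ordS_inj; rewrite ord_predK ordSE addrC residueDr addrC subrK residue_ord. Qed.

Lemma siteD s (u v : int) : site ((site (s%:Z + u))%:Z + v) = site (s%:Z + (u + v)).
Proof. by rewrite addrC residueDr addrC addrA. Qed.

Lemma site_addK s (u : int) : site ((site (s%:Z + u))%:Z - u) = s.
Proof. by rewrite siteD subrr addr0 residue_ord. Qed.

Lemma site_subK s (u : int) : site ((site (s%:Z - u))%:Z + u) = s.
Proof. by rewrite siteD addNr addr0 residue_ord. Qed.

Lemma site_add_inj (u : int) : injective (fun s => site (s%:Z + u)).
Proof. by move=> s s' e; rewrite -(site_addK s u) e site_addK. Qed.

(* [s], [s + eps], ..., [s + (d - 1) eps] are occupied and [s + d eps] is not. *)
Definition run_length eps A s (d : nat) : bool :=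
  [forall k : 'I_d, site (s%:Z + eps * k%:Z) \in A]
  && (site (s%:Z + eps * d%:Z) \notin A).

Lemma run_lengthP eps A s (d : nat) :
  reflect ((forall k, (k < d)%N -> site (s%:Z + eps * k%:Z) \in A) /\
           site (s%:Z + eps * d%:Z) \notin A)
          (run_length eps A s d).
Proof.
apply: (iffP andP) => -[run stop]; split=> //.
  by move=> k lt_kd; have /forallP /(_ (Ordinal lt_kd)) := run.
by apply/forallP => k; apply: run.
Qed.

Lemma site_neq eps s (k l : nat) : eps * eps = 1 -> (k < l)%N -> (l < k + L)%N ->
  site (s%:Z + eps * k%:Z) != site (s%:Z + eps * l%:Z).
Proof.
move=> eps2 lt_kl lt_lk; rewrite ![s%:Z + _]addrC residue_shift.
apply/residue_eqP => /eqP; rewrite eqz_mod_dvd => /dvdzP[t et].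
have : k%:Z - l%:Z = (eps * t) * L%:Z.
  by rewrite -mulrA -et -[LHS]mul1r -eps2; ring.
move: (eps * t) => u e; have L_ge0 : 0 <= L%:Z by [].
have [u_ge0|u_lt0] := leP 0 u.
  by have := mulr_ge0 u_ge0 L_ge0; move: (u * L%:Z) e => v; lia.
have : (u + 1) * L%:Z <= 0 by rewrite mulr_le0_ge0 //; lia.
by rewrite mulrDl mul1r; move: (u * L%:Z) e => v; lia.
Qed.

Lemma run_length_lt eps A s (d : nat) :
  eps * eps = 1 -> (0 < d)%N -> run_length eps A s d -> (d <= L)%N -> (d < L)%N.
Proof.
move=> _ d_gt0 /run_lengthP[run stop]; rewrite leq_eqVlt => /orP[/eqP e|//].
case/negP: stop; rewrite e addrC mulrC; have /eqP <- : site s%:Z == site (L%:Z * eps + s%:Z).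
  by apply/residue_eqP; rewrite mulrC modzMDl.
by have := run 0%N d_gt0; rewrite mulr0 addr0.
Qed.

(** A push amounts to carrying the first particle of a run to the free site at its end. Seen from
    that site in the opposite direction, the new set has a run of the same length ending at the
    vacated site; this makes moves invertible. *)
Lemma run_length_swap eps A s (d : nat) (e := site (s%:Z + eps * d%:Z)) :
    eps * eps = 1 -> (0 < d <= L)%N -> run_length eps A s d ->
  let A' := (e |: A :\ s)%SET in
  run_length (- eps) A' e d /\ A = (s |: A' :\ e)%SET.
Proof.
move=> eps2 /andP[d_gt0 le_dL] run /=.
have lt_dL := run_length_lt eps2 d_gt0 run le_dL.
case/run_lengthP: run => run stop; rewrite -/e in stop.
have s_in : s \in A.
  by have := run 0%N d_gt0; rewrite mulr0 addr0 residue_ord.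
have nse : s != e by apply: contraTneq s_in => ->.
have eE k : (k <= d)%N ->
    site (e%:Z + - eps * k%:Z) = site (s%:Z + eps * (d - k)%N%:Z).
  by move=> le_kd; rewrite siteD; congr site; rewrite -subzn //; ring.
split; last first.
  apply/setP => a; rewrite !inE; have [->|nas] := eqVneq a s; first by rewrite s_in.
  by have [->|nae] := eqVneq a e; rewrite //= (negPf stop).
apply/run_lengthP; split.
  move=> [|k] lt_kd; rewrite eE; try lia.
    by rewrite subn0 !inE eqxx.
  rewrite !inE run ?andbT; last by lia.
  apply/orP; right; have := site_neq s eps2 (k := 0) (l := d - k.+1).
  by rewrite mulr0 addr0 residue_ord eq_sym => -> //; lia.
by rewrite eE // subnn mulr0 addr0 residue_ord !inE eqxx (negPf nse).
Qed.

(** As some site is free, the run from an occupied s stops within one turn, at exactly one length.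
    Summing over this indicator splits the left jumps according to the number of particles moved. *)
Lemma run_length_unique eps A s : eps * eps = 1 -> (#|A| < L)%N ->
  (\sum_(d < L) run_length eps A s d.+1 = (s \in A))%N.
Proof.
move=> eps2 ltAL; case: (boolP (s \in A)) => [s_in|s_out]; last first.
  rewrite big1 // => d _; apply/eqP; rewrite eqb0; apply: contra s_out.
  case/run_lengthP => /(_ 0%N isT); rewrite mulr0 addr0 residue_ord.
  by [].
have ex_free : exists k, site (s%:Z + eps * k%:Z) \notin A.
  have /existsP[r r_out] : [exists r, r \notin A].
    rewrite -negb_forall; apply: contraL ltAL => /forallP all_in.
    by rewrite -leqNgt -{1}(card_ord L) subset_leq_card //; apply/fintype.subsetP => r _.
  exists (`|((eps * (r%:Z - s%:Z)) %% L)%Z|)%N.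
  suff -> : site (s%:Z + eps * `|((eps * (r%:Z - s%:Z)) %% L)%Z|%:Z) = r by [].
  rewrite gez0_abs ?modz_ge0 //; last by lia.
  rewrite -{2}(residue_ord L_gt0 r); apply/eqP/residue_eqP.
  rewrite -modzDmr modzMmr modzDmr mulrA eps2 mul1r; congr modz; ring.
have [d d_out d_min] := ex_minnP ex_free.
have run k : (k < d)%N -> site (s%:Z + eps * k%:Z) \in A.
  by move=> lt_kd; apply: contraTT lt_kd => /d_min; rewrite -leqNgt.
case: d => [|d] in d_out d_min run *.
  by rewrite mulr0 addr0 residue_ord s_in in d_out.
have run_d : run_length eps A s d.+1 by apply/run_lengthP.
have lt_dL : (d < L)%N.
  rewrite ltnNge; apply/negP => le_Ld.
  have := ltAL; rewrite ltnNge => /negP; apply.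
  rewrite -{1}(card_ord L) -(card_imset _ (@site_add_inj 0)).
  have inj : injective (fun k : 'I_L => site (s%:Z + eps * k%:Z)).
    move=> k l /eqP; apply: contraTeq => nkl.
    have [lt_kl|lt_lk|e] := ltngtP k l; last by case/eqP: nkl; apply: val_inj.
      by apply: site_neq => //; have := ltn_ord l; lia.
    by rewrite eq_sym; apply: site_neq => //; have := ltn_ord k; lia.
  rewrite (card_imset _ (@site_add_inj 0)) -(card_imset _ inj) subset_leq_card //.
  apply/fintype.subsetP => r /imsetP[k _ ->]; apply: run.
  by have := ltn_ord k; lia.
rewrite (bigD1 (Ordinal lt_dL)) //= run_d big1 // => k nk; apply/eqP; rewrite eqb0.
apply/negP => /run_lengthP[run' stop'].
have [lt_kd|lt_dk|e] := ltngtP k d.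
- by case/negP: stop'; apply: run; rewrite ltnS.
- by case/negP: d_out; apply: run'; rewrite ltnS.
- by case/eqP: nk; apply: val_inj.
Qed.

Lemma pushed_run A s (d : nat) : (d <= L)%N -> run_length (- 1) A s d ->
  pushed A s = [seq site (s%:Z - k%:Z) | k <- iota 0 d].
Proof.
rewrite /pushed => le_dL run_d; suff gen fuel : (d <= fuel)%N ->
    pushed_from fuel A s = [seq site (s%:Z - k%:Z) | k <- iota 0 d] by exact: gen.
elim: d fuel s run_d {le_dL} => [|d IH] fuel s /run_lengthP[run stop] le_dL.
  rewrite mulr0 addr0 residue_ord in stop.
  by case: fuel le_dL => //= fuel _; rewrite (negPf stop).
case: fuel le_dL => // fuel le_dL.
have -> : pushed_from fuel.+1 A s =
  if s \in A then s :: pushed_from fuel A (ord_pred s) else [::] by [].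
have := run 0%N isT; rewrite mulr0 addr0 residue_ord => ->.
rewrite -[iota 0 d.+1]/(0%N :: iota (1 + 0) d) map_cons subr0 residue_ord.
rewrite iotaDl -map_comp; congr (_ :: _).
rewrite (IH fuel) //.
  by apply: eq_map => k; rewrite ord_predE siteD; congr site; lia.
apply/run_lengthP; split=> [k lt_kd|]; rewrite ord_predE siteD.
  have -> : - 1 + - 1 * k%:Z = - 1 * k.+1%:Z by lia.
  exact: run.
by have -> : - 1 + - 1 * d%:Z = - 1 * d.+1%:Z by lia.
Qed.

Lemma mem_pushed A s (d : nat) a : (d <= L)%N -> run_length (- 1) A s d ->
  reflect (exists2 k, (k < d)%N & a = site (s%:Z - k%:Z)) (a \in pushed A s).
Proof.
move=> le_dL run; rewrite (pushed_run le_dL run).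
apply: (iffP mapP) => -[k]; first by rewrite mem_iota => lt_kd ->; exists k.
by move=> lt_kd ->; exists k => //; rewrite mem_iota.
Qed.

Lemma size_pushed A s (d : nat) : (d <= L)%N -> run_length (- 1) A s d ->
  (\sum_(x < L) (ordS x \in pushed A s) = d)%N.
Proof.
move=> le_dL run; rewrite -(reindex_inj (@ordS_inj L) (P := xpredT)
  (F := fun x => nat_of_bool (x \in pushed A s))) /=.
rewrite -big_mkcond sum1_card.
have -> : #|pushed A s| = size (pushed A s).
  apply/card_uniqP; rewrite (pushed_run le_dL run) map_inj_in_uniq ?iota_uniq //.
  move=> k l; rewrite !mem_iota /= !add0n => lt_kd lt_ld /eqP.
  have sE m : s%:Z - m%:Z = s%:Z + - 1 * m%:Z by rewrite mulN1r.
  apply: contraTeq => nkl; rewrite (sE k) (sE l).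
  have [lt_kl|lt_lk|e] := ltngtP k l; last by case/eqP: nkl.
    by apply: site_neq => //; lia.
  by rewrite eq_sym; apply: site_neq => //; lia.
by rewrite (pushed_run le_dL run) size_map size_iota.
Qed.

(** As a set, the run shifted by one differs from the original only at its two ends. *)
Lemma move_left_run A s (d : nat) : (0 < d <= L)%N -> run_length (- 1) A s d ->
  move_left A s = (site (s%:Z + - 1 * d%:Z) |: A :\ s)%SET.
Proof.
move=> /andP[d_gt0 le_dL] run; have memP := mem_pushed _ le_dL run.
have lt_dL := run_length_lt (erefl : - 1 * - 1 = 1 :> int) d_gt0 run le_dL.
case/run_lengthP: (run) => occ free.
apply/setP => a; rewrite !inE; apply/imsetP/idP => [[b b_in ->]|].
  case: memP => [[k lt_kd ->]|nb].
    rewrite ord_predE siteD.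
    have -> : - k%:Z - 1 = - 1 * k.+1%:Z by lia.
    have [->|nk] := eqVneq k.+1 d; first by rewrite eqxx.
    rewrite occ ?andbT; last by lia.
    apply/orP; right; have := site_neq s (erefl : - 1 * - 1 = 1 :> int) (k := 0) (l := k.+1).
    by rewrite mulr0 addr0 residue_ord eq_sym => -> //; lia.
  rewrite b_in andbT; apply/orP; right; apply/eqP => bs; apply: nb.
  by exists 0%N => //; rewrite subr0 residue_ord.
have pred_pushed k : (0 < k <= d)%N -> exists2 b, b \in A &
    site (s%:Z + - 1 * k%:Z) = if b \in pushed A s then ord_pred b else b.
  case: k => // k /= lt_kd; exists (site (s%:Z + - 1 * k%:Z)); first exact: occ.
  have -> : site (s%:Z + - 1 * k%:Z) \in pushed A s.
    by apply/memP; exists k => //; rewrite mulN1r.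
  by rewrite ord_predE siteD; congr site; lia.
case/orP => [/eqP ->|/andP[nas a_in]].
  have [|b b_in e] := pred_pushed d; first by rewrite d_gt0 leqnn.
  by exists b.
case: (memP a) => [[k lt_kd ak]|na].
  have [|b b_in e] := pred_pushed k.
    rewrite (ltnW lt_kd) ?andbT lt0n; apply: contraNneq nas => k0.
    by rewrite ak k0 subr0 residue_ord.
  by exists b => //; rewrite -e ak mulN1r.
exists a => //; case: ifP => // /memP h; case: na; exact: h.
Qed.

(** Turns a sum over the predecessors of X and the site of the jump into a sum over the sites of X
    where a move can have ended. *)
Lemma sum_run_swap (K : pzRingType) eps (d : nat) (X : config L N)
    (F : config L N -> K) : eps * eps = 1 -> (0 < d <= L)%N ->
  \sum_(Y : config L N) \sum_s (run_length eps (occupied Y) s d &&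
    (occupied X == (site (s%:Z + eps * d%:Z) |: occupied Y :\ s)%SET))%:R * F Y
  = \sum_e (run_length (- eps) (occupied X) e d)%:R *
    \sum_(Y : config L N)
      (occupied Y == (site (e%:Z - eps * d%:Z) |: occupied X :\ e)%SET)%:R * F Y.
Proof.
move=> eps2 d_bnd; rewrite exchange_big /=.
rewrite (reindex_inj (@site_add_inj (- (eps * d%:Z)))) /=.
apply: eq_bigr => e _; rewrite mulr_sumr; apply: eq_bigr => Y _.
rewrite mulrA -natrM mulnb; congr (_%:R * _); congr nat_of_bool.
rewrite siteD addNr addr0 residue_ord.
have eps2' : - eps * - eps = 1 by rewrite mulrNN.
apply/andP/andP => -[run /eqP occE].
  have := run_length_swap eps2 d_bnd run.
  by rewrite siteD addNr addr0 residue_ord -occE => -[-> <-].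
have := run_length_swap eps2' d_bnd run.
by rewrite opprK mulNr -occE => -[-> <-].
Qed.
End Moves.

(** * The forward equation *)

Section ForwardEquation.
Variables (K : numFieldType) (L N : nat) (zeta : K) (U : ('I_N -> int) -> K).
Hypotheses (N_gt0 : (0 < N)%N) (L_gt0 : (0 < L)%N) (ltNL : (N < L)%N).
Hypothesis zeta_neq0 : zeta != 0.
Hypothesis U_rotate : forall x, U (rotate_coord L x) = U x.
Hypothesis U_boundary : forall x (j j' : 'I_N),
  j' = j.+1 :> nat -> x j = x j' -> U (bump_at x j' 1) = zeta * U x.
Local Notation site := (residue L_gt0).
Implicit Types X Y : config L N.

Definition right_step X Y (s : 'I_L) : bool :=
  (ordS s \notin occupied X) && (occupied Y == move_right (occupied X) s).

Definition left_step X Y (s : 'I_L) : bool :=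
  occupied Y == move_left (occupied X) s.

Definition push_size X (s : 'I_L) : nat :=
  (\sum_(x < L) (ordS x \in pushed (occupied X) s))%N.

Lemma sum_config_eq (A : {set 'I_L}) (F : config L N -> K) X :
  occupied X = A -> \sum_(Y : config L N) (occupied Y == A)%:R * F Y = F X.
Proof.
by move=> <-; rewrite -[RHS](sum_config_of_set _ erefl); apply: eq_bigr => Y _; rewrite mulr_natl.
Qed.

Lemma sum_occupied_indicator X (F : 'I_L -> K) :
  \sum_i F (pos X i) = \sum_s (s \in occupied X)%:R * F s.
Proof.
rewrite sum_occupied big_mkcond /=; apply: eq_bigr => s _.
by case: ifP; rewrite ?mul1r ?mul0r.
Qed.

Lemma config_swap X (e s : 'I_L) : e \in occupied X -> s \notin occupied X ->
  exists Y : config L N, occupied Y = (s |: occupied X :\ e)%SET.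
Proof.
move=> e_in s_out; apply: config_of_set; rewrite cardsU1 !inE (negPf s_out) andbF.
by rewrite -[RHS](card_occupied X) [in RHS](cardsD1 e) e_in.
Qed.

Lemma right_moves_sum X :
  \sum_Y (\sum_i (right_step Y X (pos Y i))%:R) * U (coord Y)
  = \sum_j (site (coord X j - 1) \notin occupied X)%:R
           * U (bump_at (coord X) j (- 1)).
Proof.
have e1 : 1 * 1 = 1 :> int by [].
transitivity (\sum_Y \sum_s (run_length L_gt0 1 (occupied Y) s 1 &&
    (occupied X == (site (s%:Z + 1 * 1%:Z) |: occupied Y :\ s)%SET))%:R * U (coord Y)).
  apply: eq_bigr => Y _; rewrite mulr_suml.
  rewrite (sum_occupied_indicator Y (fun s => (right_step Y X s)%:R * U (coord Y))).
  apply: eq_bigr => s _; rewrite mulrA -natrM mulnb; congr (_%:R * _).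
  congr nat_of_bool; rewrite /right_step /move_right (ordSE L_gt0) mul1r.
  rewrite andbA; congr (_ && _); apply/andP/run_lengthP.
    move=> [s_in free]; split=> [[|//] _|]; last by rewrite mul1r.
    by rewrite mulr0 addr0 residue_ord.
  move=> [/(_ 0%N isT)]; rewrite mulr0 addr0 residue_ord mul1r.
  by [].
rewrite sum_run_swap //.
transitivity (\sum_e (e \in occupied X)%:R *
   ((site (e%:Z - 1) \notin occupied X)%:R *
    \sum_Y (occupied Y == (site (e%:Z - 1 * 1%:Z) |: occupied X :\ e)%SET)%:R * U (coord Y))).
  apply: eq_bigr => e _; rewrite mulrA -natrM mulnb; congr (_%:R * _).
  congr nat_of_bool; apply/run_lengthP/andP.
    by move=> [/(_ 0%N isT)]; rewrite mulr0 addr0 residue_ord mulr1.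
  move=> [e_in free]; split=> [[|//] _|]; last by rewrite mulr1.
  by rewrite mulr0 addr0 residue_ord.
rewrite -sum_occupied_indicator; apply: eq_bigr => j _; rewrite mul1r.
case: (boolP (site _ \notin _)) => [free|]; last by rewrite !mul0r.
rewrite !mul1r; have [|Y occY] := config_swap (e := pos X j) _ free.
  by rewrite imset_f.
by rewrite (sum_config_eq _ occY) -(U_right_free N_gt0 ltNL U_rotate free occY).
Qed.

(** Each particle j of X is the far end of exactly one incoming left push. If it moved d particles,
    the preceding configuration has value zeta^(d-1) times [U] with j bumped right, and the weight
    zeta^(-d) of its current leaves zeta^-1. *)
Lemma left_moves_sum X :
  \sum_Y (\sum_i (left_step Y X (pos Y i))%:R * zeta ^- push_size Y (pos Y i))
         * U (coord Y)
  = \sum_j zeta^-1 * U (bump_at (coord X) j 1).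
Proof.
have e1 : - 1 * - 1 = 1 :> int by [].
have ltAL Y : (#|occupied Y| < L)%N by rewrite card_occupied.
transitivity (\sum_(d < L) \sum_Y \sum_s (run_length L_gt0 (- 1) (occupied Y) s d.+1 &&
    (occupied X == (site (s%:Z + - 1 * d.+1%:Z) |: occupied Y :\ s)%SET))%:R
    * (zeta ^- d.+1 * U (coord Y))).
  rewrite exchange_big; apply: eq_bigr => Y _; rewrite exchange_big mulr_suml /=.
  rewrite (sum_occupied_indicator Y (fun s => (left_step Y X s)%:R *
     zeta ^- push_size Y s * U (coord Y))).
  apply: eq_bigr => s _.
  rewrite -(run_length_unique L_gt0 s e1 (ltAL Y)) natr_sum mulr_suml.
  apply: eq_bigr => d _; rewrite -mulnb natrM -!mulrA.
  case: (boolP (run_length _ _ _ _ _)) => [run|]; last by rewrite !mul0r.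
  by rewrite /push_size (size_pushed _ run) ?ltn_ord // /left_step (move_left_run _ run) ?ltn_ord.
transitivity (\sum_e (e \in occupied X)%:R * \sum_(d < L)
    (run_length L_gt0 1 (occupied X) e d.+1)%:R * (zeta ^- d.+1 *
    \sum_Y (occupied Y == (site (e%:Z + d.+1%:Z) |: occupied X :\ e)%SET)%:R * U (coord Y))).
  under eq_bigr => d _ do rewrite sum_run_swap ?ltn_ord //.
  rewrite exchange_big; apply: eq_bigr => e _ /=; rewrite mulr_sumr.
  apply: eq_bigr => d _; rewrite opprK.
  case: (boolP (run_length _ _ _ _ _)) => [run|]; last by rewrite !mul0r mulr0.
  have -> : e \in occupied X.
    case/run_lengthP: run => /(_ 0%N isT); rewrite mulr0 addr0 residue_ord.
    by [].
  rewrite !mul1r mulr_sumr; apply: eq_bigr => Y _.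
  by rewrite mulrCA mulN1r opprK.
rewrite -sum_occupied_indicator; apply: eq_bigr => j _.
have occj : pos X j \in occupied X by rewrite imset_f.
transitivity (\sum_(d < L) (run_length L_gt0 1 (occupied X) (pos X j) d.+1)%:R *
    (zeta^-1 * U (bump_at (coord X) j 1))); last first.
  by rewrite -mulr_suml -natr_sum run_length_unique // occj mul1r.
apply: eq_bigr => d _.
case: (boolP (run_length _ _ _ _ _)) => [run|]; last by rewrite !mul0r.
case/run_lengthP: run => run; rewrite !mul1r => free.
have [Y occY] := config_swap occj free.
rewrite (sum_config_eq _ occY).
rewrite (U_push N_gt0 ltNL U_rotate U_boundary _ free occY); last first.
  by move=> l le_ld; have := run l; rewrite mul1r; apply; rewrite ltnS.
by rewrite exprS invfM -mulrA mulKf // expf_neq0.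
Qed.

(** Bumping a particle left gives the predecessor under a right jump if the site is free, and U(X)
    by the boundary condition if it is occupied. The latter terms form the last sum, which makes up
    for the smaller exit rate of configurations with blocked particles. *)
Lemma forward_equation X (p q : K) :
  \sum_j (p * (zeta * U (bump_at (coord X) j (- 1)))
          + q * (zeta^-1 * U (bump_at (coord X) j 1)))
  = \sum_Y (\sum_i (p * zeta * (right_step Y X (pos Y i))%:R
          + q * (left_step Y X (pos Y i))%:R * zeta ^- push_size Y (pos Y i)))
       * U (coord Y)
    + p * (\sum_i (ordS (pos X i) \in occupied X)%:R) * U (coord X).
Proof.
(* Adjacent pairs are counted by their left or by their right member. *)
have blocked : \sum_i (ordS (pos X i) \in occupied X)%:R =
    \sum_j (site (coord X j - 1) \in occupied X)%:R :> K.
  rewrite (sum_occupied_indicator X (fun s => (ordS s \in occupied X)%:R)).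
  rewrite (reindex_inj (@ord_pred_inj L)) /=.
  rewrite -[RHS]/(\sum_j (site ((pos X j)%:Z - 1) \in occupied X)%:R).
  rewrite (sum_occupied_indicator X (fun s => (site (s%:Z - 1) \in occupied X)%:R)).
  by apply: eq_bigr => s _; rewrite ord_predK mulrC (ord_predE L_gt0).
rewrite blocked big_split /= [RHS]addrC.
have -> : \sum_Y (\sum_i (p * zeta * (right_step Y X (pos Y i))%:R
      + q * (left_step Y X (pos Y i))%:R * zeta ^- push_size Y (pos Y i))) * U (coord Y)
    = p * zeta * (\sum_Y (\sum_i (right_step Y X (pos Y i))%:R) * U (coord Y))
      + q * \sum_Y (\sum_i (left_step Y X (pos Y i))%:R
               * zeta ^- push_size Y (pos Y i)) * U (coord Y).
  rewrite !mulr_sumr -big_split; apply: eq_bigr => Y _ /=.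
  rewrite big_split mulrDl -!mulr_sumr; congr (_ + _); first by rewrite mulrA.
  by rewrite mulrA mulr_sumr; congr (_ * _); apply: eq_bigr => i _; rewrite mulrA.
rewrite left_moves_sum right_moves_sum addrA; congr (_ + _); last by rewrite mulr_sumr.
rewrite mulr_sumr mulr_sumr mulr_suml -big_split; apply: eq_bigr => j _ /=.
case: (boolP (site _ \in _)) => [occ|_].
  rewrite mulr1 mul0r mulr0 addr0; congr (_ * _).
  exact: U_right_blocked.
by rewrite mulr0 mul0r add0r mul1r mulrA.
Qed.
End ForwardEquation.

(** * Lower bounds for transition functions *)

Lemma near0_right (R : realType) (P : R -> Prop) :
  (\forall h \near 0^'+, P h) -> exists2 d : R, 0 < d & forall h, 0 < h < d -> P h.
Proof.
move=> /nbhs_ballP[d d_gt0 H]; exists d => // h /andP[h_gt0 lt_hd].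
by apply: H => //=; rewrite /ball /= sub0r normrN gtr0_norm.
Qed.

Lemma small_fraction (R : realType) (h d : R) : 0 < h -> 0 < d ->
  exists n : nat, h / n.+1%:R < d.
Proof.
move=> h_gt0 d_gt0; exists (Num.bound (h / d)).
have := archi_boundP (divr_ge0 (ltW h_gt0) (ltW d_gt0)) => lt_b.
rewrite ltr_pdivrMr ?ltr0n // mulrC -ltr_pdivrMr //.
by apply: lt_trans lt_b _; rewrite ltr_nat.
Qed.

Lemma bernoulli_ineq (R : realDomainType) (x : R) (n : nat) :
  0 <= x -> x <= 1 -> 1 - n%:R * x <= (1 - x) ^+ n.
Proof.
move=> x_ge0 x_le1; elim: n => [|n IH]; first by rewrite mul0r subr0 expr0.
rewrite exprS; apply: le_trans (ler_wpM2l _ IH); last by rewrite subr_ge0.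
rewrite -natr1 mulrBr mulr1 mulrBl mul1r opprB mulrDl mul1r.
have : 0 <= n%:R * x * x by rewrite !mulr_ge0 ?ler0n.
by lra.
Qed.

Section TransitionLowerBounds.
Variables (R : realType) (S : countType) (rate : S -> S -> R).
Variables (P : R -> S -> S -> R) (exit_rate : S -> R) (C : R).
Hypothesis P_trans : is_transition_function rate P.
Hypothesis exit_rateE : forall z,
  (\esum_(z' in [set z' | z' != z]) (rate z z')%:E = (exit_rate z)%:E)%E.
Hypothesis exit_bound : forall z, 0 <= exit_rate z <= C.

Lemma chapman_kolmogorov_ge (s t : R) (z z' : S) (F : seq S) :
    0 <= s -> 0 <= t -> uniq F ->
  \sum_(k <- F) P s z k * P t k z' <= P (s + t) z z'.
Proof.
move=> s_ge0 t_ge0 F_uniq; rewrite -lee_fin (transitionD P_trans) //.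
apply: esum_ge; exists [set` F]; first by split => //; exact: finite_seq.
by rewrite -fsbig_seq // sumEFin.
Qed.

Lemma chapman_kolmogorov_diag (s t : R) (z : S) :
  0 <= s -> 0 <= t -> P s z z * P t z z <= P (s + t) z z.
Proof.
move=> s_ge0 t_ge0.
by have := chapman_kolmogorov_ge z z s_ge0 t_ge0 (F := [:: z]) isT; rewrite big_seq1.
Qed.

(** Staying put is supermultiplicative in time, so the infinitesimal bound on a small fraction of h
    is raised to a power, and Bernoulli's inequality restores a bound linear in h. *)
Lemma transition_diag_ge (h : R) (z : S) :
  0 <= h -> 1 - exit_rate z * h <= P h z z.
Proof.
rewrite le_eqVlt => /orP[/eqP <-|h_gt0].
  by rewrite mulr0 subr0 (transition0 P_trans) eqxx.
have [q_ge0 q_leC] := andP (exit_bound z).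
apply/ler_addgt0Pr => e e_gt0; pose e' := e / h.
have e'_gt0 : 0 < e' by rewrite divr_gt0.
have := @transition_exit_rate _ _ _ _ P_trans z; rewrite exit_rateE.
move=> /fine_cvgP[_ /cvgr_le /(_ (exit_rate z + e'))].
rewrite ltrDl => /(_ e'_gt0) /near0_right[d d_gt0 bnd].
have b_gt0 : 0 < Num.min d (exit_rate z + e')^-1.
  by rewrite lt_min d_gt0 invr_gt0 ltr_wpDl.
(* The subinterval s must be short enough for the infinitesimal bound and for (rate + e') s <= 1. *)
have [n lt_n] := small_fraction h_gt0 b_gt0; move: lt_n; rewrite lt_min.
set s := h / n.+1%:R => /andP[lt_sd lt_sq].
have s_gt0 : 0 < s by rewrite divr_gt0 ?ltr0n.
have Ps : 1 - (exit_rate z + e') * s <= P s z z.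
  have := bnd s; rewrite s_gt0 lt_sd => /(_ isT) /=.
  by rewrite ler_pdivrMr //; lra.
have qs_ge0 : 0 <= (exit_rate z + e') * s.
  by rewrite mulr_ge0 ?(ltW s_gt0) // addr_ge0 ?(ltW e'_gt0).
have qs_le1 : (exit_rate z + e') * s <= 1.
  by rewrite mulrC -ler_pdivlMr ?ltr_wpDl // mul1r ltW.
have Pn m : P s z z ^+ m <= P (m%:R * s) z z.
  elim: m => [|m IH]; first by rewrite expr0 mul0r (transition0 P_trans) eqxx.
  rewrite exprS -natr1 mulrDl mul1r addrC.
  apply: le_trans (chapman_kolmogorov_diag _ (ltW s_gt0) _); last first.
    by rewrite mulr_ge0 ?ler0n ?ltW.
  by rewrite ler_wpM2l // (transition_ge0 P_trans) // ltW.
have hE : h = n.+1%:R * s by rewrite mulrC divfK ?pnatr_eq0.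
rewrite [in P _]hE.
have := le_trans (bernoulli_ineq n.+1 qs_ge0 qs_le1)
  (le_trans (lerXn2r n.+1 _ _ Ps) (Pn n.+1)).
rewrite !nnegrE subr_ge0 qs_le1 (transition_ge0 P_trans) ?(ltW s_gt0) // => /(_ isT isT).
rewrite mulrCA -hE => bound; rewrite -lerBlDr; apply: le_trans bound.
have -> : e = e' * h by rewrite divfK ?gt_eqF.
lra.
Qed.

Lemma rate_ge0 (z z' : S) : z != z' -> 0 <= rate z z'.
Proof.
move=> nzz'; have := transition_rate P_trans nzz' => lim.
rewrite leNgt; apply/negP => rate_lt0.
have /cvgr_lt /(_ _ rate_lt0) /near0_right[d d_gt0 bnd] := lim.
have := bnd (d / 2); rewrite divr_gt0 //= gtr_pMr // invf_lt1 ?ltr1n // => /(_ isT).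
rewrite ltNge divr_ge0 // ?(transition_ge0 P_trans) // ltW // divr_gt0 //.
Qed.

(** With [0, h] cut into many short steps, the paths that make the jump from z to z' in one step and
    otherwise stay put contribute about h times the rate, up to the probability C h of another
    jump. *)
Lemma transition_offdiag_ge (h : R) (z z' : S) : z != z' -> 0 <= h -> C * h <= 1 ->
  h * rate z z' * (1 - C * h) <= P h z z'.
Proof.
move=> nzz'; rewrite le_eqVlt => /orP[/eqP <- _|h_gt0 Ch_le1].
  by rewrite mul0r mul0r (transition_ge0 P_trans).
have C_ge0 : 0 <= C by have /andP[] := exit_bound z; apply: le_trans.
have diag_ge k s : 0 <= s -> 1 - C * s <= P s k k.
  move=> s_ge0; apply: le_trans (transition_diag_ge k s_ge0).
  by rewrite lerD2l lerN2 ler_wpM2r //; have /andP[] := exit_bound k.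
have Pn (s : R) m : 0 <= s -> C * (m%:R * s) <= 1 ->
    m%:R * P s z z' * (1 - C * (m%:R * s)) <= P (m%:R * s) z z'.
  move=> s_ge0; elim: m => [|m IH] Cms.
    by rewrite !mul0r (transition_ge0 P_trans).
  have ms_ge0 : 0 <= m%:R * s by rewrite mulr_ge0.
  have Cs_ge0 : 0 <= C * s by rewrite mulr_ge0.
  have Cms_ge0 : 0 <= C * (m%:R * s) by rewrite mulr_ge0.
  have Cms' : C * (m%:R * s) + C * s <= 1.
    by move: Cms; rewrite -natr1 mulrDl mul1r mulrDr.
  rewrite -natr1 [(m%:R + 1) * s]mulrDl mul1r [m%:R * s + s]addrC.
  have := chapman_kolmogorov_ge z z' s_ge0 ms_ge0 (F := [:: z; z']).
  rewrite /= inE nzz' => /(_ isT); rewrite big_cons big_seq1.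
  apply: le_trans.
  have Pzz' := transition_ge0 P_trans z z' s_ge0.
  have m_ge0 := ler0n R m.
  have h1 : (1 - C * s) * (m%:R * P s z z' * (1 - C * (m%:R * s)))
      <= P s z z * P (m%:R * s) z z'.
    apply: ler_pM; [lra| |exact: diag_ge|by apply: IH; lra].
    by rewrite !mulr_ge0 // subr_ge0; lra.
  have h2 : P s z z' * (1 - C * (m%:R * s)) <= P s z z' * P (m%:R * s) z' z'.
    by rewrite ler_wpM2l // diag_ge.
  apply: le_trans (lerD h1 h2).
  set p := P s z z' in Pzz' *; set u := C * s in Cs_ge0 Cms' *.
  have -> : C * (s + m%:R * s) = u + C * (m%:R * s) by rewrite /u; ring.
  set v := C * (m%:R * s) in Cms_ge0 Cms' *.
  rewrite -subr_ge0.
  have -> : (1 - u) * (m%:R * p * (1 - v)) + p * (1 - v) -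
     (m%:R + 1) * p * (1 - (u + v)) = p * (m%:R * (u * v) + u) by ring.
  by rewrite mulr_ge0 // addr_ge0 // mulr_ge0 // mulr_ge0.
apply/ler_addgt0Pr => e e_gt0; pose e' := e / h.
have e'_gt0 : 0 < e' by rewrite divr_gt0.
have := transition_rate P_trans nzz' => /cvgr_ge /(_ (rate z z' - e')).
rewrite gtrDl oppr_lt0 => /(_ e'_gt0) /near0_right[d d_gt0 bnd].
have [n lt_n] := small_fraction h_gt0 d_gt0; set s := h / n.+1%:R in lt_n.
have s_gt0 : 0 < s by rewrite divr_gt0 ?ltr0n.
have hE : h = n.+1%:R * s by rewrite mulrC divfK ?pnatr_eq0.
have := bnd s; rewrite s_gt0 lt_n => /(_ isT); rewrite /= ler_pdivlMr // => Ps.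
have := Pn s n.+1 (ltW s_gt0); rewrite -hE => /(_ Ch_le1) Ph.
rewrite -lerBlDr; apply: le_trans Ph.
have Ch : 0 <= 1 - C * h by rewrite subr_ge0.
have : h * (rate z z' - e') * (1 - C * h) <= n.+1%:R * P s z z' * (1 - C * h).
  rewrite ler_wpM2r //.
  by rewrite {1}hE mulrAC -mulrA ler_wpM2l ?ler0n.
apply: le_trans.
have -> : h * (rate z z' - e') = h * rate z z' - e.
  by rewrite mulrBr [h * e']mulrC divfK ?gt_eqF.
rewrite [leRHS]mulrBl lerB // ler_piMr ?(ltW e_gt0) //.
by rewrite lerBlDr lerDl mulr_ge0 // ltW.
Qed.
End TransitionLowerBounds.

(** * Euler schemes and lumping of states *)

Section KernelOperator.
Variables (S : eqType) (nb : S -> seq S).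

Definition kernel_op (K : pzRingType) (a : S -> K) (b : S -> S -> K)
    (f : S -> K) (z : S) : K :=
  a z * f z + \sum_(z' <- nb z) b z z' * f z'.

(** The finite set of states on which n iterations started at [z] can depend; it reduces statements
    on the countable state space to finite sums. *)
Fixpoint reach (n : nat) (z : S) : seq S :=
  if n is n'.+1 then z :: flatten [seq reach n' z' | z' <- z :: nb z] else [:: z].

Lemma iter_kernel_local (K : pzRingType) (a : S -> K) b (f g : S -> K) n z :
  {in reach n z, f =1 g} ->
  iter n (kernel_op a b) f z = iter n (kernel_op a b) g z.
Proof.
elim: n z => [|n IH] z fg /=; first by apply: fg; rewrite inE.
have sub z' : z' \in z :: nb z -> iter n (kernel_op a b) f z' = iter n (kernel_op a b) g z'.
  move=> z'_in; apply: IH => k k_in; apply: fg; rewrite inE; apply/orP; right.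
  by apply/flatten_mapP; exists z'.
rewrite /kernel_op sub ?mem_head //; congr (_ + _).
by apply: eq_big_seq => z' z'_in; rewrite sub // inE z'_in orbT.
Qed.

Lemma iter_kernel_sum (K : comPzRingType) (a : S -> K) b (I : Type) (r : seq I)
    (c : I -> K) (f : I -> S -> K) n z :
  iter n (kernel_op a b) (fun k => \sum_(i <- r) c i * f i k) z
  = \sum_(i <- r) c i * iter n (kernel_op a b) (f i) z.
Proof.
elim: n z => //= n IH z; rewrite {1}/kernel_op IH.
under [X in _ + X = _]eq_bigr do rewrite IH mulr_sumr.
rewrite exchange_big mulr_sumr -big_split; apply: eq_bigr => i _ /=.
rewrite /kernel_op mulrDr mulrCA; congr (_ + _); rewrite mulr_sumr.
by apply: eq_bigr => k _; rewrite mulrCA.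
Qed.

Lemma iter_kernel_morph (K K' : pzRingType) (phi : {rmorphism K -> K'})
    (a : S -> K) b (f : S -> K) n z :
  iter n (kernel_op (phi \o a) (fun z z' => phi (b z z'))) (phi \o f) z
  = phi (iter n (kernel_op a b) f z).
Proof.
elim: n z => //= n IH z; rewrite {1}/kernel_op IH rmorphD rmorphM rmorph_sum.
by congr (_ + _); apply: eq_bigr => z' _; rewrite rmorphM IH.
Qed.

Lemma iter_kernel_le (K : numDomainType) (a a' : S -> K) b b' (f g : S -> K) n z :
    (forall z, 0 <= a z <= a' z) -> (forall z z', z' \in nb z -> 0 <= b z z' <= b' z z') ->
    (forall z, 0 <= f z <= g z) ->
  0 <= iter n (kernel_op a b) f z <= iter n (kernel_op a' b') g z.
Proof.
move=> ha hb hfg; elim: n z => // n IH z; apply/andP; split=> /=.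
  rewrite addr_ge0 //.
    by apply: mulr_ge0; [have /andP[] := ha z|have /andP[] := IH z].
  rewrite big_seq sumr_ge0 // => z' /hb/andP[b_ge0 _].
  by rewrite mulr_ge0 //; have /andP[] := IH z'.
rewrite lerD //.
  by apply: ler_pM; [have /andP[] := ha z|have /andP[] := IH z|
     have /andP[] := ha z|have /andP[] := IH z].
rewrite !big_seq; apply: ler_sum => z' /hb/andP[b_ge0 le_b].
by apply: ler_pM => //; have /andP[] := IH z'.
Qed.

Lemma iter_kernel_const (K : pzRingType) (a : S -> K) b n z :
    (forall z, a z + \sum_(z' <- nb z) b z z' = 1) ->
  iter n (kernel_op a b) (fun=> 1) z = 1.
Proof.
move=> mass; elim: n z => //= n IH z; rewrite /kernel_op IH mulr1 -[RHS](mass z).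
by congr (_ + _); apply: eq_bigr => z' _; rewrite IH mulr1.
Qed.
End KernelOperator.

Section LumpedChain.
Variables (R : realType) (S : countType) (rate : S -> S -> R) (nb : S -> seq S).
Variables (P : R -> S -> S -> R) (C : R).
Hypothesis P_trans : is_transition_function rate P.
Hypothesis nb_uniq : forall z, uniq (nb z).
Hypothesis nb_neq : forall z, z \notin nb z.
Hypothesis nb_supp : forall z z', z' != z -> z' \notin nb z -> rate z z' = 0.

Definition exit_rate (z : S) : R := \sum_(z' <- nb z) rate z z'.
Hypothesis exit_bound : forall z, exit_rate z <= C.

Definition euler_op (K : fieldType) (phi : R -> K) (h : R) : (S -> K) -> S -> K :=
  kernel_op nb (phi \o (fun z => 1 - h * exit_rate z))
            (fun z z' => phi (h * rate z z')).

(** Jump weights are reduced by the factor 1 - C h, so that the iterates lie below both the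
    transition function and the Euler scheme. *)
Let killed_op (h : R) : (S -> R) -> S -> R :=
  kernel_op nb (fun z => 1 - h * exit_rate z)
            (fun z z' => h * (1 - C * h) * rate z z').

Lemma rate_nb_ge0 z z' : z' \in nb z -> 0 <= rate z z'.
Proof.
move=> z'_in; apply: (rate_ge0 P_trans).
by apply: contraTneq z'_in => ->; rewrite nb_neq.
Qed.

Lemma exit_rate_ge0 z : 0 <= exit_rate z <= C.
Proof.
by rewrite exit_bound andbT /exit_rate big_seq sumr_ge0 // => z' /rate_nb_ge0.
Qed.

Lemma esum_exit_rate z :
  (\esum_(z' in [set z' | z' != z]) (rate z z')%:E = (exit_rate z)%:E)%E.
Proof.
have -> : (\esum_(z' in [set z' | z' != z]) (rate z z')%:E
    = \esum_(z' in [set` nb z]) (rate z z')%:E)%E.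
  rewrite [LHS]esum_mkcond [RHS]esum_mkcond; apply: eq_esum => z' _.
  case: ifPn => [/set_mem /= nz|nz].
    case: ifPn => // /negP out; rewrite nb_supp //.
    by apply/negP => z'_in; apply: out; apply/mem_set.
  case: ifPn => // /set_mem /= z'_in; case/negP: nz; apply/mem_set => /=.
  by apply: contraTneq z'_in => ->; rewrite nb_neq.
rewrite esum_fset; last by move=> z' /set_mem /= /rate_nb_ge0; rewrite lee_fin.
  by rewrite -fsbig_seq // sumEFin.
exact: finite_seq.
Qed.

Let P_exit := fun z => esum_exit_rate z.

Lemma killed_iter_le (h : R) (n : nat) (z z' : S) : 0 <= h -> C * h <= 1 ->
  0 <= iter n (killed_op h) (fun k => (k == z')%:R) z <= P (n%:R * h) z z'.
Proof.
move=> h_ge0 Ch_le1.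
have a_ge0 k : 0 <= 1 - h * exit_rate k.
  have /andP[q_ge0 q_leC] := exit_rate_ge0 k; rewrite subr_ge0 mulrC.
  by apply: le_trans Ch_le1; rewrite ler_wpM2r.
have c_ge0 : 0 <= h * (1 - C * h) by rewrite mulr_ge0 ?subr_ge0.
have iter_ge0 m k : 0 <= iter m (killed_op h) (fun k => (k == z')%:R) k.
  suff /andP[] : 0 <= iter m (killed_op h) (fun k => (k == z')%:R) k
      <= iter m (killed_op h) (fun k => (k == z')%:R) k by [].
  apply: iter_kernel_le => l; first by rewrite a_ge0 lexx.
    by move=> l' /rate_nb_ge0 r_ge0; rewrite lexx mulr_ge0.
  by rewrite lexx ler0n.
rewrite iter_ge0 /=; elim: n z => [|n IH] z /=.
  by rewrite mul0r (transition0 P_trans).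
rewrite -natr1 mulrDl mul1r addrC.
have nh_ge0 : 0 <= n%:R * h by rewrite mulr_ge0.
have := chapman_kolmogorov_ge P_trans z z' h_ge0 nh_ge0 (F := z :: nb z).
rewrite /= nb_neq nb_uniq => /(_ isT); apply: le_trans.
rewrite big_cons; apply: lerD.
  apply: ler_pM => //.
  by rewrite mulrC; apply: (transition_diag_ge P_trans esum_exit_rate exit_rate_ge0).
rewrite !big_seq; apply: ler_sum => k k_in; apply: ler_pM => //.
  by rewrite mulr_ge0 // rate_nb_ge0.
rewrite mulrAC; apply: (transition_offdiag_ge P_trans esum_exit_rate exit_rate_ge0) => //.
by apply: contraTneq k_in => <-; rewrite nb_neq.
Qed.

(** One step loses C h times the probability h [exit_rate] of jumping, hence at most (C h)^2. *)
Lemma killed_iter_mass (h : R) (n : nat) (z : S) : 0 <= h -> C * h <= 1 ->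
  1 - n%:R * (C * h) ^+ 2 <= iter n (killed_op h) (fun=> 1) z.
Proof.
move=> h_ge0 Ch_le1; have /andP[q0 qC] := exit_rate_ge0 z.
have C_ge0 : 0 <= C by apply: le_trans qC.
have Ch_ge0 : 0 <= C * h by rewrite mulr_ge0.
elim: n z {q0 qC} => [|n IH] z /=; first by rewrite mul0r subr0.
have /andP[q_ge0 q_leC] := exit_rate_ge0 z.
have q_leCh : h * exit_rate z <= C * h by rewrite mulrC ler_wpM2r.
have c_ge0 : 0 <= h * (1 - C * h) by rewrite mulr_ge0 ?subr_ge0.
set m := 1 - n%:R * (C * h) ^+ 2 in IH.
have m_le1 : m <= 1 by rewrite /m lerBlDr lerDl mulr_ge0 ?sqr_ge0.
apply: le_trans (_ : (1 - (C * h) * (h * exit_rate z)) * m <= _).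
  rewrite -natr1 mulrDl mul1r opprD addrA -/m mulrBl mul1r lerD2l lerN2.
  have qh_ge0 : 0 <= h * exit_rate z by rewrite mulr_ge0.
  apply: le_trans (_ : (C * h) * (h * exit_rate z) * 1 <= _).
    by rewrite ler_wpM2l // mulr_ge0.
  by rewrite mulr1 expr2 ler_wpM2l.
rewrite /killed_op /kernel_op.
have -> : (1 - C * h * (h * exit_rate z)) * m
    = (1 - h * exit_rate z) * m + \sum_(z' <- nb z) h * (1 - C * h) * rate z z' * m.
  rewrite -mulr_suml -mulr_sumr -/(exit_rate z).
  move: (exit_rate z) => e; ring.
apply: lerD; first by rewrite ler_wpM2l // subr_ge0; apply: le_trans Ch_le1.
rewrite !big_seq; apply: ler_sum => z' z'_in; rewrite ler_wpM2l //.
by rewrite mulr_ge0 // rate_nb_ge0.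
Qed.

Variables (T : eqType) (label : S -> T) (z0 : S) (mu : T -> R).
Variables (t : R) (t_ge0 : 0 <= t).
Hypothesis mu_ge : forall l (F : seq S), uniq F -> {in F, forall z, label z = l} ->
  \sum_(z <- F) P t z0 z <= mu l.
Hypothesis mu_mass : forall J, uniq J -> \sum_(l <- J) mu l <= 1.

(** For each label l the killed mass kappa l is below both mu l and the Euler mass lambda l. Over J
    the mu sum to at most 1, the lambda to 1, and the kappa to at least 1 - (n + 1)(C h)^2; hence mu
    and lambda differ by at most twice that defect in total, and phi is bounded by 1. *)
Lemma lumped_error (n : nat) (phi : T -> R[i]) (J : seq T) :
    C * (t / n.+1%:R) <= 1 -> (forall l, `|phi l| <= 1) -> uniq J ->
    {subset [seq label z | z <- reach nb n.+1 z0] <= J} ->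
  `|\sum_(l <- J) phi l * (mu l)%:C
    - iter n.+1 (euler_op (real_complex R) (t / n.+1%:R)) (phi \o label) z0|
  <= (2 * (C * t) ^+ 2 / n.+1%:R)%:C.
Proof.
set h := t / n.+1%:R => Ch_le1 phi_le1 J_uniq J_sup.
have h_ge0 : 0 <= h by rewrite divr_ge0.
have tE : t = n.+1%:R * h by rewrite mulrC divfK ?pnatr_eq0.
pose ind l z : R := (label z == l)%:R.
pose a z := 1 - h * exit_rate z.
pose kappa l := iter n.+1 (killed_op h) (ind l) z0.
pose lambda l := iter n.+1 (kernel_op nb a (fun z z' => h * rate z z')) (ind l) z0.
have a_ge0 k : 0 <= a k.
  have /andP[q_ge0 q_leC] := exit_rate_ge0 k; rewrite subr_ge0 mulrC.
  by apply: le_trans Ch_le1; rewrite ler_wpM2r.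
have c_ge0 : 0 <= h * (1 - C * h) by rewrite mulr_ge0 ?subr_ge0.
have C_ge0 : 0 <= C by have /andP[q0 qC] := exit_rate_ge0 z0; apply: le_trans qC.
have kappa_mu l : kappa l <= mu l.
  pose F := [seq z <- undup (reach nb n.+1 z0) | label z == l].
  have F_uniq : uniq F by rewrite filter_uniq ?undup_uniq.
  have F_label : {in F, forall z, label z = l}.
    by move=> z; rewrite mem_filter => /andP[/eqP].
  apply: le_trans (mu_ge F_uniq F_label).
  have -> : kappa l = \sum_(z' <- F) 1 *
      iter n.+1 (killed_op h) (fun k => (k == z')%:R) z0.
    rewrite -iter_kernel_sum; apply: iter_kernel_local => k k_in.
    rewrite /ind; case: (boolP (label k == l)) => [kl|nkl].
      have kF : k \in F by rewrite mem_filter kl mem_undup.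
      rewrite (bigD1_seq k) //= eqxx mulr1 big1_seq ?addr0 // => z' /andP[nz' _].
      by rewrite eq_sym (negPf nz') mulr0.
    rewrite big1_seq // => z' /andP[_]; rewrite mem_filter => /andP[z'l _].
    by have [kz|_] := eqVneq k z'; [rewrite kz z'l in nkl|rewrite mulr0].
  apply: ler_sum => z' _; rewrite mul1r [in leRHS]tE.
  by have /andP[] := killed_iter_le n.+1 z0 z' h_ge0 Ch_le1.
have kappa_lambda l : kappa l <= lambda l.
  suff /andP[] : 0 <= kappa l <= lambda l by [].
  apply: iter_kernel_le => z; first by rewrite a_ge0 lexx.
    move=> z' /rate_nb_ge0 r_ge0; rewrite mulr_ge0 //= ler_wpM2r //.
    by rewrite ler_piMr // lerBlDr lerDl mulr_ge0.
  by rewrite /ind ler0n lexx.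
have one_ind (K : pzRingType) (c : T -> K) k : k \in reach nb n.+1 z0 ->
    \sum_(l <- J) c l * (label k == l)%:R = c (label k).
  move=> k_in; have lJ : label k \in J by apply: J_sup; apply: map_f.
  rewrite (bigD1_seq (label k)) //= eqxx mulr1 big1_seq ?addr0 // => l /andP[nl _].
  by rewrite eq_sym (negPf nl) mulr0.
have sum_kappa : 1 - n.+1%:R * (C * h) ^+ 2 <= \sum_(l <- J) kappa l.
  apply: le_trans (killed_iter_mass n.+1 z0 h_ge0 Ch_le1) _.
  rewrite le_eqVlt; apply/orP; left; apply/eqP.
  transitivity (\sum_(l <- J) 1 * kappa l); last by under eq_bigr do rewrite mul1r.
  rewrite -iter_kernel_sum; apply: iter_kernel_local => k k_in.
  by rewrite (one_ind _ (fun=> 1)).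
have sum_lambda : \sum_(l <- J) lambda l = 1.
  transitivity (\sum_(l <- J) 1 * lambda l); first by under eq_bigr do rewrite -[lambda _]mul1r.
  rewrite -iter_kernel_sum -[RHS](iter_kernel_const (nb := nb) (a := a)
    (b := fun z z' => h * rate z z') n.+1 z0); last first.
    by move=> z; rewrite -mulr_sumr -/(exit_rate z) subrK.
  apply: iter_kernel_local => k k_in.
  by rewrite (one_ind _ (fun=> 1)).
have -> : iter n.+1 (euler_op (real_complex R) h) (phi \o label) z0
    = \sum_(l <- J) phi l * (lambda l)%:C.
  under [RHS]eq_bigr do rewrite -[(lambda _)%:C]iter_kernel_morph.
  rewrite -iter_kernel_sum; apply: iter_kernel_local => k k_in /=.
  rewrite -[LHS](one_ind _ phi _ k_in); apply: eq_bigr => l _.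
  by rewrite /ind rmorph_nat.
rewrite -sumrB.
under eq_bigr do rewrite -mulrBr -rmorphB.
apply: le_trans (ler_norm_sum _ _ _) _.
apply: (@le_trans _ _ (\sum_(l <- J) ((mu l - kappa l) + (lambda l - kappa l))%:C)).
  apply: ler_sum => l _; rewrite normrM.
  apply: le_trans (ler_piMl (normr_ge0 _) (phi_le1 l)) _.
  have mk := kappa_mu l; have lk := kappa_lambda l.
  rewrite normc_def /= expr0n addr0 sqrtr_sqr lecR ler_norml.
  by apply/andP; split; lra.
rewrite -rmorph_sum lecR big_split /= !sumrB sum_lambda.
have -> : 2 * (C * t) ^+ 2 / n.+1%:R = 2 * (n.+1%:R * (C * h) ^+ 2).
  have nz : n.+1%:R != 0 :> R by rewrite pnatr_eq0.
  by rewrite /h; field.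
by have := mu_mass J_uniq; move: sum_kappa; lra.
Qed.
End LumpedChain.

(** * The generator of the PushASEP and its Euler scheme *)

Section PushASEPOperator.
Variables (L N : nat).
Local Notation S := (state L N).
Implicit Types (z : S) (x Y : config L N).

(** A jump changes each local current by -1, 0 or 1, coded by 0, 1, 2 in ['I_3]. This gives every
    state a finite list of candidates for its successors. *)
Definition near_state z (c : config L N * {ffun 'I_L -> 'I_3}) : S :=
  (c.1, [ffun i => z.2 i + (c.2 i)%:Z - 1]).

Definition near_states z : seq S :=
  [seq z' <- [seq near_state z c | c : config L N * {ffun 'I_L -> 'I_3}] | z' != z].

Lemma near_state_inj z : injective (near_state z).
Proof.
move=> [X d] [X' d'] [-> /ffunP e]; congr pair; apply/ffunP => i; apply: val_inj.
by have := e i; rewrite !ffunE /=; lia.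
Qed.

Lemma near_states_uniq z : uniq (near_states z).
Proof. by rewrite filter_uniq // map_inj_uniq ?enum_uniq //; exact: near_state_inj. Qed.

Lemma near_states_neq z : z \notin near_states z.
Proof. by rewrite mem_filter eqxx. Qed.

Lemma near_stateP z (Y : config L N) (v : {ffun 'I_L -> int}) :
  (forall i, `|v i - z.2 i| <= 1) -> exists d, (Y, v) = near_state z (Y, d).
Proof.
move=> near; have near2 i : (- 1 <= v i - z.2 i) /\ (v i - z.2 i <= 1).
  by apply/andP; rewrite -ler_norml.
have lt3 i : (`|(v i - z.2 i + 1)%R| < 3)%N.
  by case: (near2 i); move: (v i) (z.2 i) => a b; lia.
exists [ffun i => Ordinal (lt3 i)]; congr pair; apply/ffunP => i.
rewrite !ffunE; case: (near2 i) => /=; move: (v i) (z.2 i) => a b; lia.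
Qed.

(** Once the currents are prescribed within distance 1, the list contains one state for each
    configuration; [v != z.2] ensures that [z] itself, which is left out, is not among them. *)
Lemma sum_near_states (K : pzRingType) z (v : {ffun 'I_L -> int}) (F : S -> K) :
    (forall i, `|v i - z.2 i| <= 1) -> v != z.2 ->
  \sum_(z' <- near_states z) (z'.2 == v)%:R * F z' = \sum_Y F (Y, v).
Proof.
move=> near nv; rewrite big_filter big_map big_enum_cond /= big_mkcond /=.
pose G c := ((near_state z c).2 == v)%:R * F (near_state z c).
rewrite (eq_bigr G) => [|c _]; last first.
  by rewrite /G; case: ifPn => // /negPn /eqP ->; rewrite eq_sym (negPf nv) mul0r.
rewrite (eq_bigr (fun c => G (c.1, c.2))) => [|[] //].
rewrite -(pair_bigA _ (fun Y d => G (Y, d))).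
apply: eq_bigr => Y _; have [d0 e0] := near_stateP Y near.
rewrite (bigD1 d0) // big1 /= => [|d nd]; rewrite /G.
  by rewrite -e0 eqxx mul1r addr0.
case: eqP => [e|_]; last by rewrite mul0r.
case/eqP: nd; suff [] : (Y, d) = (Y, d0) by [].
by apply: (@near_state_inj z); rewrite -e0 -e.
Qed.

Definition right_current z (s : 'I_L) : {ffun 'I_L -> int} :=
  [ffun x => z.2 x + (x == s)%:R].

Definition left_current z (s : 'I_L) : {ffun 'I_L -> int} :=
  [ffun x => z.2 x - (ordS x \in pushed (occupied z.1) s)%:R].

Hypothesis L_gt0 : (0 < L)%N.

Lemma mem_pushed_self (A : {set 'I_L}) s : s \in A -> s \in pushed A s.
Proof. by rewrite /pushed; case: L L_gt0 A s => // k _ A s sA /=; rewrite sA mem_head. Qed.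

Lemma right_current_near z s i : `|right_current z s i - z.2 i| <= 1.
Proof. by rewrite ffunE addrC addKr; case: eqP. Qed.

Lemma left_current_near z s i : `|left_current z s i - z.2 i| <= 1.
Proof. by rewrite ffunE addrC addKr normrN; case: (_ \in _). Qed.

Lemma right_current_neq z s : right_current z s != z.2.
Proof.
apply/eqP => /ffunP /(_ s); rewrite ffunE eqxx.
by move: (z.2 s) => a; lia.
Qed.

Lemma left_current_neq z s : s \in occupied z.1 -> left_current z s != z.2.
Proof.
move=> s_in; apply/eqP => /ffunP /(_ (ord_pred s)); rewrite ffunE ord_predK.
by rewrite mem_pushed_self //; move: (z.2 _) => a; lia.
Qed.

Variables (R : realType) (p q : R).

Lemma pushASEP_rateE z z' :
  pushASEP_rate p q z z' =
  \sum_i ((z'.2 == right_current z (pos z.1 i))%:R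
             * (p * (right_step z.1 z'.1 (pos z.1 i))%:R)
          + (z'.2 == left_current z (pos z.1 i))%:R
             * (q * (left_step z.1 z'.1 (pos z.1 i))%:R)).
Proof.
apply: eq_bigr => i _; rewrite ![_%:R * (_ * _)]mulrCA -!natrM !mulnb.
congr (_ * _%:R + _ * _%:R); congr nat_of_bool; rewrite [RHS]andbC //.
by rewrite /right_step -andbA.
Qed.

(** Stated through a ring morphism to serve both the real exit rates and the complex Euler
    operator. *)
Lemma sum_near_rate (K : pzRingType) (phi : {rmorphism R -> K}) z (F : S -> K) :
  \sum_(z' <- near_states z) phi (pushASEP_rate p q z z') * F z' =
  \sum_i (phi p * \sum_Y (right_step z.1 Y (pos z.1 i))%:R
                     * F (Y, right_current z (pos z.1 i))
           + phi q * \sum_Y (left_step z.1 Y (pos z.1 i))%:R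
                     * F (Y, left_current z (pos z.1 i))).
Proof.
under eq_bigr do rewrite pushASEP_rateE rmorph_sum mulr_suml.
rewrite exchange_big /=; apply: eq_bigr => i _.
have occ_i : pos z.1 i \in occupied z.1 by rewrite imset_f.
under eq_bigr => z' _ do
  rewrite rmorphD !rmorphM !rmorph_nat mulrDl -![_%:R * _ * F z']mulrA.
rewrite big_split /= !mulr_sumr; congr (_ + _).
  rewrite (sum_near_states (fun z' => phi p * (right_step z.1 z'.1 (pos z.1 i))%:R * F z')
     (right_current_near z (pos z.1 i)) (right_current_neq z _)) /=.
  by apply: eq_bigr => Y _; rewrite mulrA.
rewrite (sum_near_states (fun z' => phi q * (left_step z.1 z'.1 (pos z.1 i))%:R * F z')
   (left_current_near z (pos z.1 i)) (left_current_neq occ_i)) /=.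
by apply: eq_bigr => Y _; rewrite mulrA.
Qed.

Lemma near_states_supp z z' : z' != z -> z' \notin near_states z ->
  pushASEP_rate p q z z' = 0.
Proof.
move=> nz; rewrite mem_filter nz /= => out; rewrite pushASEP_rateE big1 // => i _.
have far (v : {ffun 'I_L -> int}) : (forall i, `|v i - z.2 i| <= 1) -> z'.2 != v.
  move=> near; apply: contraNneq out => e; have [d ed] := near_stateP z'.1 near.
  apply/mapP; exists (z'.1, d); first by rewrite mem_enum.
  by rewrite -ed -e; case: (z').
rewrite (negPf (far _ (right_current_near z _))) (negPf (far _ (left_current_near z _))).
by rewrite !mul0r addr0.
Qed.

Hypotheses (N_gt0 : (0 < N)%N) (ltNL : (N < L)%N).
Hypotheses (p_ge0 : 0 <= p) (q_ge0 : 0 <= q) (pq1 : p + q = 1).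

Lemma sum_right_step x i :
  \sum_Y (right_step x Y (pos x i))%:R = (ordS (pos x i) \notin occupied x)%:R :> R.
Proof.
rewrite /right_step; case: (boolP (_ \notin _)) => [free|_] /=; last by rewrite big1.
have [|Y occY] := config_swap (e := pos x i) _ free; first by rewrite imset_f.
have /= := sum_config_eq (K := R) (fun=> 1) occY.
by rewrite -/(move_right _ _); under eq_bigr do rewrite mulr1.
Qed.

Lemma sum_left_step x i : \sum_Y (left_step x Y (pos x i))%:R = 1 :> R.
Proof.
have occ_i : pos x i \in occupied x by rewrite imset_f.
have eps2 : - 1 * - 1 = 1 :> int by [].
have ltA : (#|occupied x| < L)%N by rewrite card_occupied.
have := run_length_unique L_gt0 (pos x i) eps2 ltA; rewrite occ_i => sum1.
have [d run] : exists d : 'I_L, run_length L_gt0 (- 1) (occupied x) (pos x i) d.+1.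
  apply: contrapT => no_run; move: sum1; rewrite big1 // => d _.
  by apply/eqP; rewrite eqb0; apply/negP => run; apply: no_run; exists d.
have /run_lengthP[_ free] := run.
have [Y occY] := config_swap occ_i free.
have /= := sum_config_eq (K := R) (fun=> 1) occY.
rewrite /left_step (move_left_run (L_gt0 := L_gt0) (d := d.+1)) ?ltn_ord //.
by under eq_bigr do rewrite mulr1.
Qed.

Lemma pushASEP_exit_rate z :
  exit_rate (@pushASEP_rate R L N p q) near_states z
  = N%:R - p * \sum_i (ordS (pos z.1 i) \in occupied z.1)%:R.
Proof.
rewrite /exit_rate.
have := sum_near_rate idfun z (fun=> 1 : R).
under eq_bigr do rewrite mulr1.
move=> ->; rewrite mulr_sumr.
transitivity (\sum_(i < N) (1 - p * (ordS (pos z.1 i) \in occupied z.1)%:R)); last first.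
  by rewrite sumrB sumr_const card_ord.
apply: eq_bigr => i _.
under eq_bigr do rewrite mulr1; rewrite sum_right_step.
under eq_bigr do rewrite mulr1; rewrite sum_left_step /=.
by have := pq1; case: (_ \in _) => /=; lra.
Qed.

Lemma pushASEP_exit_bound z :
  exit_rate (@pushASEP_rate R L N p q) near_states z <= N%:R.
Proof. by rewrite pushASEP_exit_rate lerBlDr lerDl mulr_ge0 // sumr_ge0. Qed.

Definition current_label z : config L N * int := (z.1, \sum_i z.2 i).

Lemma sum_right_current z s : \sum_i right_current z s i = \sum_i z.2 i + 1.
Proof.
under eq_bigr do rewrite ffunE; rewrite big_split /=; congr (_ + _).
by rewrite (bigD1 s) //= eqxx big1 ?addr0 // => i /negPf ->.
Qed.

Lemma sum_left_current z i :
  \sum_j left_current z (pos z.1 i) j = \sum_j z.2 j - (push_size z.1 (pos z.1 i))%:Z.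
Proof.
under eq_bigr do rewrite ffunE; rewrite sumrB; congr (_ - _).
by rewrite /push_size -natz natr_sum.
Qed.

Variables (zeta : R[i]) (zeta_neq0 : zeta != 0).

(** The test function whose expectation at time t is the generating function at [x]. *)
Definition current_weight x (l : config L N * int) : R[i] :=
  zeta ^ l.2 * (l.1 == x)%:R.

Local Notation euler h := (euler_op (@pushASEP_rate R L N p q) near_states (real_complex R) h).

(** The weights are closed under an Euler step: a jump multiplies zeta^Q by a power depending only
    on the two configurations and on the jump, so the infinite state space reduces to a linear
    system indexed by configurations. *)
Lemma euler_current_weight (h : R) x z :
  euler h (current_weight x \o current_label) z =
  \sum_Y ((Y == x)%:R * (1 - h * (N%:R - p * \sum_i (ordS (pos Y i) \in occupied Y)%:R))%:C
     + h%:C * \sum_i (p%:C * zeta * (right_step Y x (pos Y i))%:R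
          + q%:C * (left_step Y x (pos Y i))%:R * zeta ^- push_size Y (pos Y i)))
    * current_weight Y (current_label z).
Proof.
rewrite (bigD1 z.1) //= [X in _ = _ + X]big1 ?addr0; last first.
  by move=> Y nY; rewrite /current_weight /= (eq_sym z.1) (negPf nY) !mulr0.
rewrite /euler_op /kernel_op /= pushASEP_exit_rate.
rewrite mulrDl; congr (_ + _).
  rewrite /current_weight /= eqxx mulr1 mulrCA mulrC; congr (_ * _).
  by rewrite mulrC.
under eq_bigr do rewrite rmorphM -mulrA.
rewrite -mulr_sumr -mulrA; congr (_ * _).
rewrite (sum_near_rate (real_complex R)) mulr_suml; apply: eq_bigr => i _.
rewrite mulrDl; congr (_ + _).
  rewrite (bigD1 x) //= big1 ?addr0; last first.
    by move=> Y nY; rewrite /current_weight /= (negPf nY) !mulr0.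
  rewrite /current_weight /= !eqxx !mulr1 sum_right_current expfzDr // expr1z.
  rewrite -!mulrA; congr (_ * _); rewrite [RHS]mulrCA; congr (_ * _).
  exact: mulrC.
rewrite (bigD1 x) //= big1 ?addr0; last first.
  by move=> Y nY; rewrite /current_weight /= (negPf nY) !mulr0.
rewrite /current_weight /= !eqxx !mulr1 sum_left_current expfzDr // -!mulrA.
by congr (_ * (_ * _)); rewrite mulrC -exprnN.
Qed.

Definition euler_evolution (h : R) (U : nat -> ('I_N -> int) -> R[i]) :=
  forall n y, U n.+1 y = U n y + h%:C * \sum_j
       (p%:C * (zeta * U n (bump_at y j (- 1)))
        + q%:C * (zeta^-1 * U n (bump_at y j 1)) - U n y).

(** The first Euler step is expanded over the predecessors of [x] and the remaining n steps are
    given by induction. [forward_equation] identifies the result with the free evolution, the exit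
    rate N - p (blocked particles) matching the terms - U and the blocked terms. *)
Lemma euler_bethe (U : nat -> ('I_N -> int) -> R[i]) (h : R) (Y0 : config L N) n x :
    (forall n y, U n (rotate_coord L y) = U n y) ->
    (forall n y (j j' : 'I_N), j' = j.+1 :> nat -> y j = y j' ->
       U n (bump_at y j' 1) = zeta * U n y) ->
    euler_evolution h U ->
    (forall x, U 0%N (coord x) = (Y0 == x)%:R) ->
  iter n (euler h) (current_weight x \o current_label) (Y0, [ffun=> 0])
  = U n (coord x).
Proof.
move=> U_rot U_bdy U_evol U_init; elim: n x => [|n IH] x.
  rewrite /= U_init /current_weight /= big1 ?expr0z ?mul1r // => i _.
  by rewrite ffunE.
rewrite iterSr (_ : euler h _ = fun z => \sum_Y
     ((Y == x)%:R * (1 - h * (N%:R - p * \sum_i (ordS (pos Y i) \in occupied Y)%:R))%:C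
     + h%:C * \sum_i (p%:C * zeta * (right_step Y x (pos Y i))%:R
          + q%:C * (left_step Y x (pos Y i))%:R * zeta ^- push_size Y (pos Y i)))
    * (current_weight Y \o current_label) z); last first.
  by apply/funext => z; rewrite euler_current_weight.
rewrite iter_kernel_sum; under eq_bigr do rewrite IH mulrDl.
rewrite big_split /= (bigD1 x) //= eqxx mul1r.
rewrite [X in _ * _ + X + _ = _]big1 ?addr0; last first.
  by move=> Y /negPf ->; rewrite !mul0r.
under [X in _ + X = _]eq_bigr do rewrite -mulrA.
rewrite -mulr_sumr U_evol sumrB.
rewrite (forward_equation N_gt0 L_gt0 ltNL zeta_neq0 (U_rot n) (U_bdy n)).
rewrite sumr_const card_ord -[_ *+ N]mulr_natl.
rewrite !(rmorphB, rmorphM, rmorph1, rmorph_sum, rmorph_nat) /=.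
have -> : \sum_i (real_complex R) (ordS (pos x i) \in occupied x)%:R
    = \sum_i (ordS (pos x i) \in occupied x)%:R :> R[i].
  by apply: eq_bigr => i _; rewrite rmorph_nat.
by ring.
Qed.
End PushASEPOperator.

(** * The law of the configuration and the total current *)

Lemma normr_exprz (K : numFieldType) (x : K) (n : int) : `|x ^ n| = `|x| ^ n.
Proof. by case: n => n; rewrite /exprz ?normfV normrX. Qed.

Lemma measure_disjoint_seq (R : realType) (d : measure_display)
    (T : measurableType d) (mu : probability T R) (I : choiceType) (F : seq I)
    (A : I -> set T) : uniq F -> (forall i, measurable (A i)) ->
    (forall i j x, A i x -> A j x -> i = j) ->
  (\sum_(i <- F) fine (mu (A i)))%:E = mu (\bigcup_(i in [set` F]) A i).
Proof.
move=> F_uniq A_meas A_disj; rewrite measure_fin_bigcup //.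
- rewrite -fsbig_seq // -sumEFin; apply: eq_bigr => i _.
  by rewrite fineK // fin_num_measure.
- by apply/trivIsetP => i j _ _ /eqP nij; rewrite -subset0 => x [/A_disj h /h].
Qed.

Section CurrentLaw.
Variables (R : realType) (L N : nat) (p q : R).
Hypotheses (N_gt0 : (0 < N)%N) (L_gt0 : (0 < L)%N) (ltNL : (N < L)%N).
Hypotheses (p_ge0 : 0 <= p) (q_ge0 : 0 <= q) (pq1 : p + q = 1).
Variables (Y : config L N) (d : measure_display) (T : measurableType d).
Variables (Pr : probability T R) (X : R -> T -> config L N).
Variable Qloc : R -> T -> {ffun 'I_L -> int}.
Hypothesis pushASEP : is_pushASEP p q Y Pr X Qloc.
Variables (t : R) (t_ge0 : 0 <= t).

Definition current_event (l : config L N * int) : set T :=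
  [set omega | X t omega = l.1 /\ total_current (Qloc t) omega = l.2].

Lemma state_event_measurable (z : state L N) :
  measurable [set omega | (X t omega, Qloc t omega) = z].
Proof. exact: (chain_measurable pushASEP). Qed.

Lemma current_event_measurable l : measurable (current_event l).
Proof.
have -> : current_event l = \bigcup_(z : state L N)
   (if current_label z == l then [set omega | (X t omega, Qloc t omega) = z] else set0).
  apply/seteqP; split=> omega.
    case: l => x Q [/= eX eQ]; exists (X t omega, Qloc t omega) => //.
    have -> : current_label (X t omega, Qloc t omega) = (x, Q) by rewrite -eX -eQ.
    by rewrite eqxx.
  by move=> [z _]; case: eqP => // <- /= <-.
apply: countable_bigcupT_measurable => [|z]; first exact: countableP.
by case: eqP => _; [exact: state_event_measurable|exact: measurable0].
Qed.

(** [lumped_error] with the label (configuration, total current), the additivity of [Pr] over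
    disjoint states supplying its hypotheses. [J0] collects the current values reachable in n + 1
    Euler steps. *)
Lemma current_law_error (zeta : R[i]) (U : nat -> ('I_N -> int) -> R[i]) n x :
    `|zeta| = 1 -> N%:R * (t / n.+1%:R) <= 1 ->
    (forall n y, U n (rotate_coord L y) = U n y) ->
    (forall n y (j j' : 'I_N), j' = j.+1 :> nat -> y j = y j' ->
       U n (bump_at y j' 1) = zeta * U n y) ->
    euler_evolution p q zeta (t / n.+1%:R) U ->
    (forall x, U 0%N (coord x) = (Y == x)%:R) ->
  exists J0 : seq int, forall J, uniq J -> {subset J0 <= J} ->
  `|\sum_(Q <- J) zeta ^ Q * (fine (Pr (current_event (x, Q))))%:C
    - U n.+1 (coord x)| <= (2 * (N%:R * t) ^+ 2 / n.+1%:R)%:C.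
Proof.
move=> zeta1 small U_rot U_bdy U_evol U_init.
have zeta_neq0 : zeta != 0 by rewrite -normr_eq0 zeta1 oner_neq0.
have [P P_trans law] := chain_law pushASEP.
pose z0 : state L N := (Y, [ffun=> 0]).
have PE z : P t z0 z = fine (Pr [set omega | (X t omega, Qloc t omega) = z]).
  have := law [:: (t, z)]; rewrite /= t_ge0 subr0 mulr1 => /(_ isT) e.
  rewrite -[LHS]/(fine (P t z0 z)%:E) -e; congr (fine (Pr _)).
  by apply/seteqP; split=> omega /=; rewrite andbT => /eqP.
pose mu l := fine (Pr (current_event l)).
have mu_ge l (F : seq (state L N)) : uniq F ->
    {in F, forall z, current_label z = l} -> \sum_(z <- F) P t z0 z <= mu l.
  move=> F_uniq F_lab; rewrite -lee_fin fineK ?fin_num_measure //; last first.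
    exact: current_event_measurable.
  under eq_bigr do rewrite PE.
  rewrite (measure_disjoint_seq Pr F_uniq); last 2 first.
  - exact: state_event_measurable.
  - by move=> z z' omega /= <- <-.
  apply: le_measure; rewrite ?inE; last first.
  - move=> omega [z /= z_in e]; have := F_lab z z_in; rewrite -e.
    by rewrite /current_label /current_event /= => <-.
  - exact: current_event_measurable.
  - apply: fin_bigcup_measurable => [|z _]; first exact: finite_seq.
    exact: state_event_measurable.
have mu_mass (J : seq (config L N * int)) : uniq J -> \sum_(l <- J) mu l <= 1.
  move=> J_uniq; rewrite -lee_fin /mu (measure_disjoint_seq Pr J_uniq).
  - apply: probability_le1; apply: fin_bigcup_measurable => [|l _].
      exact: finite_seq.
    exact: current_event_measurable.
  - exact: current_event_measurable.
  - by move=> [x1 Q1] [x2 Q2] omega [/= <- <-] [/= <- <-].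
pose J0 := [seq (current_label z).2 | z <- reach (@near_states L N) n.+1 z0].
exists J0 => J J_uniq J0J.
pose J' := [seq (Y', Q) | Y' <- enum (config L N), Q <- J].
have J'_uniq : uniq J' by rewrite allpairs_uniq ?enum_uniq // => -[? ?] [? ?].
have J'_sup : {subset [seq current_label z | z <- reach (@near_states L N) n.+1 z0] <= J'}.
  move=> l /mapP[z z_in ->]; apply/allpairsP; exists (z.1, (current_label z).2).
  by rewrite mem_enum /=; split=> //; apply: J0J; apply/mapP; exists z.
have weight_le1 l : `|current_weight zeta x l| <= 1.
  rewrite normrM normr_exprz zeta1 exp1rz mul1r.
  by case: (_ == _); rewrite ?normr1 ?normr0 ?ler01.
have := lumped_error P_trans (@near_states_uniq L N) (@near_states_neq L N)
  (@near_states_supp L N R p q)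
  (pushASEP_exit_bound L_gt0 ltNL p_ge0 pq1) t_ge0
  mu_ge mu_mass small weight_le1 J'_uniq J'_sup.
rewrite (euler_bethe L_gt0 N_gt0 ltNL pq1 zeta_neq0 _ _ U_rot U_bdy U_evol U_init).
congr (`|_ - _| <= _); rewrite big_allpairs /= big_enum (bigD1 x) //=.
rewrite [X in _ + X]big1 ?addr0 => [|Y' nY']; last first.
  by rewrite big1 // => Q _; rewrite /current_weight /= (negPf nY') mulr0 mul0r.
by apply: eq_bigr => Q _; rewrite /current_weight /= eqxx mulr1.
Qed.
End CurrentLaw.

Import Normc.

(** * Norms and continuity of complex-valued functions *)

Section ComplexContinuity.
Variable R : realType.
Local Notation C := R[i].

Lemma normcE (z : C) : normc z = Num.sqrt ((complex.Re z) ^+ 2 + (complex.Im z) ^+ 2).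
Proof. by case: z. Qed.

Lemma normr_normc (z : C) : `|z| = (normc z)%:C.
Proof. by rewrite normc_def normcE. Qed.

Lemma normc_ge0 (z : C) : 0 <= normc z.
Proof. by rewrite normcE sqrtr_ge0. Qed.

Lemma normc_real (x : R) : normc x%:C = `|x|.
Proof. by rewrite normcE /= expr0n addr0 sqrtr_sqr. Qed.

Lemma normc_Re (z : C) : `|complex.Re z| <= normc z.
Proof. by have := normc_ge_Re z; rewrite normr_normc lecR. Qed.

Lemma normc_Im (z : C) : `|complex.Im z| <= normc z.
Proof.
rewrite normcE -sqrtr_sqr ler_wsqrtr // lerDr; exact: sqr_ge0.
Qed.

Lemma normc_le_ReIm (z : C) : normc z <= `|complex.Re z| + `|complex.Im z|.
Proof.
case: z => a b /=; have s_ge0 : 0 <= `|a| + `|b| by rewrite addr_ge0.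
rewrite -(ger0_norm s_ge0) -sqrtr_sqr ler_wsqrtr // sqrrD !real_normK ?num_real //.
by rewrite lerD2r lerDl mulrn_wge0 // mulr_ge0.
Qed.

Lemma normcB (z w : C) : normc (z - w) = normc (w - z).
Proof. by rewrite -normcN opprB. Qed.

Lemma normc_sum (I : Type) (r : seq I) (F : I -> C) :
  normc (\sum_(i <- r) F i) <= \sum_(i <- r) normc (F i).
Proof.
elim/big_rec2: _ => [|i a b _ le_ba]; first by rewrite normc0.
by apply: le_trans (le_normcD _ _) _; rewrite lerD2l.
Qed.

Lemma normc_prod (I : Type) (r : seq I) (F : I -> C) :
  normc (\prod_(i <- r) F i) = \prod_(i <- r) normc (F i).
Proof. by elim/big_rec2: _ => [|i a b _ <-]; rewrite ?normc1 ?normcM. Qed.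

Lemma normcX (z : C) n : normc (z ^+ n) = normc z ^+ n.
Proof. by elim: n => [|n IH]; rewrite ?expr0 ?normc1 // !exprS normcM IH. Qed.

Lemma normc_exprz (z : C) (n : int) : normc (z ^ n) = normc z ^ n.
Proof. by case: n => n; rewrite /exprz ?normcV normcX. Qed.

Lemma normc_gt0 (z : C) : (0 < normc z) = (z != 0).
Proof.
rewrite lt_def normc_ge0 andbT; apply/negP/negP => h /eqP e; apply: h.
  by rewrite e normc0.
by apply/eqP/eq0_normc.
Qed.

(** Componentwise, as [cintegral] is defined by components. *)
Definition ccontinuous (g : R -> C) :=
  continuous (fun x => complex.Re (g x)) /\ continuous (fun x => complex.Im (g x)).

Lemma ccontinuous_cst (c : C) : ccontinuous (fun=> c).
Proof. by split=> x; exact: cvg_cst. Qed.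

Lemma ccontinuousD (f g : R -> C) :
  ccontinuous f -> ccontinuous g -> ccontinuous (fun x => f x + g x).
Proof.
have ReD (u v : C) : complex.Re (u + v) = complex.Re u + complex.Re v by case: u; case: v.
have ImD (u v : C) : complex.Im (u + v) = complex.Im u + complex.Im v by case: u; case: v.
move=> [f1 f2] [g1 g2]; split=> x.
  by under eq_fun do rewrite ReD; apply: cvgD; [exact: f1|exact: g1].
by under eq_fun do rewrite ImD; apply: cvgD; [exact: f2|exact: g2].
Qed.

Lemma ccontinuousM (f g : R -> C) :
  ccontinuous f -> ccontinuous g -> ccontinuous (fun x => f x * g x).
Proof.
have ReM (u v : C) : complex.Re (u * v)
  = complex.Re u * complex.Re v - complex.Im u * complex.Im v by case: u; case: v.
have ImM (u v : C) : complex.Im (u * v)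
  = complex.Re u * complex.Im v + complex.Im u * complex.Re v by case: u; case: v.
move=> [f1 f2] [g1 g2]; split=> x.
  under eq_fun do rewrite ReM; apply: cvgB; apply: cvgM;
    by [exact: f1|exact: f2|exact: g1|exact: g2].
under eq_fun do rewrite ImM; apply: cvgD; apply: cvgM;
  by [exact: f1|exact: f2|exact: g1|exact: g2].
Qed.

Lemma ccontinuousV (f : R -> C) : (forall x, f x != 0) ->
  ccontinuous f -> ccontinuous (fun x => (f x)^-1).
Proof.
have ReV (u : C) : complex.Re u^-1
  = complex.Re u / (complex.Re u ^+ 2 + complex.Im u ^+ 2) by case: u.
have ImV (u : C) : complex.Im u^-1
  = - (complex.Im u / (complex.Re u ^+ 2 + complex.Im u ^+ 2)) by case: u.
move=> f0 [f1 f2].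
have D0 x : complex.Re (f x) ^+ 2 + complex.Im (f x) ^+ 2 != 0.
  rewrite paddr_eq0 ?sqr_ge0 // !expf_eq0 /=; apply: contra (f0 x).
  by case: (f x) => a b /= /andP[/eqP -> /eqP ->].
have D_cont x : (fun x => complex.Re (f x) ^+ 2 + complex.Im (f x) ^+ 2) y
    @[y --> x] --> complex.Re (f x) ^+ 2 + complex.Im (f x) ^+ 2.
  by apply: cvgD; rewrite !expr2; under eq_fun do rewrite expr2; apply: cvgM;
    by [exact: f1|exact: f2].
split=> x.
  under eq_fun do rewrite ReV; apply: cvgM; first exact: f1.
  by apply: cvgV; [exact: D0|exact: D_cont].
under eq_fun do rewrite ImV; apply: cvgN; apply: cvgM; first exact: f2.
by apply: cvgV; [exact: D0|exact: D_cont].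
Qed.

Lemma continuous_uniform_limit (f : R -> R) :
  (forall e, 0 < e -> exists2 g : R -> R, continuous g & forall x, `|f x - g x| <= e) ->
  continuous f.
Proof.
move=> lim x; apply/cvgrPdist_le => e e_gt0.
have [|g g_cont fg] := lim (e / 3); first by rewrite divr_gt0.
have := g_cont x => /cvgrPdist_le /(_ (e / 3)).
rewrite divr_gt0 // => /(_ isT); apply: filterS => y gxy.
have -> : f x - f y = (f x - g x) + (g x - g y) + (g y - f y) by ring.
apply: le_trans (ler_normD _ _) _.
have := ler_normD (f x - g x) (g x - g y).
by have := fg x; have := fg y; rewrite (distrC (f y)); lra.
Qed.

Lemma ccontinuous_uniform_limit (f : R -> C) :
  (forall e, 0 < e -> exists2 g, ccontinuous g & forall x, normc (f x - g x) <= e) ->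
  ccontinuous f.
Proof.
have ReB (u v : C) : complex.Re (u - v) = complex.Re u - complex.Re v by case: u; case: v.
have ImB (u v : C) : complex.Im (u - v) = complex.Im u - complex.Im v by case: u; case: v.
move=> lim; split; apply: continuous_uniform_limit => e /lim[g [g1 g2] fg].
  exists (fun x => complex.Re (g x)) => // x; rewrite -ReB.
  exact: le_trans (normc_Re _) (fg x).
exists (fun x => complex.Im (g x)) => // x; rewrite -ImB.
exact: le_trans (normc_Im _) (fg x).
Qed.

Lemma ccontinuous_prod (I : Type) (r : seq I) (F : I -> R -> C) :
  (forall i, ccontinuous (F i)) -> ccontinuous (fun x => \prod_(i <- r) F i x).
Proof.
move=> hF; elim: r => [|i r IH].
  by under eq_fun do rewrite big_nil; exact: ccontinuous_cst.
by under eq_fun do rewrite big_cons; apply: ccontinuousM.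
Qed.

Lemma ccontinuousX (f : R -> C) n : ccontinuous f -> ccontinuous (fun x => f x ^+ n).
Proof.
move=> hf; elim: n => [|n IH]; first exact: ccontinuous_cst.
by under eq_fun do rewrite exprS; apply: ccontinuousM.
Qed.

Lemma ccontinuous_exprz (f : R -> C) (n : int) : (forall x, f x != 0) ->
  ccontinuous f -> ccontinuous (fun x => f x ^ n).
Proof.
move=> f0 hf; case: n => n; first exact: ccontinuousX.
apply: (ccontinuousV (f := fun x => f x ^+ n.+1)); last exact: ccontinuousX.
by move=> x; rewrite expf_neq0.
Qed.
End ComplexContinuity.

(** * Integrals over segments and circles *)

Section SegmentIntegral.
Variable R : realType.
Local Notation C := R[i].
Variables (a b : R) (le_ab : a <= b).

Lemma continuous_integrable (f : R -> R) : continuous f ->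
  (@lebesgue_measure R).-integrable `[a, b] (EFin \o f).
Proof.
move=> f_cont; apply: continuous_compact_integrable; first exact: segment_compact.
exact: continuous_subspaceT.
Qed.

Lemma cintegral_linear (c : C) (f g : R -> C) : ccontinuous f -> ccontinuous g ->
  cintegral a b (fun x => c * f x + g x) = c * cintegral a b f + cintegral a b g.
Proof.
move=> [f1 f2] [g1 g2]; rewrite /cintegral.
have [If1 If2] := (continuous_integrable f1, continuous_integrable f2).
have [Ig1 Ig2] := (continuous_integrable g1, continuous_integrable g2).
have mI : measurable (`[a, b] : set R) by exact: measurable_itv.
case: c => u v.
have ReE (z w : C) : complex.Re ((u +i* v) * z + w)
  = u * complex.Re z + - v * complex.Im z + complex.Re w.
  by rewrite mulNr; case: z; case: w.
have ImE (z w : C) : complex.Im ((u +i* v) * z + w)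
  = u * complex.Im z + v * complex.Re z + complex.Im w by case: z; case: w.
have scaled (k : R) (h : R -> R) : continuous h -> continuous (fun x => k * h x).
  by move=> hc x; apply: cvgM; [exact: cvg_cst|exact: hc].
under eq_Rintegral do rewrite ReE.
under [X in _ +i* X]eq_Rintegral do rewrite ImE.
have c1 : continuous (fun x => u * complex.Re (f x) + - v * complex.Im (f x)).
  by move=> x; apply: cvgD; apply: scaled.
have c2 : continuous (fun x => u * complex.Im (f x) + v * complex.Re (f x)).
  by move=> x; apply: cvgD; apply: scaled.
have Iscaled (k : R) (h : R -> R) : continuous h -> (@lebesgue_measure R).-integrable `[a, b]
    (EFin \o (fun x : R => k * h x)).
  by move=> h_cont; apply: continuous_integrable; exact: scaled.
rewrite !RintegralD //; do ?[exact: Iscaled]; do ?[exact: continuous_integrable].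
by rewrite !RintegralZl // mulNr.
Qed.

(** The factor 2 comes from bounding the two components separately. *)
Lemma cintegral_bound (f : R -> C) (M : R) : ccontinuous f ->
  (forall x, normc (f x) <= M) -> normc (cintegral a b f) <= 2 * (b - a) * M.
Proof.
move=> [f1 f2] f_le.
have real_bound (h : R -> R) : continuous h -> (forall x, `|h x| <= M) ->
    `|\int[lebesgue_measure]_(x in `[a, b]) h x| <= (b - a) * M.
  move=> h_cont h_le.
  have habs : continuous (fun x => `|h x|).
    by move=> x; apply: cvg_norm; exact: h_cont.
  have := @le_normr_Rintegral _ _ _ (@lebesgue_measure R) `[a, b] h.
  move=> /(_ (measurable_itv _) (continuous_integrable h_cont)) /le_trans; apply.
  apply: le_trans (_ : \int[lebesgue_measure]_(x in `[a, b]) M <= _).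
    apply: le_Rintegral => [||| x _]; [exact: measurable_itv| | |exact: h_le].
      exact: continuous_integrable.
    by apply: continuous_integrable => x; exact: cvg_cst.
  rewrite Rintegral_cst //.
  have -> : fine (@lebesgue_measure R `[a, b]) = b - a.
    rewrite lebesgue_measure_itv /= lte_fin.
    move: le_ab; rewrite le_eqVlt => /orP[/eqP ->|->] //.
    by rewrite ltxx subrr.
  by rewrite mulrC.
apply: le_trans (normc_le_ReIm _) _ => /=.
have -> : 2 * (b - a) * M = (b - a) * M + (b - a) * M by ring.
apply: lerD; apply: real_bound => // x; apply: le_trans (f_le x).
  exact: normc_Re.
exact: normc_Im.
Qed.

Lemma eq_cintegral (f g : R -> C) : f =1 g -> cintegral a b f = cintegral a b g.
Proof. by move=> fg; congr cintegral; apply/funext. Qed.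
End SegmentIntegral.

Section TrigIntegrals.
Variable R : realType.

Lemma FTC_period (f F : R -> R) : continuous f ->
    (forall x : R, is_derive x (1 : R) F (f x)) -> F (2 * pi) = F 0 ->
  \int[lebesgue_measure]_(x in `[0, 2 * pi]) f x = 0.
Proof.
move=> f_cont F_der F_per.
have pi2_gt0 : 0 < 2 * pi :> R by rewrite mulr_gt0 // pi_gt0.
have F_cont : continuous F.
  by move=> x; apply: differentiable_continuous; apply/derivable1_diffP; have [] := F_der x.
rewrite /Rintegral (continuous_FTC2 (F := F)) //.
- by rewrite F_per /= subrr.
- exact: continuous_subspaceT.
- split.
  + by move=> x _; have [] := F_der x.
  + exact: cvg_at_right_filter (F_cont _).
  + exact: cvg_at_left_filter (F_cont _).
- by move=> x _; rewrite derive1E; have [_ ->] := F_der x.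
Qed.

Lemma is_derive_scale (n x : R) : is_derive x (1 : R) (fun y => n * y) n.
Proof.
have := is_deriveZ (f := id) (x := x) (v := 1) (df := 1) n.
by move=> /(_ (is_derive_id _ _)); rewrite /GRing.scale /= mulr1.
Qed.

Lemma continuous_scale (g : R -> R) (k : R) :
  continuous g -> continuous (fun x => g (k * x)).
Proof.
move=> g_cont x; have k_lim : k * y @[y --> x] --> k * x.
  by apply: cvgM; [exact: cvg_cst|exact: cvg_id].
exact: (cvg_comp _ _ k_lim (g_cont _)).
Qed.

Lemma cos_period (n : nat) : cos (n%:R * (2 * pi)) = 1 :> R.
Proof.
elim: n => [|n IH]; first by rewrite mul0r cos0.
by rewrite -natr1 mulrDl mul1r [X in _ + X]mulr_natl cosD2pi.
Qed.

Lemma sin_period (n : nat) : sin (n%:R * (2 * pi)) = 0 :> R.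
Proof.
elim: n => [|n IH]; first by rewrite mul0r sin0.
by rewrite -natr1 mulrDl mul1r [X in _ + X]mulr_natl sinD2pi.
Qed.

Lemma integral_cos_period (n : nat) :
  \int[lebesgue_measure]_(x in `[0, 2 * pi]) cos (n.+1%:R * x) = 0 :> R.
Proof.
have n0 : n.+1%:R != 0 :> R by rewrite pnatr_eq0.
apply: (FTC_period (F := fun x => n.+1%:R^-1 * sin (n.+1%:R * x))).
- by apply: continuous_scale; exact: continuous_cos.
- move=> x.
  have d1 := is_derive1_comp (f := sin) (g := fun y => n.+1%:R * y)
    (is_derive_sin (n.+1%:R * x)) (is_derive_scale n.+1%:R x).
  have := is_deriveZ (f := sin \o (fun y => n.+1%:R * y)) n.+1%:R^-1 d1.
  by rewrite /GRing.scale /= mulrCA mulVf // mulr1.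
- by rewrite sin_period !mulr0 sin0 mulr0.
Qed.

Lemma integral_sin_period (n : nat) :
  \int[lebesgue_measure]_(x in `[0, 2 * pi]) sin (n.+1%:R * x) = 0 :> R.
Proof.
have n0 : n.+1%:R != 0 :> R by rewrite pnatr_eq0.
apply: (FTC_period (F := fun x => - n.+1%:R^-1 * cos (n.+1%:R * x))).
- by apply: continuous_scale; exact: continuous_sin.
- move=> x.
  have d1 := is_derive1_comp (f := cos) (g := fun y => n.+1%:R * y)
    (is_derive_cos (n.+1%:R * x)) (is_derive_scale n.+1%:R x).
  have := is_deriveZ (f := cos \o (fun y => n.+1%:R * y)) (- n.+1%:R^-1) d1.
  by rewrite /GRing.scale /= mulrCA !mulNr mulVf // mulrN mulr1 opprK.
- by rewrite cos_period !mulr0 cos0.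
Qed.
End TrigIntegrals.


Section Circles.
Variable R : realType.
Local Notation C := R[i].

Lemma complex_ext (u v : C) : complex.Re u = complex.Re v ->
  complex.Im u = complex.Im v -> u = v.
Proof. by case: u; case: v => a b c d /= -> ->. Qed.

Definition unit_point (x : R) : C := cexp ('i * x%:C).

Lemma unit_pointE x : unit_point x = cos x +i* sin x.
Proof.
rewrite /unit_point /cexp.
have -> : 'i * x%:C = 0 +i* x :> C by apply: complex_ext => /=; ring.
by rewrite /= expR0; apply: complex_ext => /=; ring.
Qed.

Lemma normc_unit_point x : normc (unit_point x) = 1.
Proof. by rewrite unit_pointE /= cos2Dsin2 sqrtr1. Qed.

Lemma unit_point_neq0 x : unit_point x != 0.
Proof. by rewrite -normc_gt0 normc_unit_point ltr01. Qed.

Lemma ccontinuous_unit_point : ccontinuous unit_point.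
Proof.
split=> x; under eq_fun do rewrite unit_pointE; rewrite /=.
  exact: continuous_cos.
exact: continuous_sin.
Qed.

Lemma unit_pointX x n : unit_point x ^+ n = cos (n%:R * x) +i* sin (n%:R * x).
Proof.
elim: n => [|n IH]; first by rewrite expr0 mul0r cos0 sin0.
rewrite exprS IH unit_pointE -natr1 mulrDl mul1r [_ + x]addrC cosD sinD.
by apply: complex_ext => /=; ring.
Qed.

Lemma unit_pointXN x n : unit_point x ^- n = cos (n%:R * x) +i* (- sin (n%:R * x)).
Proof.
apply: (mulfI (expf_neq0 n (unit_point_neq0 x))).
rewrite mulfV ?expf_neq0 ?unit_point_neq0 // unit_pointX.
apply: complex_ext => /=; last by ring.
by rewrite mulrN opprK -!expr2 cos2Dsin2.
Qed.

Lemma pi2_ge0 : 0 <= 2 * pi :> R.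
Proof. by rewrite mulr_ge0 // pi_ge0. Qed.

Lemma cintegral_unit_point (n : int) :
  cintegral 0 (2 * pi) (fun x => unit_point x ^ n) = (n == 0)%:R * (2 * pi)%:C.
Proof.
case: n => [[|n]|n].
- rewrite /cintegral; under eq_Rintegral do rewrite expr0z.
  under [X in _ +i* X]eq_Rintegral do rewrite expr0z.
  rewrite /= !Rintegral_cst // mul0r !mul1r.
  have -> : fine (@lebesgue_measure R `[0, 2 * pi]) = 2 * pi.
    by rewrite lebesgue_measure_itv /= lte_fin mulr_gt0 ?pi_gt0 //= subr0.
  by [].
- rewrite /cintegral; under eq_Rintegral do rewrite -exprnP unit_pointX.
  under [X in _ +i* X]eq_Rintegral do rewrite -exprnP unit_pointX.
  by rewrite /= integral_cos_period integral_sin_period mul0r.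
- rewrite /cintegral; under eq_Rintegral do rewrite /exprz unit_pointXN.
  under [X in _ +i* X]eq_Rintegral do rewrite /exprz unit_pointXN.
  rewrite /= integral_cos_period mul0r.
  have -> : \int[lebesgue_measure]_(x in `[0, 2 * pi]) (- sin (n.+1%:R * x)) = 0 :> R.
    under eq_Rintegral do rewrite -mulN1r.
    rewrite RintegralZl // ?integral_sin_period ?mulr0 //.
    by apply/continuous_integrable/continuous_scale; exact: continuous_sin.
  by [].
Qed.

Definition circle_point (c : C) (r : R) (x : R) : C := c + r%:C * unit_point x.

Lemma ccontinuous_circle_point c r : ccontinuous (circle_point c r).
Proof.
apply: ccontinuousD; first exact: ccontinuous_cst.
by apply: ccontinuousM; [exact: ccontinuous_cst|exact: ccontinuous_unit_point].
Qed.

Lemma normc_circle_point c r x : 0 <= r -> normc (circle_point c r x - c) = r.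
Proof.
by move=> r_ge0; rewrite /circle_point addrC addKr normcM normc_real normc_unit_point mulr1 ger0_norm.
Qed.

Lemma circle_integralE c r (f : C -> C) : circle_integral c r f =
  cintegral 0 (2 * pi) (fun x => f (circle_point c r x) * ('i * (r%:C * unit_point x))).
Proof. by []. Qed.

(** In the angle the integrand is a multiple of the (n + 1)-st power of the unit point, whose
    integral over a period is nonzero only for exponent 0. *)
Lemma circle_integral_pow (c : C) (r : R) (n : int) : 0 < r ->
  circle_integral c r (fun w => (w - c) ^ n) = (n == -1)%:R * ((2 * pi)%:C * 'i).
Proof.
move=> r_gt0; have r_neq0 : r%:C != 0 :> C.
  by rewrite -normc_gt0 normc_real gtr0_norm.
rewrite circle_integralE.
rewrite (eq_cintegral _ _ (g := fun x => ('i * r%:C ^ (n + 1)) * unit_point x ^ (n + 1) + 0)).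
  rewrite cintegral_linear.
  - rewrite cintegral_unit_point.
    have -> : cintegral 0 (2 * pi) (fun=> 0) = 0 :> C.
      by rewrite /cintegral /= !Rintegral_cst // !mul0r.
    rewrite addr0 addr_eq0; case: eqP => [->|_]; last by rewrite !mul0r mulr0.
    by rewrite addNr expr0z !mul1r mulr1 mulrC.
  - apply: ccontinuous_exprz; first exact: unit_point_neq0.
    exact: ccontinuous_unit_point.
  - exact: ccontinuous_cst.
move=> x; rewrite addr0 /circle_point addrC addKr.
rewrite expfzMl !expfzDr ?unit_point_neq0 // !expr1z.
by rewrite mulrCA -[RHS]mulrA mulrACA.
Qed.
End Circles.

(* [J] integrates, against a fixed weight, the functions of the class [Ad] over
   a contour [On]; only the values on the contour matter. *)
Record contour_functional (R : realType) (On : R[i] -> Prop)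
    (Ad : (R[i] -> R[i]) -> Prop) (J : (R[i] -> R[i]) -> R[i]) (K : R) : Prop := {
  cf_ext : forall f g, (forall w, On w -> f w = g w) -> J f = J g ;
  cf_id : Ad id ;
  cf_cst : forall c, Ad (fun=> c) ;
  cf_add : forall f g, Ad f -> Ad g -> Ad (fun w => f w + g w) ;
  cf_mul : forall f g, Ad f -> Ad g -> Ad (fun w => f w * g w) ;
  cf_inv : forall f (m : R), 0 < m -> (forall w, On w -> m <= normc (f w)) ->
    Ad f -> Ad (fun w => (f w)^-1) ;
  cf_lim : forall f, (forall e, 0 < e -> exists2 g, Ad g &
    forall w, On w -> normc (f w - g w) <= e) -> Ad f ;
  cf_bdd : forall f, Ad f -> exists M : R, forall w, On w -> normc (f w) <= M ;
  cf_linear : forall a f g, Ad f -> Ad g ->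
    J (fun w => a * f w + g w) = a * J f + J g ;
  cf_ge0 : 0 <= K ;
  cf_bound : forall f (M : R), Ad f -> (forall w, On w -> normc (f w) <= M) ->
    normc (J f) <= K * M }.

(** * Contour integrals as bounded linear functionals *)

Section Circle.
Variable R : realType.
Local Notation C := R[i].

Definition on_circle (c : C) (r : R) (w : C) : Prop := exists x, w = circle_point c r x.

Definition circle_admissible (c : C) (r : R) (f : C -> C) : Prop :=
  ccontinuous (fun x => f (circle_point c r x)) /\
  exists M : R, forall w, on_circle c r w -> normc (f w) <= M.

(** Normalised by 1/(2 pi i) and taken against dw/w, so that the constant 1 has mean 1 on circles
    about 0. *)
Definition circle_mean (c : C) (r : R) (f : C -> C) : C :=
  ((2 * pi)%:C * 'i)^-1 * circle_integral c r (fun w => w^-1 * f w).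

Lemma circle_functional (c : C) (r m : R) : 0 <= r -> 0 < m ->
    (forall w, on_circle c r w -> m <= normc w) ->
  exists K, contour_functional (on_circle c r) (circle_admissible c r)
    (circle_mean c r) K.
Proof.
move=> r_ge0 m_gt0 away.
pose pt := circle_point c r.
have pt_neq0 x : pt x != 0.
  by rewrite -normc_gt0; apply: lt_le_trans m_gt0 _; apply: away; exists x.
have pt_cont : ccontinuous pt by exact: ccontinuous_circle_point.
pose weight x := 'i * (r%:C * unit_point x) : C.
have weight_cont : ccontinuous weight.
  by do 2?[apply: ccontinuousM; first exact: ccontinuous_cst]; exact: ccontinuous_unit_point.
have integrand_cont (f : C -> C) : ccontinuous (fun x => f (pt x)) ->
    ccontinuous (fun x => (pt x)^-1 * f (pt x) * weight x).
  move=> f_cont; apply: ccontinuousM => //; apply: ccontinuousM => //.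
  exact: ccontinuousV.
have normc_i : normc ('i : C) = 1 by rewrite /= expr0n add0r expr1n sqrtr1.
have weight_norm x : normc (weight x) = r.
  by rewrite /weight normcM normc_i mul1r normcM normc_real normc_unit_point mulr1 ger0_norm.
pose k := normc (((2 * pi)%:C * 'i)^-1 : C).
exists (k * (2 * (2 * pi - 0) * (m^-1 * r))); split.
- move=> f g fg; congr (_ * _); rewrite !circle_integralE.
  by apply: eq_cintegral => x; rewrite fg //; exists x.
- split; first exact: pt_cont.
  exists (normc c + r) => w [x ->]; apply: le_trans (le_normcD _ _) _.
  by rewrite lerD2l normcM normc_real normc_unit_point mulr1 ger0_norm.
- by move=> a; split; [exact: ccontinuous_cst|exists (normc a)].
- move=> f g [f1 [M fM]] [g1 [M' gM]]; split; first exact: ccontinuousD.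
  by exists (M + M') => w hw; apply: le_trans (le_normcD _ _) _; rewrite lerD ?fM ?gM.
- move=> f g [f1 [M fM]] [g1 [M' gM]]; split; first exact: ccontinuousM.
  by exists (M * M') => w hw; rewrite normcM ler_pM ?normc_ge0 ?fM ?gM.
- move=> f l l_gt0 f_ge [f1 [M fM]]; split.
    apply: ccontinuousV => // x; rewrite -normc_gt0.
    by apply: lt_le_trans l_gt0 _; apply: f_ge; exists x.
  exists l^-1 => w hw; rewrite normcV lef_pV2 ?posrE ?f_ge //.
  by apply: lt_le_trans l_gt0 _; exact: f_ge.
- move=> f lim; split.
    apply: ccontinuous_uniform_limit => e /lim[g [g1 _] fg].
    by exists (fun x => g (pt x)) => // x; apply: fg; exists x.
  have [g [_ [M gM]] fg] := lim 1 ltr01; exists (1 + M) => w hw.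
  rewrite -(subrK (g w) (f w)); apply: le_trans (le_normcD _ _) _.
  by rewrite lerD ?fg ?gM.
- by move=> f [_ [M fM]]; exists M.
- move=> a f g [f1 _] [g1 _]; rewrite /circle_mean mulrCA -mulrDr; congr (_ * _).
  rewrite !circle_integralE -cintegral_linear; [|exact: integrand_cont|exact: integrand_cont].
  by apply: eq_cintegral => x; rewrite mulrDr mulrDl (mulrCA _ a) -!mulrA.
- by rewrite !mulr_ge0 ?normc_ge0 ?subr0 ?pi2_ge0 ?invr_ge0 ?(ltW m_gt0).
- move=> f M [f1 _] fM; rewrite /circle_mean normcM -[leRHS]mulrA.
  rewrite ler_wpM2l ?normc_ge0 // circle_integralE -[leRHS]mulrA.
  have := cintegral_bound (pi2_ge0 R) (integrand_cont f f1) (M := m^-1 * r * M).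
  apply => x.
  rewrite normcM weight_norm normcM normcV mulrAC; apply: ler_pM.
  + by rewrite mulr_ge0 // invr_ge0 normc_ge0.
  + exact: normc_ge0.
  + rewrite ler_wpM2r // lef_pV2 ?posrE ?normc_gt0 //.
    by apply: away; exists x.
  + by apply: fM; exists x.
Qed.

Lemma contour_functionalB On1 On2 Ad1 Ad2 J1 J2 (K1 K2 : R) :
    contour_functional On1 Ad1 J1 K1 -> contour_functional On2 Ad2 J2 K2 ->
  contour_functional (fun w => On1 w \/ On2 w) (fun f => Ad1 f /\ Ad2 f)
    (fun f => J1 f - J2 f) (K1 + K2).
Proof.
move=> F1 F2; split.
- move=> f g fg; rewrite (cf_ext F1 (g := g)) ?(cf_ext F2 (g := g)) //.
    by move=> w hw; apply: fg; right.
  by move=> w hw; apply: fg; left.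
- by split; [exact: (cf_id F1)|exact: (cf_id F2)].
- by move=> c; split; [exact: (cf_cst F1)|exact: (cf_cst F2)].
- by move=> f g [f1 f2] [g1 g2]; split; [exact: (cf_add F1)|exact: (cf_add F2)].
- by move=> f g [f1 f2] [g1 g2]; split; [exact: (cf_mul F1)|exact: (cf_mul F2)].
- move=> f m m_gt0 f_ge [f1 f2]; split.
    by apply: (cf_inv F1 m_gt0) => // w hw; apply: f_ge; left.
  by apply: (cf_inv F2 m_gt0) => // w hw; apply: f_ge; right.
- move=> f lim; split.
    apply: (cf_lim F1) => e /lim[g [g1 _] fg]; exists g => // w hw.
    by apply: fg; left.
  apply: (cf_lim F2) => e /lim[g [_ g2] fg]; exists g => // w hw.
  by apply: fg; right.
- move=> f [f1 f2]; have [M1 h1] := cf_bdd F1 f1; have [M2 h2] := cf_bdd F2 f2.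
  exists (Num.max M1 M2) => w [/h1|/h2] le_M; rewrite le_max le_M ?orbT //.
- move=> a f g [f1 f2] [g1 g2].
  rewrite (cf_linear F1 _ f1 g1) (cf_linear F2 _ f2 g2).
  by rewrite mulrBr opprD addrACA.
- by rewrite addr_ge0 ?(cf_ge0 F1) ?(cf_ge0 F2).
- move=> f M [f1 f2] fM; apply: le_trans (le_normcD _ _) _; rewrite normcN mulrDl.
  apply: lerD; [apply: (cf_bound F1)|apply: (cf_bound F2)] => // w hw; apply: fM.
    by left.
  by right.
Qed.

Section Consequences.
Variables (On : C -> Prop) (Ad : (C -> C) -> Prop) (J : (C -> C) -> C) (K : R).
Hypothesis F : contour_functional On Ad J K.

Lemma cf_int0 : J (fun=> 0) = 0.
Proof.
apply/eqP; rewrite -[_ == _]negbK -normc_gt0 -leNgt -(mulr0 K).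
by apply: (cf_bound F); [exact: (cf_cst F)|move=> w _; rewrite normc0].
Qed.

Lemma cf_intD f g : Ad f -> Ad g -> J (fun w => f w + g w) = J f + J g.
Proof.
move=> hf hg; rewrite -[J f]mul1r -(cf_linear F _ hf hg).
by apply: (cf_ext F) => w _; rewrite mul1r.
Qed.

Lemma cf_intZ a f : Ad f -> J (fun w => a * f w) = a * J f.
Proof.
move=> hf; rewrite -[RHS]addr0 -cf_int0 -(cf_linear F _ hf (cf_cst F _)).
by apply: (cf_ext F) => w _; rewrite addr0.
Qed.

Lemma cf_sum (I : Type) (r : seq I) (f : I -> C -> C) :
  (forall i, Ad (f i)) -> Ad (fun w => \sum_(i <- r) f i w).
Proof.
move=> hf; elim: r => [|i r IH].
  by under eq_fun do rewrite big_nil; exact: (cf_cst F).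
by under eq_fun do rewrite big_cons; apply: (cf_add F).
Qed.

Lemma cf_int_sum (I : Type) (r : seq I) (a : I -> C) (f : I -> C -> C) :
    (forall i, Ad (f i)) ->
  J (fun w => \sum_(i <- r) a i * f i w) = \sum_(i <- r) a i * J (f i).
Proof.
move=> hf; elim: r => [|i r IH].
  by rewrite big_nil -[RHS]cf_int0; apply: (cf_ext F) => w _; rewrite big_nil.
rewrite big_cons -IH -(cf_linear F) //; last first.
  apply: (cf_sum _ (f := fun j w => a j * f j w)) => j.
  by apply: (cf_mul F); [exact: (cf_cst F)|exact: hf].
by apply: (cf_ext F) => w _; rewrite big_cons.
Qed.

Lemma cf_expz f (m : R) (n : int) : 0 < m -> (forall w, On w -> m <= normc (f w)) ->
  Ad f -> Ad (fun w => f w ^ n).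
Proof.
move=> m_gt0 f_ge hf.
have hX k : Ad (fun w => f w ^+ k).
  elim: k => [|k IH]; first exact: (cf_cst F).
  by under eq_fun do rewrite exprS; apply: (cf_mul F).
case: n => n; first exact: hX.
apply: (cf_inv F (m := m ^+ n.+1)) => //; first exact: exprn_gt0.
move=> w hw; rewrite normcX lerXn2r ?nnegrE ?normc_ge0 ?(ltW m_gt0) //.
exact: f_ge.
Qed.
End Consequences.
End Circle.

(** * Iterated contour integrals *)

Section IteratedFunctional.
Variable R : realType.
Local Notation C := R[i].
Variables (On : C -> Prop) (Ad : (C -> C) -> Prop) (J : (C -> C) -> C) (K : R).
Hypothesis F : contour_functional On Ad J K.

Definition on_power (N : nat) (ws : N.-tuple C) := forall i, On (tnth ws i).

Definition tensor_sum (N : nat) (I : finType) (c : I -> C) (g : I -> nat -> C -> C)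
  (ws : N.-tuple C) : C := \sum_t c t * \prod_(i < N) g t i (tnth ws i).

(** Uniform limits of finite sums of products of one-variable functions. On such sums the iterated
    integral factorises, and it is continuous for uniform convergence. *)
Definition approximable (N : nat) (f : N.-tuple C -> C) : Prop :=
  forall e, 0 < e -> exists (I : finType) (c : I -> C) (g : I -> nat -> C -> C),
    (forall t i, Ad (g t i)) /\
    forall ws, on_power ws -> normc (f ws - tensor_sum c g ws) <= e.

Lemma tensor_sum_cons (N : nat) (I : finType) (c : I -> C) g (w : C) (ws : N.-tuple C) :
  tensor_sum c g [tuple of w :: ws]
  = tensor_sum (fun t => c t * g t 0%N w) (fun t i => g t i.+1) ws.
Proof.
apply: eq_bigr => t _; rewrite big_ord_recl mulrA tnth0; congr (_ * _).
by apply: eq_bigr => i _; rewrite tnthS.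
Qed.

Lemma on_power_cons (N : nat) (w : C) (ws : N.-tuple C) :
  On w -> on_power ws -> on_power [tuple of w :: ws].
Proof. by move=> hw hws i; case: (unliftP ord0 i) => [j ->|->]; rewrite ?tnthS ?tnth0. Qed.

Lemma approximable_cons (N : nat) (f : N.+1.-tuple C -> C) w : On w ->
  approximable f -> approximable (fun ws : N.-tuple C => f [tuple of w :: ws]).
Proof.
move=> hw hf e /hf[I [c [g [hg fg]]]].
exists I, (fun t => c t * g t 0%N w), (fun t i => g t i.+1); split=> // ws hws.
by rewrite -tensor_sum_cons; apply: fg; apply: on_power_cons.
Qed.

(** Induction on the number of variables, peeling off the outermost one. The inner integral is
    compared with the explicit sum at each point of the contour, and the bound of the functional
    turns this into the comparison of the full integrals. *)
Lemma iter_oint_approx (N : nat) (f : N.-tuple C -> C) (I : finType) (c : I -> C)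
    (g : I -> nat -> C -> C) (e : R) :
    approximable f -> (forall t i, Ad (g t i)) ->
    (forall ws, on_power ws -> normc (f ws - tensor_sum c g ws) <= e) ->
  normc (iter_oint J f - \sum_t c t * \prod_(i < N) J (g t i)) <= K ^+ N * e.
Proof.
elim: N f I c g e => [|N IH] f I c g e f_app g_ad fg.
  rewrite expr0 mul1r /=; have := fg [tuple] (fun i => match notF (valP i) with end).
  by rewrite /tensor_sum; congr (normc (_ - _) <= _); apply: eq_bigr => t _; rewrite !big_ord0.
pose h (I' : finType) (c' : I' -> C) (g' : I' -> nat -> C -> C) w := \sum_t c' t *
   (g' t 0%N w * \prod_(i < N) J (g' t i.+1)).
pose H w := iter_oint J (fun ws : N.-tuple C => f [tuple of w :: ws]).
have approx (I' : finType) (c' : I' -> C) g' e' : (forall t i, Ad (g' t i)) ->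
    (forall ws, on_power ws -> normc (f ws - tensor_sum c' g' ws) <= e') ->
    forall w, On w -> normc (H w - h I' c' g' w) <= K ^+ N * e'.
  move=> g'_ad fg' w hw; rewrite /h; under eq_bigr do rewrite mulrA.
  apply: (IH _ I' (fun t => c' t * g' t 0%N w) (fun t i => g' t i.+1)) => //.
    exact: approximable_cons.
  by move=> ws hws; rewrite -tensor_sum_cons; apply: fg'; apply: on_power_cons.
have h_ad (I' : finType) (c' : I' -> C) g' : (forall t i, Ad (g' t i)) -> Ad (h I' c' g').
  move=> g'_ad; rewrite /h.
  apply: (cf_sum F _ (f := fun t w => c' t * (g' t 0%N w * \prod_(i < N) J (g' t i.+1)))) => t.
  by do 2?[apply: (cf_mul F); rewrite //]; exact: (cf_cst F).
have K_ge0 := cf_ge0 F; have KN_ge0 : 0 <= K ^+ N by rewrite exprn_ge0.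
(* The inner integral is a uniform limit of finite sums of admissible functions, hence admissible in
   the outer variable. *)
have H_ad : Ad H.
  apply: (cf_lim F) => d d_gt0.
  have [|I' [c' [g' [g'_ad fg']]]] := f_app (d / (K ^+ N + 1)).
    by rewrite divr_gt0 // ltr_wpDl.
  exists (h I' c' g'); first exact: h_ad.
  move=> w hw; apply: le_trans (approx _ _ _ _ g'_ad fg' w hw) _.
  rewrite mulrCA ger_pMr // ler_pdivrMr ?ltr_wpDl // mul1r lerDl.
  exact: ler01.
have -> : iter_oint J f - \sum_t c t * \prod_(i < N.+1) J (g t i)
    = J (fun w => - 1 * h I c g w + H w).
  rewrite (cf_linear F) //; last exact: h_ad.
  rewrite mulN1r [RHS]addrC; congr (_ - _); rewrite /h.
  rewrite (cf_ext F (g := fun w =>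
    \sum_t (c t * \prod_(i < N) J (g t i.+1)) * g t 0%N w)); last first.
    by move=> w _; apply: eq_bigr => t _; rewrite mulrA mulrAC.
  rewrite (cf_int_sum F) //; apply: eq_bigr => t _.
  by rewrite big_ord_recl -mulrA; congr (_ * _); rewrite mulrC.
rewrite exprS -mulrA; apply: (cf_bound F).
  apply: (cf_add F) => //; apply: (cf_mul F); first exact: (cf_cst F).
  exact: h_ad.
by move=> w hw; rewrite mulN1r addrC; apply: approx.
Qed.

Variables (Onz : C -> Prop) (Adz : (C -> C) -> Prop) (Jz : (C -> C) -> C) (Kz : R).
Hypothesis Fz : contour_functional Onz Adz Jz Kz.
Variable N : nat.
Implicit Types f : C -> N.-tuple C -> C.

Definition z_tensor_sum (I : finType) (c : I -> C -> C) (g : I -> nat -> C -> C)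
  (z : C) (ws : N.-tuple C) : C := \sum_t c t z * \prod_(i < N) g t i (tnth ws i).

Definition z_approximable f : Prop :=
  forall e, 0 < e -> exists (I : finType) (c : I -> C -> C) (g : I -> nat -> C -> C),
    [/\ forall t, Adz (c t), forall t i, Ad (g t i) &
    forall z ws, Onz z -> on_power ws -> normc (f z ws - z_tensor_sum c g z ws) <= e].

Definition total_integral f : C := Jz (fun z => iter_oint J (f z)).

Lemma total_integral_approx f (I : finType) (c : I -> C -> C) (g : I -> nat -> C -> C)
    (e : R) : z_approximable f -> (forall t, Adz (c t)) -> (forall t i, Ad (g t i)) ->
    (forall z ws, Onz z -> on_power ws -> normc (f z ws - z_tensor_sum c g z ws) <= e) ->
  normc (total_integral f - \sum_t Jz (c t) * \prod_(i < N) J (g t i)) <= Kz * (K ^+ N * e).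
Proof.
move=> f_app c_ad g_ad fg.
pose h (I' : finType) (c' : I' -> C -> C) (g' : I' -> nat -> C -> C) z :=
  \sum_t (\prod_(i < N) J (g' t i)) * c' t z.
pose H z := iter_oint J (f z).
have approx (I' : finType) (c' : I' -> C -> C) g' e' : (forall t i, Ad (g' t i)) ->
    (forall z ws, Onz z -> on_power ws -> normc (f z ws - z_tensor_sum c' g' z ws) <= e') ->
    forall z, Onz z -> normc (H z - h I' c' g' z) <= K ^+ N * e'.
  move=> g'_ad fg' z hz; rewrite /h; under eq_bigr do rewrite mulrC.
  apply: (@iter_oint_approx N (f z) I' (fun t => c' t z) g') => //.
    move=> d /f_app[I2 [c2 [g2 [_ g2_ad fg2]]]].
    by exists I2, (fun t => c2 t z), g2; split=> // ws hws; apply: fg2.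
  by move=> ws hws; apply: fg'.
have h_ad (I' : finType) (c' : I' -> C -> C) g' : (forall t, Adz (c' t)) -> Adz (h I' c' g').
  move=> c'_ad; rewrite /h.
  apply: (cf_sum Fz _ (f := fun t z => (\prod_(i < N) J (g' t i)) * c' t z)) => t.
  by apply: (cf_mul Fz) => //; exact: (cf_cst Fz).
have KN_ge0 : 0 <= K ^+ N by rewrite exprn_ge0 // (cf_ge0 F).
have H_ad : Adz H.
  apply: (cf_lim Fz) => d d_gt0.
  have [|I' [c' [g' [c'_ad g'_ad fg']]]] := f_app (d / (K ^+ N + 1)).
    by rewrite divr_gt0 // ltr_wpDl.
  exists (h I' c' g'); first exact: h_ad.
  move=> z hz; apply: le_trans (approx _ _ _ _ g'_ad fg' z hz) _.
  rewrite mulrCA ger_pMr // ler_pdivrMr ?ltr_wpDl // mul1r lerDl.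
  exact: ler01.
have -> : total_integral f - \sum_t Jz (c t) * \prod_(i < N) J (g t i)
    = Jz (fun z => - 1 * h I c g z + H z).
  rewrite (cf_linear Fz) //; last exact: h_ad.
  rewrite mulN1r [RHS]addrC; congr (_ - _).
  by rewrite (cf_int_sum Fz) //; apply: eq_bigr => t _; rewrite mulrC.
apply: (cf_bound Fz).
  apply: (cf_add Fz) => //; apply: (cf_mul Fz); first exact: (cf_cst Fz).
  exact: h_ad.
by move=> z hz; rewrite mulN1r addrC; apply: approx.
Qed.

Lemma total_integral_tensor (I : finType) (c : I -> C -> C) (g : I -> nat -> C -> C) f :
    (forall t, Adz (c t)) -> (forall t i, Ad (g t i)) ->
    (forall z ws, Onz z -> on_power ws -> f z ws = z_tensor_sum c g z ws) ->
  total_integral f = \sum_t Jz (c t) * \prod_(i < N) J (g t i).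
Proof.
move=> c_ad g_ad fE; apply/eqP; rewrite -subr_eq0 -[_ == _]negbK -normc_gt0 -leNgt.
rewrite -(mulr0 Kz) -(mulr0 (K ^+ N)); apply: total_integral_approx => //.
  move=> e e_gt0; exists I, c, g; split=> // z ws hz hws.
  by rewrite fE // subrr normc0 ltW.
by move=> z ws hz hws; rewrite fE // subrr normc0.
Qed.

Lemma total_integral_bound f (M : R) : z_approximable f ->
    (forall z ws, Onz z -> on_power ws -> normc (f z ws) <= M) ->
  normc (total_integral f) <= Kz * (K ^+ N * M).
Proof.
move=> f_app fM.
have sum_void (G : void -> C) : \sum_t G t = 0 by rewrite big1 // => -[].
(* Comparison with the empty tensor sum, which is 0. *)
have := @total_integral_approx f void (fun=> id) (fun _ _ => id) M f_app.
rewrite sum_void subr0; apply => [[]|[]|z ws hz hws].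
by rewrite /z_tensor_sum sum_void subr0 fM.
Qed.

Lemma z_approximableD f f' : z_approximable f -> z_approximable f' ->
  z_approximable (fun z ws => f z ws + f' z ws).
Proof.
move=> hf hf' e e_gt0; have e2_gt0 : 0 < e / 2 by rewrite divr_gt0.
have [I [c [g [c_ad g_ad fg]]]] := hf _ e2_gt0.
have [I' [c' [g' [c'_ad g'_ad fg']]]] := hf' _ e2_gt0.
exists (I + I')%type, (fun t => match t with inl i => c i | inr i => c' i end),
  (fun t => match t with inl i => g i | inr i => g' i end).
split=> [[]|[]|z ws hz hws] //.
rewrite /z_tensor_sum big_sumType /= opprD addrACA.
apply: le_trans (le_normcD _ _) _; rewrite [e]splitr.
by apply: lerD; [exact: fg|exact: fg'].
Qed.

Lemma z_approximable_bdd f : z_approximable f -> exists2 M, 0 <= M &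
  forall z ws, Onz z -> on_power ws -> normc (f z ws) <= M.
Proof.
move=> /(_ _ ltr01)[I [c [g [c_ad g_ad fg]]]].
have [Mc hMc] : exists Mc : I -> R, forall t z, Onz z -> normc (c t z) <= Mc t.
  have [Mc h] := choice (fun t => cf_bdd Fz (c_ad t)); by exists Mc.
have [Mg hMg] : exists Mg : I -> nat -> R, forall t i w, On w -> normc (g t i w) <= Mg t i.
  have Mg t := choice (fun i => cf_bdd F (g_ad t i)).
  by exists (fun t => projT1 (Mg t)) => t; exact: projT2 (Mg t).
exists (1 + \sum_t `|Mc t| * \prod_(i < N) `|Mg t i|).
  by rewrite addr_ge0 // sumr_ge0 // => t _; rewrite mulr_ge0 ?prodr_ge0.
move=> z ws hz hws; rewrite -(subrK (z_tensor_sum c g z ws) (f z ws)).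
apply: le_trans (le_normcD _ _) _; apply: lerD; first exact: fg.
apply: le_trans (normc_sum _ _) _; apply: ler_sum => t _.
rewrite normcM normc_prod; apply: ler_pM.
- exact: normc_ge0.
- by rewrite prodr_ge0 // => i _; rewrite normc_ge0.
- by apply: le_trans (hMc t z hz) (ler_norm _).
- apply: ler_prod => i _; rewrite normc_ge0 /=.
  by apply: le_trans (hMg t i _ (hws i)) (ler_norm _).
Qed.

Lemma z_approximable_lim f : (forall e, 0 < e -> exists2 f', z_approximable f' &
    forall z ws, Onz z -> on_power ws -> normc (f z ws - f' z ws) <= e) ->
  z_approximable f.
Proof.
move=> lim e e_gt0; have e2_gt0 : 0 < e / 2 by rewrite divr_gt0.
have [f' f'_app ff'] := lim _ e2_gt0.
have [I [c [g [c_ad g_ad fg]]]] := f'_app _ e2_gt0.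
exists I, c, g; split=> // z ws hz hws.
rewrite -(subrK (f' z ws) (f z ws)) -addrA.
apply: le_trans (le_normcD _ _) _; rewrite [e]splitr.
by apply: lerD; [exact: ff'|exact: fg].
Qed.

Lemma z_tensor_approximable (I : finType) (c : I -> C -> C) (g : I -> nat -> C -> C) :
  (forall t, Adz (c t)) -> (forall t i, Ad (g t i)) -> z_approximable (z_tensor_sum c g).
Proof.
move=> c_ad g_ad e e_gt0; exists I, c, g; split=> // z ws _ _.
by rewrite subrr normc0 ltW.
Qed.

Lemma z_tensor_sumM (I I' : finType) (c : I -> C -> C) (g : I -> nat -> C -> C)
    (c' : I' -> C -> C) (g' : I' -> nat -> C -> C) z (ws : N.-tuple C) :
  z_tensor_sum c g z ws * z_tensor_sum c' g' z ws
  = z_tensor_sum (fun t : I * I' => fun z => c t.1 z * c' t.2 z)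
      (fun t i w => g t.1 i w * g' t.2 i w) z ws.
Proof.
rewrite /z_tensor_sum big_distrlr /= pair_bigA /=; apply: eq_bigr => -[t t'] _ /=.
by rewrite mulrACA -big_split.
Qed.

Lemma z_approximableM f f' : z_approximable f -> z_approximable f' ->
  z_approximable (fun z ws => f z ws * f' z ws).
Proof.
move=> hf hf'; have [M M_ge0 fM] := z_approximable_bdd hf.
have [M' M'_ge0 f'M] := z_approximable_bdd hf'.
apply: z_approximable_lim => e e_gt0.
pose d := Num.min 1 (e / (M + M' + 1)).
have S_gt0 : 0 < M + M' + 1 by rewrite ltr_wpDl ?addr_ge0.
have d_gt0 : 0 < d by rewrite lt_min ltr01 divr_gt0.
have d_le1 : d <= 1 by rewrite ge_min lexx.
have d_le : d * (M + M' + 1) <= e by rewrite -ler_pdivlMr // ge_min lexx orbT.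
have [I [c [g [c_ad g_ad fg]]]] := hf _ d_gt0.
have [I' [c' [g' [c'_ad g'_ad fg']]]] := hf' _ d_gt0.
exists (z_tensor_sum (fun t : I * I' => fun z => c t.1 z * c' t.2 z)
      (fun t i w => g t.1 i w * g' t.2 i w)).
  by apply: z_tensor_approximable => [t|t i]; [apply: (cf_mul Fz)|apply: (cf_mul F)].
move=> z ws hz hws; rewrite -z_tensor_sumM.
set u := f z ws; set u' := f' z ws; set v := z_tensor_sum c g z ws.
set v' := z_tensor_sum c' g' z ws.
have -> : u * u' - v * v' = u * (u' - v') + (u - v) * u' - (u - v) * (u' - v') by ring.
have hu : normc u <= M by exact: fM.
have hu' : normc u' <= M' by exact: f'M.
have huv : normc (u - v) <= d by exact: fg.
have huv' : normc (u' - v') <= d by exact: fg'.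
apply: le_trans (le_normcD _ _) _; rewrite normcN.
apply: le_trans (lerD (le_normcD _ _) (lexx _)) _; rewrite !normcM.
apply: le_trans d_le; have -> : d * (M + M' + 1) = M * d + d * M' + d * 1 by ring.
apply: lerD; [apply: lerD|]; apply: ler_pM; rewrite ?normc_ge0 //.
exact: le_trans d_le1.
Qed.

Lemma z_approximable_z (c : C -> C) : Adz c -> z_approximable (fun z _ => c z).
Proof.
move=> hc e e_gt0; exists unit, (fun=> c), (fun _ _ _ => 1); split=> // [_ _|z ws _ _].
  exact: (cf_cst F).
by rewrite /z_tensor_sum big_const card_unit /= addr0 big1 // mulr1 subrr normc0 ltW.
Qed.

Lemma z_approximable_cst (c : C) : z_approximable (fun _ _ => c).
Proof. exact: z_approximable_z (cf_cst Fz c). Qed.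

Lemma z_approximable_w (i : 'I_N) (g : C -> C) : Ad g ->
  z_approximable (fun _ ws => g (tnth ws i)).
Proof.
move=> hg e e_gt0; exists unit, (fun=> fun=> 1), (fun _ (j : nat) w => if j == i :> nat then g w else 1).
split=> // [_|_ j|z ws _ _]; first exact: (cf_cst Fz).
  by case: (j == _) => //; exact: (cf_cst F).
rewrite /z_tensor_sum big_const card_unit /= addr0 mul1r (bigD1 i) //= eqxx.
rewrite big1 ?mulr1 ?subrr ?normc0 ?ltW // => j; rewrite -val_eqE => /negPf.
by move=> /= ->.
Qed.

Lemma z_approximable_sum (I : Type) (r : seq I) (f : I -> C -> N.-tuple C -> C) :
  (forall i, z_approximable (f i)) ->
  z_approximable (fun z ws => \sum_(i <- r) f i z ws).
Proof.
move=> hf; elim: r => [|i r IH].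
  under eq_fun do under eq_fun do rewrite big_nil; exact: z_approximable_cst.
by under eq_fun do under eq_fun do rewrite big_cons; apply: z_approximableD.
Qed.

Lemma z_approximable_prod (I : Type) (r : seq I) (f : I -> C -> N.-tuple C -> C) :
  (forall i, z_approximable (f i)) ->
  z_approximable (fun z ws => \prod_(i <- r) f i z ws).
Proof.
move=> hf; elim: r => [|i r IH].
  under eq_fun do under eq_fun do rewrite big_nil; exact: z_approximable_cst.
by under eq_fun do under eq_fun do rewrite big_cons; apply: z_approximableM.
Qed.

Lemma total_integral_ext f f' :
    (forall z ws, Onz z -> on_power ws -> f z ws = f' z ws) -> z_approximable f ->
  total_integral f = total_integral f'.
Proof.
move=> ff' hf; apply/eqP; rewrite -subr_eq0 -[_ == _]negbK -normc_gt0 -leNgt.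
apply/ler_addgt0Pr => e e_gt0; rewrite add0r.
pose k := Kz * K ^+ N; have k_ge0 : 0 <= k by rewrite mulr_ge0 ?exprn_ge0 ?(cf_ge0 F) ?(cf_ge0 Fz).
have S_gt0 : 0 < 2 * k + 1 by rewrite ltr_wpDl // mulr_ge0.
have d_gt0 : 0 < e / (2 * k + 1) by rewrite divr_gt0.
have [I [c [g [c_ad g_ad fg]]]] := hf _ d_gt0.
have hf' : z_approximable f'.
  move=> e' /hf[I2 [c2 [g2 [? ? fg2]]]]; exists I2, c2, g2; split=> // z ws hz hws.
  by rewrite -ff' // fg2.
have h1 := total_integral_approx hf c_ad g_ad fg.
have h2 : normc (total_integral f' - \sum_t Jz (c t) * \prod_(i < N) J (g t i))
    <= Kz * (K ^+ N * (e / (2 * k + 1))).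
  by apply: total_integral_approx => // z ws hz hws; rewrite -ff' // fg.
set v := \sum_t _ in h1 h2.
have -> : total_integral f - total_integral f'
    = (total_integral f - v) - (total_integral f' - v) by ring.
apply: le_trans (le_normcD _ _) _; rewrite normcN.
apply: le_trans (lerD h1 h2) _; rewrite -subr_ge0.
have -> : e - (Kz * (K ^+ N * (e / (2 * k + 1))) + Kz * (K ^+ N * (e / (2 * k + 1))))
    = e / (2 * k + 1).
  by rewrite /k; field; rewrite gt_eqF.
exact: ltW.
Qed.

Lemma total_integral_linear a f f' : z_approximable f -> z_approximable f' ->
  total_integral (fun z ws => a * f z ws + f' z ws)
  = a * total_integral f + total_integral f'.
Proof.
move=> hf hf'; apply/eqP; rewrite -subr_eq0 -[_ == _]negbK -normc_gt0 -leNgt.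
apply/ler_addgt0Pr => e e_gt0; rewrite add0r.
pose k := Kz * K ^+ N; have k_ge0 : 0 <= k by rewrite mulr_ge0 ?exprn_ge0 ?(cf_ge0 F) ?(cf_ge0 Fz).
pose S := 2 * (normc a + 1) * k + 1.
have S_gt0 : 0 < S.
  by rewrite ltr_wpDl // mulr_ge0 // mulr_ge0 // addr_ge0 // normc_ge0.
have d_gt0 : 0 < e / S by rewrite divr_gt0.
have [I [c [g [c_ad g_ad fg]]]] := hf _ d_gt0.
have [I' [c' [g' [c'_ad g'_ad fg']]]] := hf' _ d_gt0.
pose V := \sum_t Jz (c t) * \prod_(i < N) J (g t i).
pose V' := \sum_t Jz (c' t) * \prod_(i < N) J (g' t i).
have h1 : normc (total_integral f - V) <= _ := total_integral_approx hf c_ad g_ad fg.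
have h2 : normc (total_integral f' - V') <= _ := total_integral_approx hf' c'_ad g'_ad fg'.
pose c2 (t : I + I') z := match t with inl i => a * c i z | inr i => c' i z end.
pose g2 (t : I + I') := match t with inl i => g i | inr i => g' i end.
have h3 : normc (total_integral (fun z ws => a * f z ws + f' z ws) - (a * V + V'))
    <= Kz * (K ^+ N * ((normc a + 1) * (e / S))).
  have -> : a * V + V' = \sum_t Jz (c2 t) * \prod_(i < N) J (g2 t i).
    rewrite big_sumType /=; congr (_ + _); rewrite /V mulr_sumr; apply: eq_bigr => t _.
    by rewrite mulrA (cf_intZ Fz).
  apply: total_integral_approx => [|[] t|[] t|z ws hz hws] //=.
  - by apply: z_approximableD => //; apply: z_approximableM => //; exact: z_approximable_cst.
  - by apply: (cf_mul Fz) => //; exact: (cf_cst Fz).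
  - exact: c'_ad.
  rewrite /z_tensor_sum big_sumType /=.
  under eq_bigr do rewrite -mulrA; rewrite -mulr_sumr opprD addrACA -mulrBr.
  apply: le_trans (le_normcD _ _) _; rewrite normcM mulrDl mul1r; apply: lerD.
    by rewrite ler_wpM2l ?normc_ge0 // fg.
  exact: fg'.
set T3 := total_integral (fun z ws => _) in h3 *.
have -> : T3 - (a * total_integral f + total_integral f')
    = (T3 - (a * V + V')) - (a * (total_integral f - V) + (total_integral f' - V')) by ring.
apply: le_trans (le_normcD _ _) _; rewrite normcN.
apply: le_trans (lerD h3 (le_trans (le_normcD _ _) (lerD _ h2))) _.
  by rewrite normcM; apply: ler_wpM2l h1; exact: normc_ge0.
rewrite -subr_ge0.
have -> : e - (Kz * (K ^+ N * ((normc a + 1) * (e / S))) +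
  (normc a * (Kz * (K ^+ N * (e / S))) + Kz * (K ^+ N * (e / S)))) = e / S.
  by rewrite /S /k; field; rewrite gt_eqF.
exact: ltW.
Qed.

Lemma z_approximable_ext f f' : (forall z ws, Onz z -> on_power ws -> f z ws = f' z ws) ->
  z_approximable f' -> z_approximable f.
Proof.
move=> ff' hf' e /hf'[I [c [g [c_ad g_ad fg]]]]; exists I, c, g; split=> // z ws hz hws.
by rewrite ff' // fg.
Qed.

Lemma z_approximableZ a f : z_approximable f -> z_approximable (fun z ws => a * f z ws).
Proof.
by move=> hf; apply: (z_approximableM (f := fun _ _ => a)) => //; exact: z_approximable_cst.
Qed.

Lemma total_integral0 : total_integral (fun _ (_ : N.-tuple C) => 0) = 0.
Proof.
have e := total_integral_linear (-1) (z_approximable_cst 0) (z_approximable_cst 0).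
rewrite [X in _ = X + _]mulN1r [RHS]addNr in e.
by rewrite -[RHS]e; congr total_integral; apply/funext => z; apply/funext => ws;
  rewrite mulr0 addr0.
Qed.

Lemma total_integralZ a f : z_approximable f ->
  total_integral (fun z ws => a * f z ws) = a * total_integral f.
Proof.
move=> hf; have := total_integral_linear a hf (z_approximable_cst 0).
rewrite total_integral0 addr0 => <-.
by congr total_integral; apply/funext => z; apply/funext => ws; rewrite addr0.
Qed.

Lemma total_integral_sum (I : Type) (r : seq I) (f : I -> C -> N.-tuple C -> C) :
  (forall i, z_approximable (f i)) ->
  total_integral (fun z ws => \sum_(i <- r) f i z ws) = \sum_(i <- r) total_integral (f i).
Proof.
move=> hf; elim: r => [|i r IH].
  by rewrite big_nil -[RHS]total_integral0; congr total_integral; apply/funext => z;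
    apply/funext => ws; rewrite big_nil.
rewrite big_cons -IH -[total_integral (f i)]mul1r.
rewrite -(total_integral_linear 1 (hf i) (z_approximable_sum _ hf)).
by congr total_integral; apply/funext => z; apply/funext => ws; rewrite big_cons mul1r.
Qed.
End IteratedFunctional.

(** * One-variable integrals of w^B (1 - 1/w)^A *)

Lemma geometric_decay_eq0 (R : realType) (x : R[i]) (M th : R) :
  0 <= th -> th < 1 -> (forall k, normc x <= M * th ^+ k) -> x = 0.
Proof.
move=> th_ge0 th_lt1 h; apply/eqP; rewrite -[_ == _]negbK -normc_gt0 -leNgt.
have M_ge0 : 0 <= M by have := h 0%N; rewrite expr0 mulr1; apply: le_trans (normc_ge0 _).
apply/ler_addgt0Pr => e e_gt0; rewrite add0r.
have d_gt0 : 0 < e / (M + 1) by rewrite divr_gt0 // ltr_wpDl.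
have lim : th ^+ k @[k --> \oo] --> (0 : R) by apply: cvg_expr; rewrite ger0_norm.
have /cvgr_le /(_ _ d_gt0) [k _ /(_ k (leqnn _)) /= thk] := lim.
apply: le_trans (h k) _; apply: le_trans (ler_wpM2l M_ge0 thk) _.
by rewrite mulrCA ger_pMr // ler_pdivrMr ?mul1r ?lerDl // ltr_wpDl.
Qed.

Lemma addz1BS (a : int) (d : nat) : a + 1 - d.+1%:Z = a - d%:Z.
Proof. lia. Qed.

Lemma subr3ACA (V : zmodType) (a b c a' b' c' : V) :
  a - a' - (b - b') - (c - c') = a - b - c - (a' - b' - c').
Proof. by rewrite !opprD !opprK (addrACA a) [LHS]addrACA. Qed.

Lemma normc_1B (R : realType) (w : R[i]) : `|1 - normc w| <= normc (w - 1).
Proof.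
rewrite ler_norml; apply/andP; split.
  have := le_normcD (w - 1) 1; rewrite subrK normc1; lra.
by have := le_normcD (1 - w) w; rewrite subrK normc1 normcB; lra.
Qed.

Section MonomialMeans.
Variable R : realType.
Local Notation C := R[i].

Definition monomial (A B : int) (w : C) : C := w ^ B * (1 - w^-1) ^ A.

Lemma monomial_pascal (A B : int) (w : C) : w != 0 -> w != 1 ->
  monomial (A + 1) B w = - 1 * monomial A (B - 1) w + monomial A B w.
Proof.
move=> w0 w1; have w1' : 1 - w^-1 != 0.
  by rewrite subr_eq0 eq_sym invr_eq1.
rewrite /monomial !expfzDr // exprN1 expr1z.
by set u := w ^ B; set v := (1 - w^-1) ^ A; ring.
Qed.

Variables (c : C) (r m1 m2 : R).
Hypotheses (r_ge0 : 0 <= r) (m1_gt0 : 0 < m1) (m2_gt0 : 0 < m2).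
Hypothesis away0 : forall w, on_circle c r w -> m1 <= normc w.
Hypothesis away1 : forall w, on_circle c r w -> m2 <= normc (1 - w^-1).

Local Notation mean A B := (circle_mean c r (monomial A B)).

Lemma on_circle_neq0 w : on_circle c r w -> w != 0.
Proof. by move=> /away0; rewrite -normc_gt0; apply: lt_le_trans. Qed.

Lemma on_circle_neq1 w : on_circle c r w -> w != 1.
Proof.
move=> /away1 h; apply: contraTneq h => ->.
by rewrite invr1 subrr normc0 -ltNge.
Qed.

Lemma monomial_circle_admissible A B : circle_admissible c r (monomial A B).
Proof.
have [K F] := circle_functional r_ge0 m1_gt0 away0.
apply: (cf_mul F); first by apply: (cf_expz F _ m1_gt0) => //; exact: (cf_id F).
apply: (cf_expz F _ m2_gt0) => //; apply: (cf_add F); first exact: (cf_cst F).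
have -> : (fun w : C => - w^-1) = (fun w => -1 * w^-1) by apply/funext => w; rewrite mulN1r.
apply: (cf_mul F); first exact: (cf_cst F).
by apply: (cf_inv F m1_gt0) => //; exact: (cf_id F).
Qed.

Lemma mean_pascal A B : mean (A + 1) B = mean A B - mean A (B - 1).
Proof.
have [K F] := circle_functional r_ge0 m1_gt0 away0.
transitivity (- 1 * mean A (B - 1) + mean A B); last by rewrite mulN1r addrC.
rewrite -(cf_linear F); try exact: monomial_circle_admissible.
apply: (cf_ext F) => w hw; apply: monomial_pascal.
  exact: on_circle_neq0.
exact: on_circle_neq1.
Qed.

Lemma mean_bound : exists2 K, 0 <= K & forall A B (M : R),
  (forall w, on_circle c r w -> normc (monomial A B w) <= M) ->
  normc (mean A B) <= K * M.
Proof.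
have [K F] := circle_functional r_ge0 m1_gt0 away0; exists K; first exact: (cf_ge0 F).
by move=> A B M h; apply: (cf_bound F) => //; exact: monomial_circle_admissible.
Qed.
End MonomialMeans.

Section MonomialValues.
Variables (R : realType) (r e1 e2 : R).
Local Notation C := R[i].
Hypotheses (r_ge2 : 2 <= r) (e1_gt0 : 0 < e1) (e1_le : e1 <= 4^-1).
Hypotheses (e2_gt0 : 0 < e2) (e2_le : e2 <= 4^-1).

Ltac big_lra := move: r_ge2 => ?; nra.
Ltac zero_lra := move: e1_gt0 e1_le => ? ?; nra.
Ltac one_lra := move: e2_gt0 e2_le => ? ?; nra.

Definition big_mean A B : C := circle_mean 0 r (monomial A B).
Definition zero_mean A B : C := circle_mean 0 e1 (monomial A B).
Definition one_mean A B : C := circle_mean 1 e2 (monomial A B).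

Lemma on_circle_norm (c : C) (s : R) w : 0 <= s -> on_circle c s w -> normc (w - c) = s.
Proof. by move=> s_ge0 [x ->]; exact: normc_circle_point. Qed.

Lemma on_big_norm w : on_circle 0 r w -> normc w = r.
Proof.
move=> hw; rewrite -(on_circle_norm _ hw) ?subr0 //.
by apply: le_trans r_ge2.
Qed.

Lemma on_zero_norm w : on_circle 0 e1 w -> normc w = e1.
Proof. by move=> hw; rewrite -(on_circle_norm (ltW e1_gt0) hw) subr0. Qed.

Lemma on_one_norm w : on_circle 1 e2 w -> normc (w - 1) = e2.
Proof. exact: on_circle_norm (ltW e2_gt0). Qed.

Lemma on_one_bounds w : on_circle 1 e2 w -> 3 / 4 <= normc w <= 5 / 4.
Proof.
move=> /on_one_norm e; have := normc_1B w; rewrite e ler_norml => /andP[h1 h2].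
by apply/andP; split; one_lra.
Qed.

Lemma one_sub_inv (w : C) : w != 0 -> normc (1 - w^-1) = normc (w - 1) / normc w.
Proof.
move=> w0; rewrite -normcV -normcM; congr normc.
by rewrite mulrBl mulfV // mul1r.
Qed.

Lemma big_away0 w : on_circle 0 r w -> 1 <= normc w.
Proof. by move=> /on_big_norm ->; big_lra. Qed.

Lemma big_sub_inv w : on_circle 0 r w -> 2^-1 <= normc (1 - w^-1) <= 2.
Proof.
move=> /on_big_norm e; have w0 : w != 0 by rewrite -normc_gt0 e; big_lra.
have inv_le : normc w^-1 <= 2^-1 by rewrite normcV e lef_pV2 ?posrE //; big_lra.
apply/andP; split.
  have := le_normcD (1 - w^-1) w^-1; rewrite subrK normc1.
  by move: (normc _) (normc _) inv_le => a b; big_lra.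
by apply: le_trans (le_normcD _ _) _; rewrite normcN normc1; move: (normc _) inv_le => a; big_lra.
Qed.

Lemma zero_sub_inv w : on_circle 0 e1 w -> 1 <= normc (1 - w^-1) <= 2 / e1.
Proof.
move=> /on_zero_norm e; have w0 : w != 0 by rewrite -normc_gt0 e.
have inv_ge : 4 <= e1^-1 by rewrite -[4]invrK lef_pV2 ?posrE.
have inv_e : normc w^-1 = e1^-1 by rewrite normcV e.
apply/andP; split.
  have := le_normcD (w^-1 - 1) 1; rewrite subrK normc1 inv_e normcB.
  by move: (normc _) (e1^-1) inv_ge => a b; zero_lra.
apply: le_trans (le_normcD _ _) _; rewrite normcN normc1 inv_e.
by move: (e1^-1) inv_ge => b; zero_lra.
Qed.

Lemma one_sub_inv_bounds w : on_circle 1 e2 w -> e2 / 2 <= normc (1 - w^-1) <= 2 * e2.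
Proof.
move=> hw; have /andP[w_ge w_le] := on_one_bounds hw.
have w_gt0 : 0 < normc w by one_lra.
rewrite one_sub_inv -?normc_gt0 // (on_one_norm hw).
rewrite ler_pdivlMr // ler_pdivrMr //; apply/andP; split; one_lra.
Qed.

Lemma zero_away0 w : on_circle 0 e1 w -> e1 <= normc w.
Proof. by move=> /on_zero_norm ->. Qed.

Lemma one_away0 w : on_circle 1 e2 w -> 2^-1 <= normc w.
Proof. by move=> /on_one_bounds /andP[h _]; one_lra. Qed.

Let r_ge0 : 0 <= r. Proof. big_lra. Qed.
Let half_gt0 : 0 < 2^-1 :> R. Proof. big_lra. Qed.
Let e22_gt0 : 0 < e2 / 2. Proof. one_lra. Qed.
Let big_low w : on_circle 0 r w -> 2^-1 <= normc (1 - w^-1).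
Proof. by move=> /big_sub_inv /andP[]. Qed.
Let zero_low w : on_circle 0 e1 w -> 1 <= normc (1 - w^-1).
Proof. by move=> /zero_sub_inv /andP[]. Qed.
Let one_low w : on_circle 1 e2 w -> e2 / 2 <= normc (1 - w^-1).
Proof. by move=> /one_sub_inv_bounds /andP[]. Qed.

Definition big_pascal := mean_pascal r_ge0 ltr01 half_gt0 big_away0 big_low.
Definition zero_pascal := mean_pascal (ltW e1_gt0) e1_gt0 ltr01 zero_away0 zero_low.
Definition one_pascal := mean_pascal (ltW e2_gt0) half_gt0 e22_gt0 one_away0 one_low.

Lemma mean_pow (s : R) (B : int) : 0 < s ->
  circle_mean 0 s (monomial 0 B) = (B == 0)%:R.
Proof.
move=> s_gt0; rewrite /circle_mean.
have -> : circle_integral 0 s (fun w => w^-1 * monomial 0 B w)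
    = circle_integral 0 s (fun w => (w - 0) ^ (B - 1)).
  rewrite !circle_integralE; apply: eq_cintegral => x; congr (_ * _).
  set w := circle_point _ _ _; have w0 : w != 0.
    rewrite -normc_gt0 -[w]subr0 normc_circle_point //; exact: ltW.
  by rewrite /monomial expr0z mulr1 subr0 expfzDr // exprN1 mulrC.
rewrite circle_integral_pow // mulrCA mulVf ?mulr1; last first.
  rewrite mulf_neq0 //; last by rewrite -normc_gt0 /= expr0n add0r expr1n sqrtr1.
  by rewrite -normc_gt0 normc_real normr_gt0 mulf_neq0 // gt_eqF // pi_gt0.
by rewrite -[B == 0](inj_eq (addIr (- 1))) add0r.
Qed.

Lemma big_mean00 : big_mean 0 0 = 1.
Proof. by rewrite /big_mean mean_pow // (lt_le_trans _ r_ge2). Qed.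

Lemma big_mean_nat (n : nat) B : (B < 0) || (n%:Z < B) -> big_mean n%:Z B = 0.
Proof.
elim: n B => [|n IH] B hB.
  rewrite /big_mean mean_pow ?(lt_le_trans _ r_ge2) //.
  by case: eqP hB => // ->.
have -> : n.+1%:Z = n%:Z + 1 by lia.
by rewrite /big_mean big_pascal -!/(big_mean _ _) !IH ?subrr //; lia.
Qed.

Lemma big_zero_mean (n : nat) B : zero_mean n%:Z B = big_mean n%:Z B.
Proof.
elim: n B => [|n IH] B.
  by rewrite /big_mean /zero_mean !mean_pow // (lt_le_trans _ r_ge2).
have -> : n.+1%:Z = n%:Z + 1 by lia.
by rewrite /big_mean /zero_mean big_pascal zero_pascal -!/(big_mean _ _) -!/(zero_mean _ _) !IH.
Qed.

(** Induction on - A. By the Pascal rule, and since the means for A + 1 vanish at negative B, the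
    mean does not change when B < 0 decreases; but it decays like r^B. *)
Lemma big_mean_neg A B : B < 0 -> big_mean A B = 0.
Proof.
case: A => [n|n]; first by move=> B0; rewrite big_mean_nat ?B0.
rewrite NegzE; elim: {n}n.+1 B => [|n IH] B B0; first by rewrite oppr0 big_mean_nat ?B0.
have step B' : B' < 0 -> big_mean (- n.+1%:Z) B' = big_mean (- n.+1%:Z) (B' - 1).
  move=> B'0; have := big_pascal (- n.+1%:Z) B'.
  have -> : - n.+1%:Z + 1 = - n%:Z by lia.
  by rewrite -!/(big_mean _ _) IH // => /esym /subr0_eq.
have steps k : big_mean (- n.+1%:Z) B = big_mean (- n.+1%:Z) (B - k%:Z).
  elim: k => [|k ->]; first by rewrite subr0.
  by rewrite step; [congr big_mean; lia|lia].
have [K K_ge0 bound] := mean_bound r_ge0 ltr01 half_gt0 big_away0 big_low.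
apply: (@geometric_decay_eq0 _ _ (K * (r ^ B * 2 ^+ n.+1)) r^-1).
- by rewrite invr_ge0.
- by rewrite invf_lt1; big_lra.
move=> k; rewrite (steps k) -mulrA; apply: bound => w hw.
have rk : r ^ (B - k%:Z) = r ^ B * r^-1 ^+ k.
  by rewrite expfzDr ?gt_eqF //; [rewrite -exprnN exprVn|big_lra].
rewrite /monomial normcM normc_exprz (on_big_norm hw) rk mulrAC -!mulrA.
rewrite ler_wpM2l ?exprz_ge0 // ler_wpM2r ?exprn_ge0 ?invr_ge0 //.
rewrite normc_exprz -exprnN -exprVn lerXn2r ?nnegrE ?invr_ge0 ?normc_ge0 //.
by rewrite invf_ple ?posrE ?big_low //; exact: lt_le_trans (big_low hw).
Qed.

(** For B = A + 1 the integrand against dw is (w - 1)^A. *)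
Lemma one_mean_diag A : one_mean A (A + 1) = (A == -1)%:R.
Proof.
rewrite /one_mean /circle_mean.
have -> : circle_integral 1 e2 (fun w => w^-1 * monomial A (A + 1) w)
    = circle_integral 1 e2 (fun w => (w - 1) ^ A).
  rewrite !circle_integralE; apply: eq_cintegral => x; congr (_ * _).
  have hw : on_circle 1 e2 (circle_point 1 e2 x) by exists x.
  set w := circle_point _ _ _ in hw *; have w0 : w != 0.
    by rewrite -normc_gt0; apply: lt_le_trans (one_away0 hw).
  rewrite /monomial expfzDr // expr1z mulrA [_ * w]mulrC mulrA mulVf // mul1r.
  by rewrite -expfzMl mulrBr mulr1 mulfV.
rewrite circle_integral_pow // mulrCA mulVf ?mulr1 //.
rewrite mulf_neq0 //; last by rewrite -normc_gt0 /= expr0n add0r expr1n sqrtr1.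
by rewrite -normc_gt0 normc_real normr_gt0 mulf_neq0 // gt_eqF // pi_gt0.
Qed.

(** The integrand is analytic near 1. The mean vanishes on the diagonal B = A + 1, and the Pascal
    rule propagates this to larger B. Towards smaller B the same rule shows that the modulus is
    constant along each diagonal, along which it decays like a power of [e2]. *)
Lemma one_mean_nat (n : nat) B : one_mean n%:Z B = 0.
Proof.
have pascal k D : one_mean k.+1%:Z D = one_mean k%:Z D - one_mean k%:Z (D - 1).
  have -> : k.+1%:Z = k%:Z + 1 by lia.
  by rewrite /one_mean one_pascal.
have diag k : one_mean k%:Z (k%:Z + 1) = 0 by rewrite one_mean_diag.
have up D k : one_mean k%:Z (k%:Z + 1 + D%:Z) = 0.
  elim: D k => [|D IH] k; first by rewrite addr0 diag.
  have := pascal k (k%:Z + 1 + D.+1%:Z).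
  have -> : k%:Z + 1 + D.+1%:Z - 1 = k%:Z + 1 + D%:Z by lia.
  have -> : k%:Z + 1 + D.+1%:Z = k.+1%:Z + 1 + D%:Z by lia.
  by rewrite !IH subr0 => <-.
have down D k : one_mean k%:Z (k%:Z + 1 - D%:Z) = 0.
  elim: D k => [|D IH] k; first by rewrite subr0 diag.
  have step l : one_mean l%:Z (l%:Z + 1 - D.+1%:Z)
      = - one_mean l.+1%:Z (l.+1%:Z + 1 - D.+1%:Z).
    rewrite pascal; have -> : l.+1%:Z + 1 - D.+1%:Z - 1 = l%:Z + 1 - D.+1%:Z by lia.
    have -> : l.+1%:Z + 1 - D.+1%:Z = l%:Z + 1 - D%:Z by lia.
    by rewrite IH sub0r opprK.
  have steps j : normc (one_mean k%:Z (k%:Z + 1 - D.+1%:Z))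
      = normc (one_mean (k + j)%N%:Z ((k + j)%N%:Z + 1 - D.+1%:Z)).
    elim: j => [|j ->]; first by rewrite addn0.
    by rewrite step normcN addnS.
  have [K K_ge0 bound] := mean_bound (ltW e2_gt0) half_gt0 e22_gt0 one_away0 one_low.
  apply: (@geometric_decay_eq0 _ _ (K * (e2 ^+ k * 2 ^+ D)) e2).
  - exact: ltW.
  - one_lra.
  move=> j; rewrite (steps j) -mulrA; apply: bound => w hw.
  have /andP[w_ge w_le] := on_one_bounds hw.
  have w0 : w != 0 by rewrite -normc_gt0; one_lra.
  have -> : monomial (k + j)%N%:Z ((k + j)%N%:Z + 1 - D.+1%:Z) w
      = (w - 1) ^+ (k + j) * w ^- D.
    rewrite addz1BS.
    rewrite /monomial expfzDr // mulrAC -expfzMl mulrBr mulr1 mulfV //.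
    by rewrite -exprnN.
  rewrite normcM normcX (on_one_norm hw) exprD -!mulrA ler_wpM2l ?exprn_ge0 ?(ltW e2_gt0) //.
  rewrite mulrC ler_wpM2r ?exprn_ge0 ?(ltW e2_gt0) //.
  rewrite normcV normcX -exprVn lerXn2r ?nnegrE ?invr_ge0 ?normc_ge0 //.
  by rewrite invf_ple ?posrE //; one_lra.
have [D ->] : exists D : int, B = n%:Z + 1 + D by exists (B - n%:Z - 1); lia.
case: D => D; first exact: up.
by rewrite NegzE down.
Qed.

(** The integrand is analytic near 0 in this range; as before, the Pascal rule makes the mean
    independent of B while it decays like e1^B. *)
Lemma zero_mean_high (n : nat) B : - n%:Z < B -> zero_mean (- n%:Z) B = 0.
Proof.
elim: n B => [|n IH] B hB.
  by rewrite oppr0 /zero_mean mean_pow //; case: eqP hB => // ->.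
have step B' : - n.+1%:Z < B' -> zero_mean (- n.+1%:Z) B' = zero_mean (- n.+1%:Z) (B' + 1).
  move=> hB'; have := zero_pascal (- n.+1%:Z) (B' + 1).
  have -> : - n.+1%:Z + 1 = - n%:Z by lia.
  by rewrite addrK -!/(zero_mean _ _) IH ?lia // => [/esym /subr0_eq -> //|]; lia.
have steps k : zero_mean (- n.+1%:Z) B = zero_mean (- n.+1%:Z) (B + k%:Z).
  elim: k => [|k ->]; first by rewrite addr0.
  by rewrite step; [congr zero_mean; lia|lia].
have [K K_ge0 bound] := mean_bound (ltW e1_gt0) e1_gt0 ltr01 zero_away0 zero_low.
apply: (@geometric_decay_eq0 _ _ (K * e1 ^ B) e1).
- exact: ltW.
- zero_lra.
move=> k; rewrite (steps k) -mulrA; apply: bound => w hw.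
have ek : e1 ^ (B + k%:Z) = e1 ^ B * e1 ^+ k by rewrite expfzDr ?gt_eqF.
rewrite /monomial normcM normc_exprz (on_zero_norm hw) ek.
rewrite ler_piMr ?mulr_ge0 ?exprz_ge0 ?exprn_ge0 ?(ltW e1_gt0) //.
rewrite normc_exprz -exprnN -exprVn exprn_ile1 ?invr_ge0 ?normc_ge0 //.
by rewrite invf_le1 ?zero_low //; apply: lt_le_trans (zero_low hw).
Qed.

(** The deformation of the large circle onto the singularities 0 and 1. The defect D of the identity
    satisfies the Pascal rule and vanishes for A >= 0. Inductively, for each A < 0 it does not
    depend on B, and it is 0 at B = A + 1, where all three means are known. *)
Lemma mean_split A B : big_mean A B = zero_mean A B + one_mean A B.
Proof.
case: A => [n|n]; first by rewrite one_mean_nat addr0 big_zero_mean.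
rewrite NegzE.
pose D A B := big_mean A B - zero_mean A B - one_mean A B.
suff D0 m B' : D (- m%:Z) B' = 0.
  by apply/eqP; rewrite -subr_eq0 opprD addrA; apply/eqP/D0.
have pascal A B1 : D (A + 1) B1 = D A B1 - D A (B1 - 1).
  rewrite /D /big_mean /zero_mean /one_mean big_pascal zero_pascal one_pascal.
  exact: subr3ACA.
elim: m B' => [|m IH] B'.
  by rewrite oppr0 /D (one_mean_nat 0) (big_zero_mean 0) subrr subr0.
have step B1 : D (- m.+1%:Z) (B1 - 1) = D (- m.+1%:Z) B1.
  have := pascal (- m.+1%:Z) B1; have -> : - m.+1%:Z + 1 = - m%:Z by lia.
  by rewrite IH => /esym /subr0_eq ->.
have base : D (- m.+1%:Z) (- m.+1%:Z + 1) = 0.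
  rewrite /D one_mean_diag zero_mean_high ?subr0; last by lia.
  case: m {IH step} => [|m].
    have := big_pascal (- 1) 0; rewrite -!/(big_mean _ _).
    rewrite (big_mean_neg _ (isT : 0 - 1 < 0 :> int)) subr0 big_mean00.
    by move=> <-; rewrite subrr.
  by rewrite big_mean_neg ?sub0r; lia || rewrite /= oppr0.
have shift k B1 : D (- m.+1%:Z) (B1 + k%:Z) = D (- m.+1%:Z) B1.
  elim: k => [|k IHk]; first by rewrite addr0.
  by rewrite -IHk -[LHS]step; congr D; lia.
have [le_B|lt_B] := leP (- m.+1%:Z + 1) B'.
  have -> : B' = - m.+1%:Z + 1 + (absz (B' - (- m.+1%:Z + 1))%R)%:Z by lia.
  by rewrite shift base.
rewrite -base; have -> : - m.+1%:Z + 1 = B' + (absz (- m.+1%:Z + 1 - B')%R)%:Z by lia.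
by rewrite shift.
Qed.
End MonomialValues.

(** * Uniform limits and geometric series *)

Section UniformLimits.
Variables (R : realType) (T : Type) (D : T -> Prop).
Local Notation C := R[i].

Definition uniform_limit (f : T -> C) (fm : nat -> T -> C) : Prop :=
  (exists2 M : R, 0 <= M & forall x, D x -> normc (f x) <= M) /\
  forall e, 0 < e -> exists m0, forall m x, (m0 <= m)%N -> D x -> normc (f x - fm m x) <= e.

Lemma uniform_limit_bounded f (M : R) : 0 <= M -> (forall x, D x -> normc (f x) <= M) ->
  uniform_limit f (fun=> f).
Proof.
move=> M_ge0 hM; split; first by exists M.
by move=> e e_gt0; exists 0%N => m x _ _; rewrite subrr normc0 ltW.
Qed.

Lemma uniform_limitM f g fm gm : uniform_limit f fm -> uniform_limit g gm ->
  uniform_limit (fun x => f x * g x) (fun m x => fm m x * gm m x).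
Proof.
move=> [[M M_ge0 hM] hf] [[M' M'_ge0 hM'] hg]; split.
  exists (M * M'); first exact: mulr_ge0.
  by move=> x Dx; rewrite normcM ler_pM ?normc_ge0 ?hM ?hM'.
move=> e e_gt0; pose d := Num.min 1 (e / (M + M' + 1)).
have S_gt0 : 0 < M + M' + 1 by rewrite ltr_wpDl ?addr_ge0.
have d_gt0 : 0 < d by rewrite lt_min ltr01 divr_gt0.
have d_le1 : d <= 1 by rewrite ge_min lexx.
have d_le : d * (M + M' + 1) <= e by rewrite -ler_pdivlMr // ge_min lexx orbT.
have [m1 h1] := hf _ d_gt0; have [m2 h2] := hg _ d_gt0.
exists (maxn m1 m2) => m x; rewrite geq_max => /andP[le1 le2] Dx.
have := h1 m x le1 Dx; have := h2 m x le2 Dx; have := hM x Dx; have := hM' x Dx.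
move: (f x) (g x) (fm m x) (gm m x) => u u' v v' hu' hu huv' huv.
have -> : u * u' - v * v' = u * (u' - v') + (u - v) * u' - (u - v) * (u' - v') by ring.
apply: le_trans (le_normcD _ _) _; rewrite normcN.
apply: le_trans (lerD (le_normcD _ _) (lexx _)) _; rewrite !normcM.
apply: le_trans d_le; have -> : d * (M + M' + 1) = M * d + d * M' + d * 1 by ring.
apply: lerD; [apply: lerD|]; apply: ler_pM; rewrite ?normc_ge0 //.
exact: le_trans d_le1.
Qed.

Lemma uniform_limit_prod (I : Type) (r : seq I) (f : I -> T -> C) fm :
  (forall i, uniform_limit (f i) (fm i)) ->
  uniform_limit (fun x => \prod_(i <- r) f i x) (fun m x => \prod_(i <- r) fm i m x).
Proof.
move=> hf; elim: r => [|i r IH].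
  under eq_fun do rewrite big_nil; under [X in uniform_limit _ X]eq_fun do
    under eq_fun do rewrite big_nil.
  by apply: (@uniform_limit_bounded _ 1) => // x _; rewrite normc1.
under eq_fun do rewrite big_cons; under [X in uniform_limit _ X]eq_fun do
  under eq_fun do rewrite big_cons.
exact: uniform_limitM.
Qed.
End UniformLimits.

Section GeometricSeries.
Variable R : realType.
Local Notation C := R[i].

(** Coefficients of the two expansions of 1/(1 - u): all powers k >= 0 when u is small, minus all
    powers k < 0 when u is large. [two_sided m] keeps the exponents from -m to m - 1. *)
Definition branch (b : bool) (k : int) : C :=
  if b then (0 <= k)%R%:R else - (k < 0)%R%:R.

Definition two_sided (m : nat) (b : bool) (u : C) : C :=
  \sum_(k < m + m) branch b (k%:Z - m%:Z) * u ^ (k%:Z - m%:Z).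

Definition dominated (b : bool) (u : C) : Prop :=
  u != 0 /\ normc (if b then u else u^-1) <= 2^-1.

Lemma two_sided_pos m u : two_sided m true u = \sum_(k < m) u ^+ k.
Proof.
rewrite /two_sided big_split_ord /= big1 ?add0r => [|k _]; last first.
  by rewrite leNgt subr_lt0 ltz_nat ltn_ord mul0r.
apply: eq_bigr => k _; rewrite PoszD addrAC subrr add0r.
by rewrite mul1r.
Qed.

Lemma two_sided_neg m u : two_sided m false u = - \sum_(k < m) u^-1 ^+ k.+1.
Proof.
rewrite /two_sided big_split_ord /= addrC big1 ?add0r => [|k _]; last first.
  by rewrite PoszD addrAC subrr add0r oppr0 mul0r.
rewrite (reindex_inj rev_ord_inj) -sumrN; apply: eq_bigr => k _ /=.
have -> : (m - k.+1)%N%:Z - m%:Z = - k.+1%:Z by have := ltn_ord k; lia.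
by rewrite mulN1r -exprnN exprVn.
Qed.

Lemma geometric_tail (u : C) m : u != 1 ->
  (1 - u)^-1 - \sum_(k < m) u ^+ k = u ^+ m * (1 - u)^-1.
Proof.
move=> u1; have u1' : 1 - u != 0 by rewrite subr_eq0 eq_sym.
have := subrX1 u m; rewrite -[u - 1]opprB mulNr => e.
have : (1 - u) * \sum_(k < m) u ^+ k = 1 - u ^+ m by rewrite -[LHS]opprK -e opprB.
move=> {}e; apply: (mulfI u1'); rewrite mulrBr e mulfV // mulrCA mulfV //.
by rewrite mulr1 subKr.
Qed.

Lemma half_away (u : C) : normc u <= 2^-1 -> u != 1 /\ normc (1 - u)^-1 <= 2.
Proof.
move=> hu; have := le_normcD (1 - u) u; rewrite subrK normc1 => h.
have h2 : 2^-1 <= normc (1 - u) by move: (normc _) (normc _) hu h => x y; lra.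
have pos : 0 < normc (1 - u) by apply: lt_le_trans h2; rewrite invr_gt0.
split; first by move: pos; rewrite normc_gt0 subr_eq0 eq_sym.
by rewrite normcV invf_ple ?posrE.
Qed.

Lemma dominated_neq1 b u : dominated b u -> u != 1.
Proof.
case: b => -[u0 /half_away[h _]] //.
by apply: contra h => /eqP ->; rewrite invr1.
Qed.

Lemma two_sided_error m b u : dominated b u ->
  normc ((1 - u)^-1 - two_sided m b u) <= 2 * 2^-1 ^+ m.
Proof.
case: b => -[u0 hu]; have [u1 inv_le] := half_away hu.
  rewrite two_sided_pos geometric_tail // normcM mulrC normcX.
  by apply: ler_pM; rewrite ?normc_ge0 ?exprn_ge0 ?normc_ge0 // lerXn2r ?nnegrE ?normc_ge0 ?invr_ge0.
set v := u^-1 in hu u1 inv_le *; have uE : u = v^-1 by rewrite invrK.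
have v0 : v != 0 by rewrite invr_eq0.
have v1' : 1 - v != 0 by rewrite subr_eq0 eq_sym.
have -> : (1 - u)^-1 = 1 - (1 - v)^-1.
  have u1' : 1 - u != 0.
    by rewrite uE -[X in X - _](mulfV v0) -[X in _ - X]mul1r -mulrBl mulf_neq0 ?subr_eq0 ?invr_eq0.
  by apply: (mulfI u1'); rewrite mulfV // uE; field; rewrite v0 v1'.
rewrite two_sided_neg opprK -/v.
have -> : 1 - (1 - v)^-1 + \sum_(k < m) v ^+ k.+1 = - ((1 - v)^-1 - \sum_(k < m.+1) v ^+ k).
  by rewrite big_ord_recl expr0 opprB [LHS]addrAC.
rewrite geometric_tail // normcN normcM mulrC normcX.
apply: ler_pM; rewrite ?normc_ge0 ?exprn_ge0 ?normc_ge0 //.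
apply: le_trans (_ : 2^-1 ^+ m.+1 <= _).
  by rewrite lerXn2r ?nnegrE ?normc_ge0 ?invr_ge0.
by rewrite exprS ler_piMl ?exprn_ge0 ?invr_ge0 // invf_le1 // ler1n.
Qed.

Lemma uniform_limit_two_sided (T : Type) (D : T -> Prop) (n : nat) (b : T -> bool) (u : T -> C) :
    (0 < n)%N -> (forall x, D x -> dominated (b x) (u x)) ->
  uniform_limit D (fun x => (1 - u x)^-1) (fun m x => two_sided (n * m) (b x) (u x)).
Proof.
move=> n_gt0 dom; split.
  exists 2 => // x /dom h; apply: le_trans (_ : 2 * 2^-1 ^+ 0 <= _); last by rewrite mulr1.
  have := two_sided_error 0 h; rewrite /two_sided.
  by rewrite big_ord0 subr0.
move=> e e_gt0; have half_lt1 : (2^-1 : R) < 1 by rewrite invf_lt1 ?ltr1n.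
have lim : 2^-1 ^+ k @[k --> \oo] --> (0 : R) by apply: cvg_expr; rewrite ger0_norm ?invr_ge0.
have e2_gt0 : 0 < e / 2 by rewrite divr_gt0.
have /cvgr_le /(_ _ e2_gt0) [m0 _ hm0] := lim.
exists m0 => m x le_m Dx; apply: le_trans (two_sided_error _ (dom x Dx)) _.
rewrite mulrC -ler_pdivlMr //; apply: hm0 => /=.
by apply: leq_trans le_m _; rewrite leq_pmull.
Qed.
End GeometricSeries.

(** * The contours of w and of z *)

Section ContourFunctionals.
Variable R : realType.
Local Notation C := R[i].

Lemma circle_admissible_ext (c : C) (s : R) (f g : C -> C) :
  (forall w, on_circle c s w -> f w = g w) ->
  circle_admissible c s g -> circle_admissible c s f.
Proof.
move=> fg [g1 [M gM]]; split; last by exists M => w hw; rewrite fg // gM.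
by have -> : (fun x => f (circle_point c s x)) = (fun x => g (circle_point c s x));
  first by apply/funext => x; rewrite fg //; exists x.
Qed.

Lemma circle_scaled (c : C) (s m : R) (k : C) (f g : C -> C) :
    0 <= s -> 0 < m -> (forall w, on_circle c s w -> m <= normc w) ->
    circle_admissible c s g -> (forall w, on_circle c s w -> f w = g w * k) ->
  circle_admissible c s f /\ circle_mean c s f = circle_mean c s g * k.
Proof.
move=> s_ge0 m_gt0 away g_ad fg; have [K F] := circle_functional s_ge0 m_gt0 away.
split.
  apply: circle_admissible_ext fg _; apply: (cf_mul F) => //; exact: (cf_cst F).
rewrite mulrC -(cf_intZ F) //.
by apply: (cf_ext F) => w hw; rewrite fg // mulrC.
Qed.

Lemma prod_exprz (I : Type) (s : seq I) (x : I -> C) (n : int) :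
  \prod_(i <- s) x i ^ n = (\prod_(i <- s) x i) ^ n.
Proof. by elim/big_rec2: _ => [|i u v _ ->]; rewrite ?exp1rz // expfzMl. Qed.

Lemma exprz_sum (I : Type) (s : seq I) (x : C) (n : I -> int) : x != 0 ->
  \prod_(i <- s) x ^ n i = x ^ (\sum_(i <- s) n i).
Proof.
by move=> x0; elim/big_rec2: _ => [|i u v _ ->]; rewrite ?expr0z // expfzDr.
Qed.
End ContourFunctionals.

Section ContourW.
Variables (R : realType) (r e1 e2 : R).
Local Notation C := R[i].
Hypotheses (r_ge2 : 2 <= r) (e1_gt0 : 0 < e1) (e1_le : e1 <= 4^-1).
Hypotheses (e2_gt0 : 0 < e2) (e2_le : e2 <= 4^-1).

Definition on_w (w : C) : Prop := (on_circle 0 r w \/ on_circle 0 e1 w) \/ on_circle 1 e2 w.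
Definition adm_w (f : C -> C) : Prop :=
  (circle_admissible 0 r f /\ circle_admissible 0 e1 f) /\ circle_admissible 1 e2 f.
Definition mean_w (f : C -> C) : C :=
  circle_mean 0 r f - circle_mean 0 e1 f - circle_mean 1 e2 f.

(** Together with [is_near1], tells from w itself which circle of the contour carries it, so that
    one function can use different expansions on different circles. *)
Definition is_big (w : C) : bool := normc w == r.
Definition is_near1 (w : C) : bool := normc (w - 1) == e2.

Lemma on_w_big w : on_circle 0 r w -> is_big w = true /\ is_near1 w = false.
Proof.
move=> hw; have e := on_big_norm r_ge2 hw; rewrite /is_big e eqxx; split=> //.
apply/negbTE; rewrite neq_lt; apply/orP; right.
have := normc_1B w; rewrite e ler_norml => /andP[h _].
by move: h r_ge2 e2_le; move: (normc _) => u; lra.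
Qed.

Lemma on_w_zero w : on_circle 0 e1 w -> is_big w = false /\ is_near1 w = false.
Proof.
move=> hw; have e := on_zero_norm e1_gt0 hw; rewrite /is_big e; split.
  by apply/negbTE; rewrite neq_lt; apply/orP; left; move: r_ge2 e1_le; lra.
apply/negbTE; rewrite neq_lt; apply/orP; right.
have := normc_1B w; rewrite e ler_norml => /andP[_ h].
by move: h e1_le e2_le; move: (normc _) => u; lra.
Qed.

Lemma on_w_one w : on_circle 1 e2 w -> is_big w = false /\ is_near1 w = true.
Proof.
move=> hw; rewrite /is_near1 (on_one_norm e2_gt0 hw) eqxx; split=> //.
have /andP[_ h] := on_one_bounds e2_gt0 e2_le hw.
apply/negbTE; rewrite neq_lt; apply/orP; left.
by move: h r_ge2; move: (normc _) => u; lra.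
Qed.

Lemma on_w_neq w : on_w w -> w != 0 /\ w != 1.
Proof.
have lt_neq (x : R) (u : C) : 0 < x -> x <= normc u -> u != 0.
  by move=> x_gt0 h; rewrite -normc_gt0; apply: lt_le_trans h.
have half : (0 : R) < 2^-1 by rewrite invr_gt0.
have ne1 (u : C) : 1 - u^-1 != 0 -> u != 1.
  by apply: contra => /eqP ->; rewrite invr1 subrr.
case=> [[]|] hw; split.
- exact: lt_neq (ltr01) (big_away0 r_ge2 hw).
- by apply: ne1; apply: lt_neq half _; have /andP[] := big_sub_inv r_ge2 hw.
- exact: lt_neq e1_gt0 (zero_away0 e1_gt0 hw).
- by apply: ne1; apply: lt_neq ltr01 _; have /andP[] := zero_sub_inv e1_gt0 e1_le hw.
- exact: lt_neq half (one_away0 e2_gt0 e2_le hw).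
- apply: ne1; apply: (@lt_neq (e2 / 2)); first by rewrite divr_gt0.
  by have /andP[] := one_sub_inv_bounds e2_gt0 e2_le hw.
Qed.

Let r_ge0 : 0 <= r. Proof. exact: le_trans r_ge2. Qed.
Let half_gt0 : (0 : R) < 2^-1. Proof. by rewrite invr_gt0. Qed.

Lemma functional_w : exists K, contour_functional on_w adm_w mean_w K.
Proof.
have [K1 F1] := circle_functional r_ge0 ltr01 (big_away0 r_ge2).
have [K2 F2] := circle_functional (ltW e1_gt0) e1_gt0 (zero_away0 e1_gt0).
have [K3 F3] := circle_functional (ltW e2_gt0) half_gt0 (one_away0 e2_gt0 e2_le).
by exists (K1 + K2 + K3); exact: contour_functionalB (contour_functionalB F1 F2) F3.
Qed.

Lemma monomial_big A B : circle_admissible 0 r (monomial A B).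
Proof.
apply: (monomial_circle_admissible r_ge0 ltr01 half_gt0 (big_away0 r_ge2)).
by move=> w /(big_sub_inv r_ge2) /andP[].
Qed.

Lemma monomial_zero A B : circle_admissible 0 e1 (monomial A B).
Proof.
apply: (monomial_circle_admissible (ltW e1_gt0) e1_gt0 ltr01 (zero_away0 e1_gt0)).
by move=> w /(zero_sub_inv e1_gt0 e1_le) /andP[].
Qed.

Lemma monomial_one A B : circle_admissible 1 e2 (monomial A B).
Proof.
apply: (@monomial_circle_admissible _ _ _ 2^-1 (e2 / 2)) => //.
- exact: ltW.
- by rewrite divr_gt0.
- exact: one_away0.
- by move=> w /(one_sub_inv_bounds e2_gt0 e2_le) /andP[].
Qed.

Lemma monomial_indicator A B (h : bool -> bool -> C) (f : C -> C) :
    (forall w, f w = monomial A B w * h (is_big w) (is_near1 w)) ->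
  adm_w f /\ mean_w f = big_mean r A B * h true false - zero_mean e1 A B * h false false
    - one_mean e2 A B * h false true.
Proof.
move=> fE.
have [|a1 m1] := @circle_scaled _ 0 r 1 (h true false) f _ r_ge0 ltr01 (big_away0 r_ge2) (monomial_big A B).
  by move=> w hw; rewrite fE; have [-> ->] := on_w_big hw.
have [|a2 m2] := @circle_scaled _ 0 e1 e1 (h false false) f _ (ltW e1_gt0) e1_gt0 (zero_away0 e1_gt0)
    (monomial_zero A B).
  by move=> w hw; rewrite fE; have [-> ->] := on_w_zero hw.
have [|a3 m3] := @circle_scaled _ 1 e2 2^-1 (h false true) f _ (ltW e2_gt0) half_gt0
    (one_away0 e2_gt0 e2_le) (monomial_one A B).
  by move=> w hw; rewrite fE; have [-> ->] := on_w_one hw.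
by split; [split|rewrite /mean_w m1 m2 m3].
Qed.

(** For k >= 0 only the large circle contributes. For k < 0 only the two small ones do, with the
    sign of the contour cancelled by the sign of the expansion, and [mean_split] gives the same
    value. *)
Lemma monomial_branch (k A B : int) :
  let f w := monomial A B w * branch R (is_big w) k in
  adm_w f /\ mean_w f = big_mean r A B.
Proof.
move=> f.
have [ad ->] := @monomial_indicator A B (fun b _ => branch R b k) f (fun=> erefl).
split=> //; rewrite (mean_split r_ge2 e1_gt0 e1_le e2_gt0 e2_le) /branch leNgt.
move: (zero_mean _ _ _) (one_mean _ _ _) => u v.
by case: (k < 0); rewrite /= ?oppr0 !(mulr0, mulr1, subr0) // !mulrN1 !opprK add0r.
Qed.

Lemma monomial_branch_near1 (k A B : int) :
  let f w := monomial A B w * (branch R (is_big w) k * (is_near1 w)%:R) in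
  adm_w f /\ (0 <= A -> mean_w f = 0).
Proof.
move=> f.
have [ad ->] := @monomial_indicator A B (fun b o => branch R b k * o%:R) f (fun=> erefl).
split=> //; case: A {f ad} => // n _; rewrite (one_mean_nat r_ge2 e1_gt0 e1_le e2_gt0 e2_le).
by rewrite mul0r !mulr0 !subr0.
Qed.

Lemma monomial_w A B : adm_w (monomial A B).
Proof. by split; [split; [exact: monomial_big|exact: monomial_zero]|exact: monomial_one]. Qed.
End ContourW.

Section ContourZ.
Variables (R : realType) (R' e' : R).
Local Notation C := R[i].
Hypotheses (R'_ge2 : 2 <= R') (e'_gt0 : 0 < e') (e'_le : e' <= 4^-1).

Definition on_z (z : C) : Prop := on_circle 0 R' z \/ on_circle 0 e' z.
Definition adm_z (f : C -> C) : Prop := circle_admissible 0 R' f /\ circle_admissible 0 e' f.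
Definition mean_z (f : C -> C) : C := circle_mean 0 R' f - circle_mean 0 e' f.
Definition is_far (z : C) : bool := normc z == R'.

Let R'_ge0 : 0 <= R'. Proof. exact: le_trans R'_ge2. Qed.

Lemma functional_z : exists K, contour_functional on_z adm_z mean_z K.
Proof.
have [K1 F1] := circle_functional R'_ge0 ltr01 (big_away0 R'_ge2).
have [K2 F2] := circle_functional (ltW e'_gt0) e'_gt0 (zero_away0 e'_gt0).
by exists (K1 + K2); exact: contour_functionalB F1 F2.
Qed.

Lemma on_z_neq0 z : on_z z -> z != 0.
Proof.
case=> hz; rewrite -normc_gt0; first exact: lt_le_trans ltr01 (big_away0 R'_ge2 hz).
exact: lt_le_trans e'_gt0 (zero_away0 e'_gt0 hz).
Qed.

Lemma power_indicator (B : int) (h : bool -> C) (f : C -> C) :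
    (forall z, f z = monomial 0 B z * h (is_far z)) ->
  adm_z f /\ mean_z f = (B == 0)%:R * (h true - h false).
Proof.
move=> fE.
have [|a1 m1] := @circle_scaled _ 0 R' 1 (h true) f _ R'_ge0 ltr01 (big_away0 R'_ge2)
    (monomial_big R'_ge2 0 B).
  by move=> z hz; rewrite fE /is_far (on_big_norm R'_ge2 hz) eqxx.
have [|a2 m2] := @circle_scaled _ 0 e' e' (h false) f _ (ltW e'_gt0) e'_gt0 (zero_away0 e'_gt0)
    (monomial_zero e'_gt0 e'_le 0 B).
  move=> z hz; rewrite fE /is_far (on_zero_norm e'_gt0 hz) lt_eqF //.
  by move: R'_ge2 e'_le; lra.
split=> //; rewrite /mean_z m1 m2 !mean_pow // ?mulrBr //.
by move: R'_ge2; lra.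
Qed.
End ContourZ.

(** * Expansion of the kernel into winding sums *)

Lemma box_sum_bound (N m : nat) (k : 'I_N -> 'I_(m + m)) : (0 < N)%N ->
  - (N * m)%N%:Z <= \sum_i ((k i)%:Z - m%:Z) < (N * m)%N%:Z.
Proof.
move=> N_gt0; have k_lt (i : 'I_N) : (k i)%:Z - m%:Z <= m%:Z - 1.
  by have := ltn_ord (k i); lia.
have sum_cst (x : int) : \sum_(i < N) x = N%:Z * x.
  by rewrite sumr_const card_ord -mulr_natl natz.
apply/andP; split.
  have -> : - (N * m)%N%:Z = \sum_(i < N) (- m%:Z) by rewrite sum_cst; lia.
  by apply: ler_sum => i _; lia.
apply: (@le_lt_trans _ _ (\sum_(i < N) (m%:Z - 1))); first exact: ler_sum.
by rewrite sum_cst; lia.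
Qed.

Section Expansion.
Variables (R : realType) (N L : nat) (c : R[i]) (r e1 e2 R' e' : R).
Local Notation C := R[i].
Hypotheses (r_ge2 : 2 <= r) (e1_gt0 : 0 < e1) (e1_le : e1 <= 4^-1).
Hypotheses (e2_gt0 : 0 < e2) (e2_le : e2 <= 4^-1).
Hypotheses (R'_ge2 : 2 <= R') (e'_gt0 : 0 < e') (e'_le : e' <= 4^-1).
Hypotheses (N_gt0 : (0 < N)%N) (L_gt0 : (0 < L)%N) (c_neq0 : c != 0).

(** With c = (-1)^(N+1) zeta^L, 1 - [p_ratio] is p_z, and 1 - [q_ratio] is q_z. *)
Definition p_ratio (z : C) (ws : N.-tuple C) : C :=
  c * z ^ (- L%:Z) * \prod_(i < N) (1 - (tnth ws i)^-1).

Definition q_ratio (z w : C) : C := z ^ L%:Z * monomial (- N%:Z) (- L%:Z) w.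

(** The ratio is small for large z, but also for small z when all the w_i are near 1, as the product
    of the 1 - 1/w_i is then tiny. *)
Definition p_branch (z : C) (ws : N.-tuple C) : bool :=
  is_far R' z || [forall i, is_near1 e2 (tnth ws i)].

Local Notation onw := (on_w r e1 e2).
Local Notation onz := (on_z R' e').
Local Notation Jw := (mean_w r e1 e2).
Local Notation Jz := (mean_z R' e').

Hypothesis q_dominated : forall z w, onz z -> onw w -> dominated (is_big r w) (q_ratio z w).
Hypothesis p_dominated : forall z ws, onz z -> on_power onw ws ->
  dominated (p_branch z ws) (p_ratio z ws).

Definition kernel (a b : 'I_N -> int) (z : C) (ws : N.-tuple C) : C :=
  \prod_(i < N) monomial (a i) (b i) (tnth ws i) *
  ((1 - p_ratio z ws)^-1 * \prod_(i < N) (1 - q_ratio z (tnth ws i))^-1).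

(** The series of 1/p_z is cut at N m because its exponent has to meet sums of N exponents between
    -m and m - 1. *)
Definition truncated_kernel (m : nat) (a b : 'I_N -> int) (z : C) (ws : N.-tuple C) : C :=
  \prod_(i < N) monomial (a i) (b i) (tnth ws i) *
  (two_sided (N * m) (p_branch z ws) (p_ratio z ws) *
   \prod_(i < N) two_sided (1 * m) (is_big r (tnth ws i)) (q_ratio z (tnth ws i))).

Lemma kernel_limit a b e : 0 < e -> exists m0, forall m z ws, (m0 <= m)%N ->
  onz z -> on_power onw ws -> normc (kernel a b z ws - truncated_kernel m a b z ws) <= e.
Proof.
move=> e_gt0.
pose D (x : C * N.-tuple C) := onz x.1 /\ on_power onw x.2.
have [Kw Fw] := functional_w r_ge2 e1_gt0 e2_gt0 e2_le.
have mono_lim (i : 'I_N) : uniform_limit D (fun x => monomial (a i) (b i) (tnth x.2 i))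
    (fun=> fun x => monomial (a i) (b i) (tnth x.2 i)).
  have [M hM] := cf_bdd Fw (monomial_w r_ge2 e1_gt0 e1_le e2_gt0 e2_le (a i) (b i)).
  apply: (@uniform_limit_bounded _ _ _ _ `|M|) => // x [_ hx].
  exact: le_trans (hM _ (hx i)) (ler_norm _).
have p_lim : uniform_limit D (fun x => (1 - p_ratio x.1 x.2)^-1)
    (fun m x => two_sided (N * m) (p_branch x.1 x.2) (p_ratio x.1 x.2)).
  by apply: uniform_limit_two_sided => // x [hz hw]; exact: p_dominated.
have q_lim (i : 'I_N) : uniform_limit D (fun x => (1 - q_ratio x.1 (tnth x.2 i))^-1)
    (fun m x => two_sided (1 * m) (is_big r (tnth x.2 i)) (q_ratio x.1 (tnth x.2 i))).
  by apply: uniform_limit_two_sided => // x [hz hw]; apply: q_dominated.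
have [_ /(_ e e_gt0)[m0 hm0]] := uniform_limitM
  (uniform_limit_prod (index_enum 'I_N) mono_lim)
  (uniform_limitM p_lim (uniform_limit_prod (index_enum 'I_N) q_lim)).
by exists m0 => m z ws le_m hz hw; exact: (hm0 m (z, ws) le_m (conj hz hw)).
Qed.

Section Truncation.
Variables (m : nat) (a b : 'I_N -> int).
(** The exponent for 1/p_z, the exponents for the 1/q_z(w_i), and a boolean: [true] for the
    expansion decided by z alone, [false] for the correction where z is small and all w_i are near
    1. *)
Let index : finType := ('I_(N * m + N * m) * {ffun 'I_N -> 'I_(m + m)} * bool)%type.
Let height (t : index) : int := (t.1.1)%:Z - (N * m)%N%:Z.
Let winding (t : index) (i : 'I_N) : int := (t.1.2 i)%:Z - m%:Z.

Let z_factor (t : index) (z : C) : C := c ^ height t *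
  (monomial 0 (L%:Z * (\sum_i winding t i) - L%:Z * height t) z *
   (if t.2 then branch R (is_far R' z) (height t) else (~~ is_far R' z)%:R)).

Let w_factor (t : index) (i : nat) (w : C) : C :=
  if insub i is Some i then
    monomial (a i + height t - N%:Z * winding t i) (b i - L%:Z * winding t i) w *
    (branch R (is_big r w) (winding t i) * (if t.2 then 1 else (is_near1 e2 w)%:R))
  else 1.

Let index_sum (G : index -> C) : \sum_t G t = \sum_l \sum_k \sum_(t : bool) G ((l, k), t).
Proof. by rewrite !pair_bigA; apply: eq_bigr => -[[]]. Qed.

(** The two expansions differ by the full bilateral series, whose coefficients are all 1. *)
Lemma branch_split (far near : bool) (k : int) :
  branch R (far || near) k = branch R far k + (~~ far)%:R * near%:R.
Proof.
rewrite /branch leNgt; case: far; case: near; rewrite /= ?mul0r ?mulr0 ?addr0 ?mul1r //.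
by case: (k < 0) => /=; rewrite ?oppr0 ?add0r ?addNr.
Qed.

Lemma truncated_kernelE z ws : onz z -> on_power onw ws ->
  truncated_kernel m a b z ws = z_tensor_sum z_factor w_factor z ws.
Proof.
move=> hz hw; have z0 := on_z_neq0 R'_ge2 e'_gt0 hz.
have w_neq i := on_w_neq r_ge2 e1_gt0 e1_le e2_gt0 e2_le (hw i).
have w1 i : 1 - (tnth ws i)^-1 != 0.
  by rewrite subr_eq0 eq_sym invr_eq1; have [] := w_neq i.
rewrite /z_tensor_sum index_sum /truncated_kernel /two_sided mul1n bigA_distr_bigA big_distrlr /=.
rewrite mulr_sumr; apply: eq_bigr => l _; rewrite mulr_sumr; apply: eq_bigr => k _.
pose h := l%:Z - (N * m)%N%:Z; pose v i := (k i)%:Z - m%:Z.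
pose M := \prod_(i < N) monomial (a i) (b i) (tnth ws i).
pose P := \prod_(i < N) (1 - (tnth ws i)^-1).
pose Y := \prod_(i < N) (branch R (is_big r (tnth ws i)) (v i) *
  monomial (- N%:Z) (- L%:Z) (tnth ws i) ^ v i).
have w_part (t : bool) : \prod_(i < N) w_factor ((l, k), t) i (tnth ws i)
    = M * P ^ h * Y * (if t then 1 else [forall i, is_near1 e2 (tnth ws i)]%:R).
  have -> : (if t then 1 else [forall i, is_near1 e2 (tnth ws i)]%:R) =
      \prod_(i < N) (if t then 1 else (is_near1 e2 (tnth ws i))%:R) :> C.
    case: t; first by rewrite big1.
    case: forallP => [near|/forallP/forallPn[i /negPf far]].
      by rewrite big1 // => i _; rewrite near.
    by rewrite (bigD1 i) //= far mul0r.
  rewrite -prod_exprz -!big_split; apply: eq_bigr => i _.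
  rewrite /w_factor (valK i) /= /height /winding /= -/h -/(v i).
  have [wi0 _] := w_neq i; have := w1 i; rewrite /monomial.
  move: (1 - _) (v i) (h) => u vi h' u0; rewrite -!mulNr !expfzDr // -!exprz_exp expfzMl.
  move: (branch _ _ _) (if _ then _ else _) => s f.
  move: (u ^ a i) (u ^ h') (_ ^ b i) ((u ^ _) ^ _) ((_ ^ _) ^ _) => x1 x2 x3 x4 x5; ring.
have q_part : \prod_(i < N) (branch R (is_big r (tnth ws i)) (v i) * q_ratio z (tnth ws i) ^ v i)
    = Y * z ^ (L%:Z * \sum_(i < N) v i).
  rewrite -exprz_exp -exprz_sum ?expfz_neq0 // -big_split; apply: eq_bigr => i _ /=.
  by rewrite /q_ratio expfzMl [X in _ * X]mulrC mulrA.
rewrite big_bool /= !w_part {}q_part /z_factor /height /winding /= -/h.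
rewrite /p_branch branch_split /p_ratio !expfzMl -/P /monomial expr0z mulr1.
have -> : z ^ (L%:Z * (\sum_(i < N) v i) - L%:Z * h) = z ^ (L%:Z * \sum_(i < N) v i) * (z ^ (- L%:Z)) ^ h.
  by rewrite expfzDr // -mulNr exprz_exp.
clear w_part; rewrite -/M; move: (M) (Y) (P ^ h) (c ^ h) => M' Y' P' c'.
move: (z ^ _) ((z ^ _) ^ _) (branch _ _ _) (_%:R) (_%:R) => x x' u f n; ring.
Qed.

Lemma branchB k : branch R true k - branch R false k = 1.
Proof. by rewrite /branch leNgt opprK; case: (k < 0); rewrite ?add0r ?addr0. Qed.

Lemma z_factor_mean t : adm_z R' e' (z_factor t) /\
  Jz (z_factor t) = (height t == \sum_i winding t i)%:R * (c ^ height t * (-1) ^+ ~~ t.2).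
Proof.
pose h far : C := c ^ height t *
  (if t.2 then branch R far (height t) else (~~ far)%:R).
have [|ad ->] := @power_indicator _ R' e' R'_ge2 e'_gt0 e'_le
  (L%:Z * (\sum_i winding t i) - L%:Z * height t) h (z_factor t).
  by move=> z; rewrite /z_factor mulrCA.
split=> //; congr (_%:R * _).
  have /negPf L0 : L%:Z != 0 by rewrite eqz_nat -lt0n.
  by rewrite -mulrBr mulf_eq0 L0 subr_eq0 eq_sym.
rewrite /h -mulrBr; case: (t.2); first by rewrite branchB.
by rewrite /= sub0r.
Qed.

Lemma w_factor_admissible t i : adm_w r e1 e2 (w_factor t i).
Proof.
have [Kw Fw] := functional_w r_ge2 e1_gt0 e2_gt0 e2_le.
rewrite /w_factor; case: (insub i) => [j|]; last exact: (cf_cst Fw).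
by have [] := @monomial_indicator _ r e1 e2 r_ge2 e1_gt0 e1_le e2_gt0 e2_le
  (a j + height t - N%:Z * winding t j) (b j - L%:Z * winding t j)
  (fun big near => branch R big (winding t j) * (if t.2 then 1 else near%:R)) _ (fun=> erefl).
Qed.

(** Integration in z keeps only the terms where the exponent for 1/p_z is the sum of the others. The
    main terms are those of the winding sum by [monomial_branch], and the corrections vanish. *)
Lemma truncated_integral : 0 <= \sum_i a i ->
  \sum_t Jz (z_factor t) * \prod_(i < N) Jw (w_factor t i) = winding_sum L (big_mean r) c m a b.
Proof.
move=> a_ge0; rewrite index_sum exchange_big; apply: eq_bigr => k _ /=.
pose S := \sum_(i < N) ((k i)%:Z - m%:Z).
have SE : \sum_i box_point k i = S by apply: eq_bigr => i _; rewrite ffunE.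
have /andP[S_ge S_lt] : - (N * m)%N%:Z <= S < (N * m)%N%:Z by exact: box_sum_bound.
(* The index of the exponent S, exponents being stored with offset N m. *)
have l0_lt : (absz (S + (N * m)%N%:Z)%R < N * m + N * m)%N by lia.
have h0 : (absz (S + (N * m)%N%:Z)%R)%:Z - (N * m)%N%:Z = S by lia.
rewrite (bigD1 (Ordinal l0_lt)) //= [X in _ + X]big1 ?addr0 => [|l l_neq]; last first.
  apply: big1 => t _; have [_ ->] := z_factor_mean (l, k, t).
  rewrite /height /winding /= -/S; case: eqP => [lE|_]; last by rewrite !mul0r.
  by case/eqP: l_neq; apply: val_inj => /=; lia.
rewrite big_bool /=; have [_ ->] := z_factor_mean (Ordinal l0_lt, k, true).
have [_ ->] := z_factor_mean (Ordinal l0_lt, k, false).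
rewrite /height /winding /= h0 -/S eqxx mul1r mulr1 /winding_term SE.
rewrite [X in _ + X](_ : _ = 0) ?addr0; last first.
  (* The exponents A of the factors sum to the sum of the [a i], so one of them is nonnegative, and
     its integral around 1 vanishes. *)
  have [i A_ge0] : exists i, 0 <= a i + S - N%:Z * ((k i)%:Z - m%:Z).
    apply: contrapT => neg; have : \sum_i (a i + S - N%:Z * ((k i)%:Z - m%:Z)) < 0.
      rewrite (bigD1 (Ordinal N_gt0)) //= -[ltRHS]addr0; apply: ltr_leD.
        by rewrite ltNge; apply/negP => h; apply: neg; exists (Ordinal N_gt0).
      apply: sumr_le0 => i _; rewrite leNgt; apply/negP => h; apply: neg.
      by exists i; exact: ltW.
    rewrite !big_split /= sumrN -mulr_sumr -/S sumr_const card_ord -mulr_natl natz.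
    by rewrite addrK ltNge a_ge0.
  have [_] := monomial_branch_near1 r_ge2 e1_gt0 e1_le e2_gt0 e2_le ((k i)%:Z - m%:Z)
    (a i + S - N%:Z * ((k i)%:Z - m%:Z)) (b i - L%:Z * ((k i)%:Z - m%:Z)).
  move=> /(_ A_ge0) mean0.
  have factor0 : Jw (w_factor (Ordinal l0_lt, k, false) i) = 0.
    by rewrite -[RHS]mean0 /w_factor valK /height /winding /= h0.
  by rewrite (bigD1 i) //= factor0 mul0r mulr0.
congr (_ * _); apply: eq_bigr => i _; rewrite /box_point ffunE.
have [_ <-] := monomial_branch r_ge2 e1_gt0 e1_le e2_gt0 e2_le ((k i)%:Z - m%:Z)
  (a i + S - N%:Z * ((k i)%:Z - m%:Z)) (b i - L%:Z * ((k i)%:Z - m%:Z)).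
rewrite /w_factor valK /height /winding /= h0.
by under eq_fun do rewrite mulr1.
Qed.

Lemma truncated_tensor : exists (I : finType) (cz : I -> C -> C) (g : I -> nat -> C -> C),
  [/\ forall t, adm_z R' e' (cz t), forall t i, adm_w r e1 e2 (g t i),
      forall z ws, onz z -> on_power onw ws ->
        truncated_kernel m a b z ws = z_tensor_sum cz g z ws &
      0 <= \sum_i a i -> \sum_t Jz (cz t) * \prod_(i < N) Jw (g t i)
        = winding_sum L (big_mean r) c m a b].
Proof.
exists index, z_factor, w_factor; split; last exact: truncated_integral.
- by move=> t; have [] := z_factor_mean t.
- exact: w_factor_admissible.
- exact: truncated_kernelE.
Qed.
End Truncation.

Lemma kernel_approximable a b :
  z_approximable onw (adm_w r e1 e2) onz (adm_z R' e') (kernel a b).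
Proof.
move=> e /(kernel_limit a b)[m hm].
have [I [cz [g [cz_ad g_ad fE _]]]] := truncated_tensor m a b.
by exists I, cz, g; split=> // z ws hz hw; rewrite -fE // hm.
Qed.

Lemma kernel_integral_limit a b e : 0 <= \sum_i a i -> 0 < e ->
  exists m0, forall m, (m0 <= m)%N ->
    normc (total_integral Jw Jz (kernel a b) - winding_sum L (big_mean r) c m a b) <= e.
Proof.
move=> a_ge0 e_gt0.
have [Kw Fw] := functional_w r_ge2 e1_gt0 e2_gt0 e2_le.
have [Kz Fz] := functional_z R'_ge2 e'_gt0.
have S_gt0 : 0 < Kz * Kw ^+ N + 1.
  by rewrite ltr_wpDl // mulr_ge0 ?exprn_ge0 ?(cf_ge0 Fw) ?(cf_ge0 Fz).
have d_gt0 : 0 < e / (Kz * Kw ^+ N + 1) by rewrite divr_gt0.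
have [m0 hm0] := kernel_limit a b d_gt0; exists m0 => m le_m.
have [I [cz [g [cz_ad g_ad fE <- //]]]] := truncated_tensor m a b.
apply: le_trans (total_integral_approx Fw Fz (kernel_approximable a b) cz_ad g_ad _) _.
  by move=> z ws hz hw; rewrite -fE //; exact: hm0.
rewrite mulrA mulrCA ger_pMr // ler_pdivrMr // mul1r lerDl.
exact: ler01.
Qed.
End Expansion.

(** * Bethe functions under the free evolution *)

Lemma addrBACA (V : zmodType) (a b c d : V) : a + b - (c + d) = a - c + (b - d).
Proof. by rewrite opprD addrACA. Qed.

Section BetheFunctions.
Variables (R : realType) (N L : nat) (c : R[i]) (r e1 e2 R' e' : R).
Local Notation C := R[i].
Hypotheses (r_ge2 : 2 <= r) (e1_gt0 : 0 < e1) (e1_le : e1 <= 4^-1).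
Hypotheses (e2_gt0 : 0 < e2) (e2_le : e2 <= 4^-1).
Hypotheses (R'_ge2 : 2 <= R') (e'_gt0 : 0 < e') (e'_le : e' <= 4^-1).
Hypotheses (N_gt0 : (0 < N)%N) (ltNL : (N < L)%N) (c_neq0 : c != 0).

Local Notation onw := (on_w r e1 e2).
Local Notation onz := (on_z R' e').
Local Notation admw := (adm_w r e1 e2).
Local Notation admz := (adm_z R' e').
Local Notation Jw := (mean_w r e1 e2).
Local Notation Jz := (mean_z R' e').

Hypothesis q_dominated : forall z w, onz z -> onw w -> dominated (is_big r w) (q_ratio N L z w).
Hypothesis p_dominated : forall z (ws : N.-tuple C), onz z -> on_power onw ws ->
  dominated (p_branch e2 R' z ws) (p_ratio L c z ws).

Let L_gt0 : (0 < L)%N. Proof. exact: leq_ltn_trans ltNL. Qed.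

Local Notation app := (z_approximable onw admw onz admz).
Local Notation Tot := (total_integral Jw Jz).
Local Notation ker := (@kernel R N L c).

Let kernel_app a b : app (ker a b).
Proof. exact: kernel_approximable. Qed.

Let big_mean_low A B : B < 0 -> big_mean r A B = 0.
Proof. exact: (big_mean_neg r_ge2 e1_gt0 e1_le e2_gt0 e2_le). Qed.

Lemma big_mean_gap A B : 0 <= A -> A < B -> big_mean r A B = 0.
Proof. by case: A => // n _ h; rewrite (big_mean_nat r_ge2 e1_gt0 e1_le e2_gt0 e2_le) // h orbT. Qed.

Lemma kernel_integral_boundary a b i :
  Tot (ker (bump_at a i 1) b) = Tot (ker a b) - Tot (ker a (bump_at b i (-1))).
Proof.
have [Kw Fw] := functional_w r_ge2 e1_gt0 e2_gt0 e2_le.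
have [Kz Fz] := functional_z R'_ge2 e'_gt0.
transitivity (- 1 * Tot (ker a (bump_at b i (-1))) + Tot (ker a b)); last by rewrite mulN1r addrC.
rewrite -(total_integral_linear Fw Fz (-1) (kernel_app _ _) (kernel_app _ _)).
apply: (total_integral_ext Fw Fz) => // z ws hz hw.
have w_neq j := on_w_neq r_ge2 e1_gt0 e1_le e2_gt0 e2_le (hw j).
rewrite /kernel; move: ((1 - p_ratio L c z ws)^-1 * _) => k.
rewrite mulrA -mulrDl; congr (_ * _).
pose rest := \prod_(j < N | j != i) monomial (a j) (b j) (tnth ws j).
have restE (u v : 'I_N -> int) : (forall j, j != i -> u j = a j) ->
    (forall j, j != i -> v j = b j) ->
    \prod_j monomial (u j) (v j) (tnth ws j) = monomial (u i) (v i) (tnth ws i) * rest.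
  move=> ua vb; rewrite (bigD1 i) //=; congr (_ * _).
  by apply: eq_bigr => j ne; rewrite ua ?vb.
have off (u : 'I_N -> int) d j : j != i -> bump_at u i d j = u j.
  by move=> /negPf ne; rewrite /bump_at ne mul0r addr0.
rewrite !restE //; try by move=> j; exact: off.
rewrite mulrA -mulrDl /bump_at !eqxx !mul1r; congr (_ * _).
by apply: monomial_pascal; have [] := w_neq i.
Qed.

(** Both integrals are limits of winding sums, which satisfy the identity exactly once the box is
    large. *)
Lemma kernel_integral_rotate a b i : 0 <= \sum_i a i ->
  c * Tot (ker (fun j => a j + 1 - (j == i)%:R * N%:Z) (fun j => b j - (j == i)%:R * L%:Z))
  = Tot (ker a b).
Proof.
move=> a_ge0; set a' := (fun j => _); set b' := (fun j => _).
have a'_ge0 : 0 <= \sum_j a' j.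
  rewrite /a' sumrB big_split /= sumr_const card_ord natz.
  suff -> : \sum_j (j == i)%:R * N%:Z = N%:Z by rewrite addrK.
  by rewrite (bigD1 i) //= eqxx mul1r big1 ?addr0 // => j /negPf ->; rewrite mul0r.
apply/eqP; rewrite -subr_eq0 -[_ == _]negbK -normc_gt0 -leNgt.
apply/ler_addgt0Pr => e e_gt0; rewrite add0r.
have nc_ge0 := normc_ge0 c.
have S_gt0 : 0 < normc c + 1 by rewrite ltr_wpDl.
have d_gt0 : 0 < e / (normc c + 1) by rewrite divr_gt0.
have limit := kernel_integral_limit r_ge2 e1_gt0 e1_le e2_gt0 e2_le R'_ge2 e'_gt0 e'_le
  N_gt0 L_gt0 c_neq0 q_dominated p_dominated.
have [m1 h1] := limit a' b' _ a'_ge0 d_gt0; have [m2 h2] := limit a b _ a_ge0 d_gt0.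
have [m3 h3] := winding_sum_shift N_gt0 ltNL c_neq0 big_mean_low
  big_mean_gap b i a_ge0.
pose m := maxn m1 (maxn m2 m3).
have := h1 m (leq_maxl _ _); have := h2 m _; have := h3 m _.
rewrite !leq_max !leqnn !orbT => /(_ isT) + /(_ isT); rewrite -/a' -/b'.
move: (winding_sum _ _ _ _ a' b') (winding_sum _ _ _ _ a b) (Tot (ker a' b')) (Tot (ker a b)).
move=> u v T' T0 <- {}h2 {}h1.
have -> : c * T' - T0 = c * (T' - u) - (T0 - c * u) by ring.
apply: le_trans (le_normcD _ _) _; rewrite normcN normcM.
apply: le_trans (lerD (ler_wpM2l nc_ge0 h1) h2) _.
by rewrite -[X in _ + X]mul1r -mulrDl mulrC divfK // gt_eqF.
Qed.

Lemma kernel_integral_initial (x y : 'I_N -> int) :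
    cyclically_increasing L x -> cyclically_increasing L y ->
    (forall i, 0 <= x i < L%:Z) -> (forall i, 0 <= y i < L%:Z) ->
  \sum_(tau : 'S_N) (-1) ^+ tau * Tot (ker (fun i => i%:Z - (tau i)%:Z) (fun i => y i - x (tau i)))
  = [forall i, x i == y i]%:R.
Proof.
move=> x_cyc y_cyc x_bd y_bd.
apply/eqP; rewrite -subr_eq0 -[_ == _]negbK -normc_gt0 -leNgt.
apply/ler_addgt0Pr => e e_gt0; rewrite add0r.
have d_gt0 : 0 < e / #|{: 'S_N}|%:R.
  by rewrite divr_gt0 // ltr0n; apply/card_gt0P; exists 1%g.
have sum_a (tau : 'S_N) : 0 <= \sum_(i < N) (i%:Z - (tau i)%:Z).
  rewrite sumrB [X in _ - X](reindex_inj (@perm_inj _ (tau^-1)%g)) /=.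
  by under [X in _ - X]eq_bigr do rewrite permKV; rewrite subrr.
have limit := kernel_integral_limit r_ge2 e1_gt0 e1_le e2_gt0 e2_le R'_ge2 e'_gt0 e'_le
  N_gt0 L_gt0 c_neq0 q_dominated p_dominated.
have [M hM] := choice (fun tau : 'S_N => limit (fun i : 'I_N => i%:Z - (tau i)%:Z)
  (fun i => y i - x (tau i)) _ (sum_a tau) d_gt0).
(* The successor keeps the box nonempty, so that it contains k = 0. *)
pose m := (\max_tau M tau).+1.
rewrite -(winding_sum_initial N_gt0 ltNL c_neq0 big_mean_low
  big_mean_gap (big_mean00 r_ge2) (ltn0Sn (\max_tau M tau)) x_cyc y_cyc x_bd y_bd) -/m.
rewrite -sumrB; apply: le_trans (normc_sum _ _) _.
apply: le_trans (_ : \sum_(tau : 'S_N) e / #|{: 'S_N}|%:R <= _).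
  apply: ler_sum => tau _; rewrite -mulrBr normcM normcX normcN normc1 expr1n mul1r.
  by apply: hM; rewrite ltnW // ltnS leq_bigmax.
have card0 : #|{: 'S_N}|%:R != 0 :> R by rewrite pnatr_eq0 -lt0n; apply/card_gt0P; exists 1%g.
by rewrite sumr_const -[leLHS]mulr_natr divfK.
Qed.

Variables (s p q : C).
(** m Euler steps of size s of the free evolution, acting on the exponents b only. *)
Fixpoint bethe_fun (m : nat) (a b : 'I_N -> int) : C :=
  if m is m'.+1 then
    bethe_fun m' a b + s * \sum_i (p * bethe_fun m' a (bump_at b i 1)
      + q * bethe_fun m' a (bump_at b i (-1)) - bethe_fun m' a b)
  else Tot (ker a b).

Lemma bump_atC (b : 'I_N -> int) i j d d' :
  bump_at (bump_at b i d) j d' = bump_at (bump_at b j d') i d.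
Proof. by apply/funext => k; rewrite /bump_at addrAC. Qed.

Lemma bethe_fun_boundary m a b i :
  bethe_fun m (bump_at a i 1) b = bethe_fun m a b - bethe_fun m a (bump_at b i (-1)).
Proof.
elim: m b => [|m IH] b /=; first exact: kernel_integral_boundary.
rewrite IH addrBACA -mulrBr -sumrB; congr (_ + s * _); apply: eq_bigr => j _.
rewrite !IH ![bump_at (bump_at b i _) j _]bump_atC.
move: (bethe_fun _ _ _) (bethe_fun _ _ (bump_at (bump_at b j 1) _ _))
  (bethe_fun _ _ (bump_at b i (-1))) (bethe_fun _ _ (bump_at b j (-1)))
  (bethe_fun _ _ (bump_at b j 1)) (bethe_fun m a b) => u1 u2 u3 u4 u5 u6; ring.
Qed.

Lemma bethe_fun_rotate m a b i : 0 <= \sum_i a i ->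
  c * bethe_fun m (fun j => a j + 1 - (j == i)%:R * N%:Z) (fun j => b j - (j == i)%:R * L%:Z)
  = bethe_fun m a b.
Proof.
move=> a_ge0; elim: m b => [|m IH] b /=; first exact: kernel_integral_rotate.
rewrite mulrDr IH mulrCA mulr_sumr; congr (_ + s * _); apply: eq_bigr => k _.
have shift d : bump_at (fun j => b j - (j == i)%:R * L%:Z) k d
    = (fun j => bump_at b k d j - (j == i)%:R * L%:Z).
  by apply/funext => j; rewrite /bump_at addrAC.
by rewrite !shift mulrBr mulrDr !(mulrCA c) !IH.
Qed.

Definition energy (ws : N.-tuple C) : C :=
  \sum_(i < N) (p * tnth ws i + q * (tnth ws i)^-1 - 1).

Let Kw_ex := functional_w r_ge2 e1_gt0 e2_gt0 e2_le.
Let Kz_ex := functional_z R'_ge2 e'_gt0.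

Lemma energy_approximable : app (fun _ ws => energy ws).
Proof.
have [Kw Fw] := Kw_ex; have [Kz Fz] := Kz_ex.
have mono B : admw (monomial 0 B) := monomial_w r_ge2 e1_gt0 e1_le e2_gt0 e2_le 0 B.
apply: (z_approximable_sum Fw Fz) => i.
pose g (w : C) := p * monomial 0 1 w + q * monomial 0 (-1) w - 1.
have -> : (fun (z : C) (ws : N.-tuple C) => p * tnth ws i + q * (tnth ws i)^-1 - 1)
    = (fun _ ws => g (tnth ws i)).
  by apply/funext => z; apply/funext => ws; rewrite /g /monomial expr0z !mulr1.
apply: (z_approximable_w Fw Fz); apply: (cf_add Fw); last exact: (cf_cst Fw).
by apply: (cf_add Fw); apply: (cf_mul Fw) => //; exact: (cf_cst Fw).
Qed.

Lemma step_approximable m : app (fun _ ws => (1 + s * energy ws) ^+ m).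
Proof.
have [Kw Fw] := Kw_ex; have [Kz Fz] := Kz_ex.
elim: m => [|m IH]; first exact: (z_approximable_cst Fw Fz).
under eq_fun do under eq_fun do rewrite exprS.
apply: (z_approximableM Fw Fz) => //.
apply: (z_approximableD (f := fun _ _ => 1)); first exact: (z_approximable_cst Fw Fz).
by apply: (z_approximableZ Fw Fz); exact: energy_approximable.
Qed.

Lemma kernel_bump (a b : 'I_N -> int) (i : 'I_N) (d : int) z ws : tnth ws i != 0 ->
  ker a (bump_at b i d) z ws = tnth ws i ^ d * ker a b z ws.
Proof.
move=> wi0; rewrite /kernel [RHS]mulrA; congr (_ * _).
rewrite (bigD1 i) //= [in RHS](bigD1 i) //= mulrA; congr (_ * _).
  by rewrite /bump_at eqxx mul1r /monomial expfzDr // mulrA [_ ^ d * _]mulrC.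
by apply: eq_bigr => j /negPf ne; rewrite /bump_at ne mul0r addr0.
Qed.

(** Bumping b at i multiplies the integrand by a power of w_i, so each Euler step multiplies it by 1
    + s E. *)
Lemma bethe_fun_integral m a b :
  bethe_fun m a b = Tot (fun z ws => ker a b z ws * (1 + s * energy ws) ^+ m).
Proof.
have [Kw Fw] := Kw_ex; have [Kz Fz] := Kz_ex.
elim: m b => [|m IH] b /=.
  by congr total_integral; apply/funext => z; apply/funext => ws; rewrite mulr1.
pose X m b z ws := ker a b z ws * (1 + s * energy ws) ^+ m.
have X_app b' : app (X m b').
  by apply: (z_approximableM Fw Fz); [exact: kernel_app|exact: step_approximable].
pose Y i z ws := p * X m (bump_at b i 1) z ws +
  (q * X m (bump_at b i (-1)) z ws + (- 1 * X m b z ws + 0)).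
have cst0 := z_approximable_cst Fw Fz N 0.
have scale k (f g : C -> N.-tuple C -> C) : app f -> app g -> app (fun z ws => k * f z ws + g z ws).
  by move=> hf; apply: z_approximableD; exact: (z_approximableZ Fw Fz).
have Y_app i : app (Y i) := scale _ _ _ (X_app _) (scale _ _ _ (X_app _) (scale _ _ _ (X_app _) cst0)).
have {}IH b' : bethe_fun m a b' = Tot (X m b') := IH b'.
transitivity (Tot (fun z ws => s * (\sum_i Y i z ws) + X m b z ws)).
  rewrite (total_integral_linear Fw Fz) ?(total_integral_sum Fw Fz) //; last exact: (z_approximable_sum Fw Fz).
  rewrite IH addrC; congr (s * _ + _); apply: eq_bigr => i _.
  rewrite (total_integral_linear Fw Fz p (X_app _) (scale _ _ _ (X_app _) (scale _ _ _ (X_app _) cst0))).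
  rewrite (total_integral_linear Fw Fz q (X_app _) (scale _ _ _ (X_app _) cst0)).
  rewrite (total_integral_linear Fw Fz (-1) (X_app _) cst0).
  rewrite (total_integral0 Fw Fz) !IH; move: (Tot _) (Tot (X _ (bump_at b i 1))) (Tot (X _ (bump_at b i (-1)))).
  by move=> u u1 u2; rewrite addr0 mulN1r addrA.
apply: (total_integral_ext Fw Fz) => [z ws hz hw|]; last first.
  apply: scale => //; exact: (z_approximable_sum Fw Fz).
have w_neq i := on_w_neq r_ge2 e1_gt0 e1_le e2_gt0 e2_le (hw i).
have YE i : Y i z ws = (p * tnth ws i + q * (tnth ws i)^-1 - 1) * X m b z ws.
  have [wi0 _] := w_neq i; rewrite /Y /X !kernel_bump // expr1z exprN1.
  move: (ker _ _ _ _) ((1 + _) ^+ m) (tnth ws i) (tnth ws i)^-1 => k e w w'; ring.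
have -> : \sum_i Y i z ws = energy ws * X m b z ws.
  by rewrite mulr_suml; apply: eq_bigr => i _; exact: YE.
rewrite /X exprS.
move: (energy ws) (ker _ _ _ _) ((1 + s * energy ws) ^+ m) => E k e; ring.
Qed.
End BetheFunctions.

(** * The complex exponential as a limit of powers *)

Section ComplexExponential.
Variable R : realType.
Local Notation C := R[i].

Lemma mean_value_bound (f df : R -> R) (b K : R) :
    (forall x : R, is_derive x (1 : R) f (df x)) -> (forall x, `|x| <= `|b| -> `|df x| <= K) ->
  `|f b - f 0| <= K * `|b|.
Proof.
move=> f_der df_le.
have f_cont : continuous f.
  by move=> x; apply: differentiable_continuous; apply/derivable1_diffP; have [] := f_der x.
have within (a c : R) : {within `[a, c], continuous f} by exact: continuous_subspaceT.
have [b_ge0|b_le0] := leP 0 b.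
  have [c cb ->] := MVT_segment b_ge0 (fun x _ => f_der x) (within 0 b).
  rewrite subr0 normrM ler_wpM2r // df_le //.
  by move: cb; rewrite in_itv /= => /andP[c_ge0 c_le]; rewrite !ger0_norm.
have [c cb e] := MVT_segment (ltW b_le0) (fun x _ => f_der x) (within b 0).
rewrite distrC e sub0r normrM normrN ler_wpM2r // df_le //.
move: cb; rewrite in_itv /= => /andP[c_ge c_le0].
by rewrite (ler0_norm c_le0) (ltr0_norm b_le0) lerN2.
Qed.

Lemma normr_sin_le (b : R) : `|sin b| <= `|b|.
Proof.
have := @mean_value_bound sin cos b 1 (fun x => is_derive_sin x) (fun x _ => cos_max x).
by rewrite sin0 subr0 mul1r.
Qed.

Lemma normr_cosB1_le (b : R) : `|cos b - 1| <= b ^+ 2.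
Proof.
rewrite -real_normK ?num_real // expr2 -[in X in `|_ - X|]cos0.
apply: (mean_value_bound (df := fun x => - sin x)) => x xb.
by rewrite normrN; apply: le_trans (normr_sin_le _) xb.
Qed.

Lemma normr_sinB_le (b : R) : `|b| <= 1 -> `|sin b - b| <= b ^+ 2.
Proof.
move=> b1; have := @mean_value_bound (fun x => sin x - x) (fun x => cos x - 1) b (b ^+ 2).
rewrite sin0 !subr0 => h; apply: le_trans (h _ _) _.
- move=> x xb; apply: le_trans (normr_cosB1_le _) _.
  by rewrite -real_normK ?num_real // -[leRHS]real_normK ?num_real // lerXn2r ?nnegrE.
- by rewrite ler_piMr ?sqr_ge0.
Qed.

Lemma expRB1B_le (a : R) : `|a| <= 2^-1 -> `|expR a - 1 - a| <= 2 * a ^+ 2.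
Proof.
rewrite ler_norml => /andP[a_ge a_le].
have h1 := expR_ge1Dx a; have h2 := expR_ge1Dx (- a).
have e_gt0 := expR_gt0 a; rewrite expRN in h2.
have h3 : expR a * (1 - a) <= 1.
  have e_neq0 : expR a != 0 by rewrite gt_eqF.
  by rewrite -[leRHS](mulfV e_neq0) (ler_wpM2l (ltW e_gt0)).
rewrite ger0_norm; last by rewrite -addrA -opprD subr_ge0.
by move: (expR a) h1 h3 => e h1 h3; nra.
Qed.

Lemma cexpD (x y : C) : cexp (x + y) = cexp x * cexp y.
Proof.
case: x => a b; case: y => c d; rewrite /cexp /= expRD cosD sinD.
by apply: complex_ext => /=; ring.
Qed.

Lemma cexpX (x : C) n : cexp (n%:R * x) = cexp x ^+ n.
Proof.
elim: n => [|n IH].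
  by rewrite mul0r expr0 /cexp /= expR0 cos0 sin0; apply: complex_ext => /=; ring.
by rewrite -natr1 mulrDl mul1r cexpD IH exprSr.
Qed.

Lemma normc_cexp (x : C) : normc (cexp x) <= expR (normc x).
Proof.
rewrite /cexp normcM normc_real ger0_norm ?expR_ge0 //.
have -> : normc (cos (complex.Im x) +i* sin (complex.Im x)) = 1 by rewrite /= cos2Dsin2 sqrtr1.
by rewrite mulr1 ler_expR (le_trans (ler_norm _)) // normc_Re.
Qed.

Lemma cexp_taylor (y : C) (d : R) : normc y <= d -> d <= 2^-1 ->
  normc (cexp y - (1 + y)) <= 8 * d ^+ 2.
Proof.
move=> yd d_le; have ra := le_trans (normc_Re y) yd; have rb := le_trans (normc_Im y) yd.
apply: le_trans (normc_le_ReIm _) _; case: y {yd} ra rb => a b /= ra rb.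
have a_half := le_trans ra d_le; have b_half := le_trans rb d_le.
have := expRB1B_le a_half; have := normr_cosB1_le b.
have := normr_sinB_le (le_trans b_half (_ : 2^-1 <= 1)).
have := normr_sin_le b; have := cos_max b.
rewrite invf_le1 // ler1n => hc hs /(_ isT) hsb hcb he.
have d_ge0 : 0 <= d := le_trans (normr_ge0 a) ra.
have a2 : a ^+ 2 <= d ^+ 2.
  by rewrite -real_normK ?num_real // lerXn2r ?nnegrE.
have b2 : b ^+ 2 <= d ^+ 2.
  by rewrite -real_normK ?num_real // lerXn2r ?nnegrE.
move: (expR a) (cos b) (sin b) hc hs hsb hcb he => e u v hc hs hsb hcb he.
have re : `|e * u - 0 * v - (1 + a)| <= 4 * d ^+ 2.
  have -> : e * u - 0 * v - (1 + a) = (e - 1 - a) * u + (1 + a) * (u - 1) by ring.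
  apply: le_trans (ler_normD _ _) _; rewrite !normrM.
  have h1 : `|e - 1 - a| * `|u| <= 2 * d ^+ 2 * 1.
    by apply: ler_pM => //; apply: le_trans he _; rewrite ler_pM2l.
  have h2 : `|1 + a| * `|u - 1| <= 2 * d ^+ 2.
    apply: ler_pM => //; last exact: le_trans hcb _.
    by apply: le_trans (ler_normD _ _) _; rewrite normr1; lra.
  by lra.
have im : `|e * v + 0 * u - (0 + b)| <= 4 * d ^+ 2.
  have -> : e * v + 0 * u - (0 + b) = (e - 1 - a) * v + a * v + (v - b) by ring.
  have e1 : `|e - 1 - a| * `|v| <= 2 * d ^+ 2 * 1.
    by apply: ler_pM => //; [apply: le_trans he _; rewrite ler_pM2l|lra].
  have e2 : `|a| * `|v| <= d * d by apply: ler_pM => //; apply: le_trans hs rb.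
  apply: le_trans (ler_normD _ _) _; apply: le_trans (lerD (ler_normD _ _) (lexx _)) _.
  by rewrite !normrM; move: e1 e2 hsb b2; rewrite -expr2; lra.
by have := lerD re im; rewrite -mulrDl; congr (_ <= _ * _); lra.
Qed.

Lemma normc_expB (u v : C) (K : R) n : 1 <= K -> normc u <= K -> normc v <= K ->
  normc (u ^+ n - v ^+ n) <= n%:R * normc (u - v) * K ^+ n.
Proof.
move=> K_ge1 hu hv; have K_ge0 : 0 <= K by exact: le_trans K_ge1.
have d_ge0 := normc_ge0 (u - v).
elim: n => [|n IH]; first by rewrite subrr normc0 !mul0r.
have -> : u ^+ n.+1 - v ^+ n.+1 = u * (u ^+ n - v ^+ n) + (u - v) * v ^+ n.
  by rewrite !exprS; ring.
apply: le_trans (le_normcD _ _) _; rewrite !normcM -natr1 !mulrDl mul1r; apply: lerD.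
  have -> : n%:R * normc (u - v) * K ^+ n.+1 = K * (n%:R * normc (u - v) * K ^+ n).
    by rewrite exprS; ring.
  by apply: ler_pM => //; exact: normc_ge0.
rewrite ler_wpM2l // normcX; apply: le_trans (_ : K ^+ n <= _).
  by rewrite lerXn2r ?nnegrE ?normc_ge0.
by rewrite exprS ler_peMl ?exprn_ge0.
Qed.

(** Both sides are (n + 1)-st powers; their bases differ by at most 8 (M/(n+1))^2, and n + 1 such
    errors add up, amplified by at most e^M. *)
Lemma cexp_limit (v : C) (M : R) n : normc v <= M -> 2 * M <= n.+1%:R ->
  normc (cexp v - (1 + v / n.+1%:R) ^+ n.+1) <= 8 * M ^+ 2 * expR M / n.+1%:R.
Proof.
move=> vM nM; have n_gt0 : 0 < n.+1%:R :> R by [].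
have n_neq0 : n.+1%:R != 0 :> C by rewrite pnatr_eq0.
have M_ge0 : 0 <= M := le_trans (normc_ge0 v) vM.
pose d := M / n.+1%:R; have d_ge0 : 0 <= d by rewrite divr_ge0.
have d_le : d <= 2^-1 by rewrite ler_pdivrMr // mulrC ler_pdivlMr // mulrC.
have yd : normc (v / n.+1%:R) <= d.
  rewrite normcM normcV -(rmorph_nat (real_complex R)) normc_real ger0_norm //.
  by rewrite ler_wpM2r ?invr_ge0.
have -> : cexp v = cexp (v / n.+1%:R) ^+ n.+1 by rewrite -cexpX mulrC divfK.
have powers := @normc_expB (cexp (v / n.+1%:R)) (1 + v / n.+1%:R) (expR d) n.+1.
apply: le_trans (powers _ _ _) _.
- by apply: le_trans (expR_ge1Dx d); rewrite lerDl.
- by apply: le_trans (normc_cexp _) _; rewrite ler_expR.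
- apply: le_trans (le_normcD _ _) _; rewrite normc1.
  by apply: le_trans (expR_ge1Dx d); rewrite lerD2l.
rewrite -expRM_natl; have -> : n.+1%:R * d = M by rewrite mulrC divfK // gt_eqF.
have := cexp_taylor yd d_le; move: (normc _) => w hw.
have -> : 8 * M ^+ 2 * expR M / n.+1%:R = n.+1%:R * (8 * d ^+ 2) * expR M.
  by rewrite /d; field; rewrite gt_eqF.
by rewrite ler_wpM2r ?expR_ge0 // ler_wpM2l.
Qed.
End ComplexExponential.

(** * Sizes of the ratios on the contours *)

Section ContourEstimates.
Variables (R : realType) (N L : nat) (c : R[i]) (r e1 e2 e : R).
Local Notation C := R[i].
Hypotheses (r_ge2 : 2 <= r) (e1_gt0 : 0 < e1) (e1_le : e1 <= 4^-1).
Hypotheses (e2_gt0 : 0 < e2) (e2_le : e2 <= 4^-1).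
Hypotheses (e_gt0 : 0 < e) (e_le : e <= 4^-1).
Hypotheses (N_gt0 : (0 < N)%N) (ltNL : (N < L)%N) (normc_c : normc c = 1).

(** Crude bounds on w and 1 - 1/w cost factors up to 2^(L+N); this threshold leaves 1/2 after paying
    for them. *)
Let d : R := (2 ^+ (L + N).+1)^-1.
Hypotheses (big_small : r^-1 ^+ L / e ^+ L <= d) (zero_small : e1 ^+ (L - N) / e ^+ L <= d).
Hypotheses (one_small : e2 ^+ N / e ^+ L <= d) (far_small : e ^+ L / e1 ^+ N <= d).
Hypothesis near_small : e ^+ L / e2 ^+ N.-1 <= d.

Local Notation onw := (on_w r e1 e2).
Local Notation onz := (on_z e^-1 e).

Lemma inv_small_ge2 : 2 <= e^-1.
Proof. by rewrite -[2]invrK lef_pV2 ?posrE ?invr_gt0 //; move: e_le; lra. Qed.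

Let pow2_half (k : nat) (x : R) : (k <= L + N)%N -> x <= d -> 2 ^+ k * x <= 2^-1.
Proof.
move=> k_le x_le; apply: le_trans (_ : 2 ^+ k * d <= _); first by rewrite ler_pM2l ?exprn_gt0.
rewrite /d exprS invfM mulrCA ler_piMr ?invr_ge0 // ler_pdivrMr ?exprn_gt0 // mul1r.
by rewrite ler_eXn2l // ltr1n.
Qed.

Lemma on_z_norm z : onz z -> e <= normc z <= e^-1.
Proof.
have e_le1 : e <= e^-1 by apply: le_trans inv_small_ge2; move: e_le; lra.
case=> hz; first by rewrite (on_big_norm inv_small_ge2 hz) e_le1 lexx.
by rewrite (on_zero_norm e_gt0 hz) lexx.
Qed.

Lemma normc_q_ratio (z w : C) : normc (q_ratio N L z w)
  = normc z ^+ L / (normc w ^+ L * normc (1 - w^-1) ^+ N).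
Proof.
by rewrite /q_ratio /monomial !normcM !normc_exprz -!exprnN invfM.
Qed.

(** Up to powers of 2, the ratio is at most e^-L r^-L on the large circle, where beta > 1 is used;
    its inverse is at most e1^(L-N) e^-L near 0 and e2^N e^-L near 1, which call for the lower
    bounds on beta1 and beta2. *)
Lemma q_ratio_dominated z w : onz z -> onw w -> dominated (is_big r w) (q_ratio N L z w).
Proof.
move=> hz hw; have [w0 w1] := on_w_neq r_ge2 e1_gt0 e1_le e2_gt0 e2_le hw.
have v0 : 1 - w^-1 != 0 by rewrite subr_eq0 eq_sym invr_eq1.
have /andP[z_ge z_le] := on_z_norm hz.
have z_gt0 : 0 < normc z by exact: lt_le_trans z_ge.
have z0 : z != 0 by rewrite -normc_gt0.
split; first by rewrite /q_ratio /monomial !mulf_neq0 // expfz_neq0.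
case: hw => [[]|] hw.
- have [-> _] := on_w_big r_ge2 e2_le hw.
  rewrite normc_q_ratio (on_big_norm r_ge2 hw); have /andP[v_ge _] := big_sub_inv r_ge2 hw.
  have r_gt0 : 0 < r by exact: lt_le_trans r_ge2.
  apply: le_trans (pow2_half (leq_addl L N) big_small).
  have -> : 2 ^+ N * (r^-1 ^+ L / e ^+ L) = (e^-1) ^+ L / (r ^+ L * 2^-1 ^+ N).
    by rewrite invfM -!exprVn invrK; ring.
  apply: ler_pM; rewrite ?exprn_ge0 ?invr_ge0 ?mulr_ge0 ?exprn_ge0 ?(ltW r_gt0) ?normc_ge0 //.
    by rewrite lerXn2r ?nnegrE ?normc_ge0 ?invr_ge0 ?(ltW e_gt0).
  rewrite lef_pV2 ?posrE ?mulr_gt0 ?exprn_gt0 ?invr_gt0 ?normc_gt0 //.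
  by rewrite ler_wpM2l ?exprn_ge0 ?(ltW r_gt0) // lerXn2r ?nnegrE ?normc_ge0 ?invr_ge0.
- have [-> _] := on_w_zero r_ge2 e1_gt0 e1_le e2_le hw.
  rewrite normcV normc_q_ratio (on_zero_norm e1_gt0 hw) invf_div.
  have /andP[_ v_le] := zero_sub_inv e1_gt0 e1_le hw.
  apply: le_trans (pow2_half (leq_addl L N) zero_small).
  have -> : 2 ^+ N * (e1 ^+ (L - N) / e ^+ L) = (e1 ^+ L * (2 / e1) ^+ N) / e ^+ L.
    have -> : e1 ^+ L = e1 ^+ (L - N) * e1 ^+ N by rewrite -exprD subnK // ltnW.
    rewrite expr_div_n; move: (e1 ^+ (L - N)) => u; field.
    by rewrite !expf_neq0 ?gt_eqF.
  apply: ler_pM; rewrite ?exprn_ge0 ?invr_ge0 ?mulr_ge0 ?exprn_ge0 ?(ltW e1_gt0) ?normc_ge0 //.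
    by rewrite ler_wpM2l ?exprn_ge0 ?(ltW e1_gt0) // lerXn2r ?nnegrE ?normc_ge0 ?divr_ge0 ?(ltW e1_gt0).
  by rewrite lef_pV2 ?posrE ?exprn_gt0 // lerXn2r ?nnegrE ?normc_ge0 ?(ltW e_gt0).
- have [-> _] := on_w_one r_ge2 e2_gt0 e2_le hw.
  rewrite normcV normc_q_ratio invf_div; have /andP[_ w_le] := on_one_bounds e2_gt0 e2_le hw.
  have /andP[_ v_le] := one_sub_inv_bounds e2_gt0 e2_le hw.
  apply: le_trans (pow2_half (leqnn _) one_small).
  have -> : 2 ^+ (L + N) * (e2 ^+ N / e ^+ L) = (2 ^+ L * (2 * e2) ^+ N) / e ^+ L.
    by rewrite exprD exprMn; ring.
  apply: ler_pM; rewrite ?exprn_ge0 ?invr_ge0 ?mulr_ge0 ?exprn_ge0 ?normc_ge0 //.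
    apply: ler_pM; rewrite ?exprn_ge0 ?normc_ge0 // lerXn2r ?nnegrE ?normc_ge0 ?mulr_ge0 ?(ltW e2_gt0) //.
    by apply: le_trans w_le _; lra.
  by rewrite lef_pV2 ?posrE ?exprn_gt0 // lerXn2r ?nnegrE ?normc_ge0 ?(ltW e_gt0).
Qed.

Lemma normc_p_ratio z (ws : N.-tuple C) : normc (p_ratio L c z ws)
  = (\prod_(i < N) normc (1 - (tnth ws i)^-1)) / normc z ^+ L.
Proof.
by rewrite /p_ratio !normcM normc_c mul1r normc_exprz normc_prod mulrC -exprnN.
Qed.

Lemma prod_le_exp (f : 'I_N -> R) (K : R) : (forall i, 0 <= f i <= K) -> \prod_i f i <= K ^+ N.
Proof.
move=> fK; have -> : K ^+ N = \prod_(i < N) K by rewrite prodr_const card_ord.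
by apply: ler_prod => i _; exact: fK.
Qed.

(** For large z, each factor 1 - 1/w_i is at most 2/e1, which calls for beta1 < L/N. For small z
    with all w_i near 1 the product is at most (2 e2)^N. Otherwise one factor is at least 1/2 and
    the others at least e2/2, which calls for beta2 < L/(N-1). *)
Lemma p_ratio_dominated z (ws : N.-tuple C) : onz z -> on_power onw ws ->
  dominated (p_branch e2 e^-1 z ws) (p_ratio L c z ws).
Proof.
move=> hz hw; have w_neq i := on_w_neq r_ge2 e1_gt0 e1_le e2_gt0 e2_le (hw i).
pose v i := normc (1 - (tnth ws i)^-1).
have v_gt0 i : 0 < v i.
  by rewrite /v normc_gt0 subr_eq0 eq_sym invr_eq1; have [] := w_neq i.
have v_ge0 i := ltW (v_gt0 i).
have z0 := on_z_neq0 inv_small_ge2 e_gt0 hz.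
have inv_e1 : 4 <= e1^-1 by rewrite -[4]invrK lef_pV2 ?posrE ?invr_gt0.
have v_le i : v i <= 2 / e1.
  case: (hw i) => [[]|] h.
  - have /andP[_] := big_sub_inv r_ge2 h; rewrite -/(v i); move: inv_e1; lra.
  - by have /andP[_] := zero_sub_inv e1_gt0 e1_le h.
  - have /andP[_] := one_sub_inv_bounds e2_gt0 e2_le h; rewrite -/(v i).
    by move: inv_e1 e2_le; lra.
split.
  rewrite -normc_gt0 normc_p_ratio divr_gt0 ?exprn_gt0 ?normc_gt0 //.
  by apply: prodr_gt0 => i _; exact: v_gt0.
case: hz => hz.
  have zn := on_big_norm inv_small_ge2 hz; rewrite /p_branch /is_far zn eqxx /=.
  rewrite normc_p_ratio zn; apply: le_trans (pow2_half (leq_addl L N) far_small).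
  have -> : 2 ^+ N * (e ^+ L / e1 ^+ N) = (2 / e1) ^+ N / e^-1 ^+ L.
    by rewrite expr_div_n -exprVn invrK; ring.
  rewrite ler_wpM2r ?invr_ge0 ?exprn_ge0 ?invr_ge0 ?(ltW e_gt0) //.
  by apply: prod_le_exp => i; rewrite v_ge0 v_le.
have zn := on_zero_norm e_gt0 hz; rewrite /p_branch /is_far zn lt_eqF /=; last first.
  by apply: lt_le_trans inv_small_ge2; move: e_le; lra.
have near_le (i : 'I_N) : is_near1 e2 (tnth ws i) -> v i <= 2 * e2.
  case: (hw i) => [[]|] h.
  - by have [_ ->] := on_w_big r_ge2 e2_le h.
  - by have [_ ->] := on_w_zero r_ge2 e1_gt0 e1_le e2_le h.
  - by move=> _; have /andP[] := one_sub_inv_bounds e2_gt0 e2_le h.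
have far_ge (i : 'I_N) : ~~ is_near1 e2 (tnth ws i) -> 2^-1 <= v i.
  case: (hw i) => [[]|] h.
  - by move=> _; have /andP[] := big_sub_inv r_ge2 h.
  - move=> _; have /andP[h1 _] := zero_sub_inv e1_gt0 e1_le h; apply: le_trans h1.
    by rewrite invf_le1 // ler1n.
  - by have [_ ->] := on_w_one r_ge2 e2_gt0 e2_le h.
have v_ge i : e2 / 2 <= v i.
  case: (boolP (is_near1 e2 (tnth ws i))) => [|/far_ge]; last by move: e2_le; lra.
  case: (hw i) => [[]|] h.
  - by have [_ ->] := on_w_big r_ge2 e2_le h.
  - by have [_ ->] := on_w_zero r_ge2 e1_gt0 e1_le e2_le h.
  - by move=> _; have /andP[] := one_sub_inv_bounds e2_gt0 e2_le h.
case: (boolP [forall i, _]) => [/forallP near|].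
  rewrite normc_p_ratio zn; apply: le_trans (pow2_half (leq_addl L N) one_small).
  have -> : 2 ^+ N * (e2 ^+ N / e ^+ L) = (2 * e2) ^+ N / e ^+ L by rewrite exprMn mulrA.
  rewrite ler_wpM2r ?invr_ge0 ?exprn_ge0 ?(ltW e_gt0) //.
  by apply: prod_le_exp => i; rewrite v_ge0 near_le.
case/forallPn => i far; rewrite normcV normc_p_ratio zn invf_div.
apply: le_trans (pow2_half (leq_addl L N) near_small).
have -> : 2 ^+ N * (e ^+ L / e2 ^+ N.-1) = e ^+ L / (2^-1 * (e2 / 2) ^+ N.-1).
  rewrite -{1}(prednK N_gt0) exprS expr_div_n; field.
  by rewrite !expf_neq0 ?gt_eqF.
rewrite ler_wpM2l ?exprn_ge0 ?(ltW e_gt0) //.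
have v_prod : 0 < \prod_(j < N) normc (1 - (tnth ws j)^-1) by apply: prodr_gt0 => j _; exact: v_gt0.
rewrite lef_pV2 ?posrE ?mulr_gt0 ?exprn_gt0 ?divr_gt0 ?invr_gt0 //.
rewrite (bigD1 i) //=; apply: ler_pM; rewrite ?invr_ge0 ?exprn_ge0 ?divr_ge0 ?(ltW e2_gt0) //.
  exact: far_ge.
have -> : (e2 / 2) ^+ N.-1 = \prod_(j < N | j != i) (e2 / 2).
  by rewrite prodr_const cardC1 card_ord.
by apply: ler_prod => j _; rewrite divr_ge0 ?(ltW e2_gt0) // v_ge.
Qed.
End ContourEstimates.

(** * Choice of the radii *)

Section SmallRadius.
Variable R : realType.

Lemma small_powers (s : seq R) (d : R) : 0 < d -> {in s, forall x, 0 < x} ->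
  exists2 e0 : R, 0 < e0 & forall e, 0 < e < e0 -> {in s, forall x, e `^ x <= d}.
Proof.
move=> d_gt0; elim: s => [|x s IH] s_pos; first by exists 1 => // e _ y; rewrite in_nil.
have [y ys|e0 e0_gt0 h] := IH; first by apply: s_pos; rewrite inE ys orbT.
have x_gt0 : 0 < x by apply: s_pos; rewrite mem_head.
exists (Num.min e0 (d `^ x^-1)); first by rewrite lt_min e0_gt0 powR_gt0.
move=> e; rewrite lt_min => /and3P[e_gt0 e_lt e_lt'] y; rewrite inE => /predU1P[->|ys].
  have -> : d = (d `^ x^-1) `^ x by rewrite -powRrM mulVf ?gt_eqF // powRr1 // ltW.
  by apply: (ge0_ler_powR (ltW x_gt0)); rewrite ?nnegrE ?powR_ge0 ?(ltW e_gt0) ?(ltW e_lt').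
by apply: h => //; rewrite e_gt0.
Qed.

Lemma powR_ratio (e x : R) (n m : nat) : 0 < e ->
  e `^ (x * n%:R - m%:R) = (e `^ x) ^+ n / e ^+ m.
Proof.
move=> e_gt0; have e0 : e != 0 by rewrite gt_eqF.
rewrite powRB ?e0 ?implybT //.
by rewrite powRrM !powR_mulrn ?powR_ge0 // ltW.
Qed.

Lemma powR_ratioV (e x : R) (n m : nat) : 0 < e ->
  e `^ (m%:R - x * n%:R) = e ^+ m / (e `^ x) ^+ n.
Proof. by move=> e_gt0; rewrite -opprB powRN powR_ratio // invf_div. Qed.

(* The least exponent to be controlled is that of the relevant ratio of radii. *)
Lemma contour_radii (L N : nat) (beta beta1 beta2 : R) : (0 < N)%N -> (2 * N < L)%N ->
    contour_exponents L N beta beta1 beta2 ->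
  exists2 e0 : R, 0 < e0 & forall e, 0 < e < e0 ->
  let r := e^-1 `^ beta in let e1 := e `^ beta1 in let e2 := e `^ beta2 in
  let d := (2 ^+ (L + N).+1)^-1 in
  [/\ e <= 4^-1, [/\ 2 <= r, e1 <= 4^-1 & e2 <= 4^-1],
    r^-1 ^+ L / e ^+ L <= d /\ e1 ^+ (L - N) / e ^+ L <= d,
    e2 ^+ N / e ^+ L <= d /\ e ^+ L / e1 ^+ N <= d & e ^+ L / e2 ^+ N.-1 <= d].
Proof.
move=> N_gt0 NL; have leNL : (N <= L)%N by lia.
move=> [beta_gt1 /andP[b1_gt b1_lt] b2_gt b2_lt].
have N0 : 0 < N%:R :> R by rewrite ltr0n.
have L0 : 0 < L%:R :> R by rewrite ltr0n; lia.
have LN0 : 0 < L%:R - N%:R :> R by rewrite subr_gt0 ltr_nat; lia.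
pose d : R := Num.min 4^-1 (2 ^+ (L + N).+1)^-1.
have d_gt0 : 0 < d by rewrite lt_min !invr_gt0 exprn_gt0 // ltr0n.
pose s := [:: 1; beta; beta1; beta2; beta * L%:R - L%:R; beta1 * (L - N)%N%:R - L%:R;
  beta2 * N%:R - L%:R; L%:R - beta1 * N%:R; L%:R - beta2 * N.-1%:R].
have s_pos : {in s, forall x, 0 < x}.
  have b1_gt0 : 0 < beta1 by apply: lt_trans b1_gt; rewrite divr_gt0.
  have b2_gt0 : 0 < beta2 by apply: lt_trans b2_gt; rewrite divr_gt0.
  move=> x; rewrite !inE; do ?[case/predU1P => [->|]]; last move/eqP => ->; rewrite ?ltr01 //.
  - by move: beta_gt1; lra.
  - by rewrite subr_gt0 ltr_pMl.
  - by rewrite subr_gt0 natrB; [rewrite -ltr_pdivrMr|].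
  - by rewrite subr_gt0 -ltr_pdivrMr.
  - by rewrite subr_gt0 -ltr_pdivlMr.
  rewrite subr_gt0; case: (N) N_gt0 b2_lt => [|[|n]] // _ b2_lt; first by rewrite mulr0.
  have : beta2 < L%:R / (n.+2%:R - 1) by exact: b2_lt.
  have -> : n.+2%:R - 1 = n.+1%:R :> R by rewrite -natr1 addrK.
  by rewrite ltr_pdivlMr // ltr0n.
have [e0 e0_gt0 small] := small_powers d_gt0 s_pos.
exists e0 => // e e_lt r e1 e2 D; have /andP[e_gt0 _] := e_lt.
have e_small x : x \in s -> e `^ x <= 4^-1 /\ e `^ x <= D.
  by move=> /(small e e_lt); rewrite le_min => /andP[].
have rE : r^-1 = e `^ beta.
  by rewrite /r -[e^-1]powR_inv1 ?ltW // -powRrM mulN1r powRN invrK.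
have s1 : e <= 4^-1 by have [] := e_small 1 (mem_head _ _); rewrite powRr1 // ltW.
have in_s k : (k < 9)%N -> nth 0 s k \in s by move=> ?; exact: mem_nth.
have [sr _] := e_small _ (in_s 1%N isT).
have [se1 _] := e_small _ (in_s 2%N isT); have [se2 _] := e_small _ (in_s 3%N isT).
have [_ h1] := e_small _ (in_s 4%N isT); have [_ h2] := e_small _ (in_s 5%N isT).
have [_ h3] := e_small _ (in_s 6%N isT); have [_ h4] := e_small _ (in_s 7%N isT).
have [_ h5] := e_small _ (in_s 8%N isT).
move: sr se1 se2 h1 h2 h3 h4 h5; rewrite /= !powR_ratio // !powR_ratioV // -/e1 -/e2 -rE.
move=> sr se1 se2 h1 h2 h3 h4 h5; split=> //; split=> //.
have r_gt0 : 0 < r by rewrite powR_gt0 // invr_gt0.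
rewrite -[2]invrK -[r]invrK lef_pV2 ?posrE ?invr_gt0 //.
by apply: le_trans sr _; lra.
Qed.
End SmallRadius.

(** * The integrand of the theorem as a Bethe sum *)

Section Integrand.
Variables (R : realType) (L N : nat) (zeta z : R[i]) (ws : N.-tuple R[i]).
Local Notation C := R[i].
Hypotheses (zeta_neq0 : zeta != 0).
Hypotheses (ws_neq0 : forall i, tnth ws i != 0) (ws_neq1 : forall i, tnth ws i != 1).
Local Notation w i := (tnth ws i).
Let c : C := (-1) ^+ N.+1 * zeta ^+ L.

Lemma p_funE : p_fun L z ws zeta = 1 - p_ratio L c z ws.
Proof. by rewrite /p_fun /p_ratio /c exprS mulN1r !mulNr opprK exprnN. Qed.

Lemma q_funE v : q_fun L N z v = 1 - q_ratio N L z v.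
Proof. by rewrite /q_fun /q_ratio /monomial !exprnN mulrA. Qed.

(** Reindexing the products by tau gathers the exponents of each w_i; the powers of zeta combine
    into the total displacement. *)
Lemma bethe_term (x y : config L N) (tau : 'S_N) :
  h_fun ws y zeta * (A_fun (tau^-1)%g ws * \prod_(i < N) (zeta^-1 * w ((tau^-1)%g i)) ^- pos x i)
  = zeta ^ (\sum_i coord x i - \sum_i coord y i) * ((-1) ^+ tau *
    \prod_(i < N) monomial (i%:Z - (tau i)%:Z) (coord y i - coord x (tau i)) (w i)).
Proof.
rewrite /A_fun odd_permV.
rewrite (reindex_inj (@perm_inj _ tau)) /= [X in _ * (_ * X)](reindex_inj (@perm_inj _ tau)) /=.
under eq_bigr do rewrite permK.
under [X in _ * (_ * X)]eq_bigr do rewrite permK.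
rewrite mulrCA [RHS]mulrCA -!mulrA; congr (_ * _).
have -> : \sum_i coord x i = \sum_i coord x (tau i) by rewrite (reindex_inj (@perm_inj _ tau)).
rewrite -sumrB -exprz_sum // /h_fun -!big_split /=; apply: eq_bigr => i _.
have v0 : 1 - (w i)^-1 != 0 by rewrite subr_eq0 eq_sym invr_eq1.
rewrite /monomial /coord !expfzDr // !exprnN exprnP !expfzMl ?exprzD ?exprz_inv opprK.
move: (_ ^ i%:Z) (_ ^ (- (tau i)%:Z)) (zeta ^ _) (zeta ^ (- _)) (w i ^ _) (w i ^ (- _)) => u1 u2 u3 u4 u5 u6; ring.
Qed.

Lemma integrandE (x y : config L N) : G_fun z ws y zeta * u_fun ws x zeta
  = zeta ^ (\sum_i coord x i - \sum_i coord y i) * \sum_(tau : 'S_N) (-1) ^+ tau *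
    kernel L c (fun i => i%:Z - (tau i)%:Z) (fun i => coord y i - coord x (tau i)) z ws.
Proof.
rewrite /G_fun p_funE (eq_bigr _ (fun i _ => q_funE (w i))) mulrAC /kernel invfM -prodfV.
rewrite /u_fun (reindex_inj invg_inj) [X in X * _]mulr_sumr.
under [X in X * _]eq_bigr do rewrite bethe_term.
rewrite -mulr_sumr -mulrA mulr_suml; congr (_ * _); apply: eq_bigr => tau _.
by rewrite -!mulrA.
Qed.
End Integrand.

(** * The contour integral and the limit of many Euler steps *)

Section CurrentFormula.
Variables (R : realType) (N L : nat) (r e1 e2 e : R) (zeta : R[i]).
Local Notation C := R[i].
Hypotheses (r_ge2 : 2 <= r) (e1_gt0 : 0 < e1) (e1_le : e1 <= 4^-1).
Hypotheses (e2_gt0 : 0 < e2) (e2_le : e2 <= 4^-1).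
Hypotheses (e_gt0 : 0 < e) (e_le : e <= 4^-1).
Hypotheses (N_gt0 : (0 < N)%N) (ltNL : (N < L)%N) (zeta_neq0 : zeta != 0).
Let c : C := (-1) ^+ N.+1 * zeta ^+ L.

Local Notation onw := (on_w r e1 e2).
Local Notation onz := (on_z e^-1 e).
Local Notation admw := (adm_w r e1 e2).
Local Notation admz := (adm_z e^-1 e).
Local Notation Jw := (mean_w r e1 e2).
Local Notation Jz := (mean_z e^-1 e).
Local Notation app := (z_approximable onw admw onz admz).
Local Notation Tot := (total_integral Jw Jz).
Local Notation ker := (@kernel R N L c).

Hypothesis q_dominated : forall z w, onz z -> onw w -> dominated (is_big r w) (q_ratio N L z w).
Hypothesis p_dominated : forall z (ws : N.-tuple C), onz z -> on_power onw ws ->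
  dominated (p_branch e2 e^-1 z ws) (p_ratio L c z ws).

Let R'_ge2 : 2 <= e^-1. Proof. exact: inv_small_ge2. Qed.
Let L_gt0 : (0 < L)%N. Proof. exact: leq_ltn_trans ltNL. Qed.
Let c_neq0 : c != 0.
Proof. by rewrite mulf_neq0 ?expf_neq0 // oppr_eq0 oner_eq0. Qed.
Let Kw_ex := functional_w r_ge2 e1_gt0 e2_gt0 e2_le.
Let Kz_ex := functional_z R'_ge2 e_gt0.
Let ker_app a b : app (ker a b).
Proof. exact: kernel_approximable. Qed.

Definition ring_integral (f : C -> N.-tuple C -> C) : C :=
  oint_z e^-1 e (fun z => z^-1 *
    iter_oint (fun g => oint_w r e1 e2 (fun w => w^-1 * g w)) (f z)).

Lemma ring_integralE f : ring_integral f = Tot f.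
Proof.
have Jw_E : (fun g => oint_w r e1 e2 (fun w => w^-1 * g w)) = Jw.
  by apply/funext => g; rewrite /oint_w /mean_w /circle_mean !mulrBr.
by rewrite /ring_integral Jw_E /oint_z /total_integral /mean_z /circle_mean mulrBr.
Qed.

Variables (x y : config L N).

Definition bethe_integrand (z : C) (ws : N.-tuple C) : C := G_fun z ws y zeta * u_fun ws x zeta.

Let expansion (z : C) (ws : N.-tuple C) : C :=
  zeta ^ (\sum_i coord x i - \sum_i coord y i) * \sum_(tau : 'S_N) (-1) ^+ tau *
    ker (fun i => i%:Z - (tau i)%:Z) (fun i => coord y i - coord x (tau i)) z ws.

Let bethe_integrandE z ws : onz z -> on_power onw ws -> bethe_integrand z ws = expansion z ws.
Proof.
move=> hz hw; have w_neq i := on_w_neq r_ge2 e1_gt0 e1_le e2_gt0 e2_le (hw i).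
by apply: integrandE => // i; have [] := w_neq i.
Qed.

Lemma bethe_integrand_approximable : app bethe_integrand.
Proof.
have [Kw Fw] := Kw_ex; have [Kz Fz] := Kz_ex.
apply: z_approximable_ext bethe_integrandE _; apply: (z_approximableZ Fw Fz).
by apply: (z_approximable_sum Fw Fz) => tau; exact: (z_approximableZ Fw Fz).
Qed.

Variables (s p q : C).
Local Notation E := (@energy R N p q).

Lemma bethe_integrand_step m :
  Tot (fun z ws => bethe_integrand z ws * (1 + s * E ws) ^+ m)
  = bethe_sum zeta (coord y) (bethe_fun L c r e1 e2 e^-1 e s p q m) (coord x).
Proof.
have [Kw Fw] := Kw_ex; have [Kz Fz] := Kz_ex.
pose X a b z ws := ker a b z ws * (1 + s * E ws) ^+ m.
have step_app := step_approximable N r_ge2 e1_gt0 e1_le e2_gt0 e2_le R'_ge2 e_gt0 s p q m.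
have X_app a b : app (X a b) by exact: (z_approximableM Fw Fz).
rewrite /bethe_sum.
transitivity (Tot (fun z ws => zeta ^ (\sum_i coord x i - \sum_i coord y i) *
   \sum_(tau : 'S_N) (-1) ^+ tau *
   X (fun i => i%:Z - (tau i)%:Z) (fun i => coord y i - coord x (tau i)) z ws)).
  apply: (total_integral_ext Fw Fz) => [z ws hz hw|]; last first.
    by apply: (z_approximableM Fw Fz) => //; exact: bethe_integrand_approximable.
  rewrite bethe_integrandE // /expansion -mulrA mulr_suml; congr (_ * _).
  by apply: eq_bigr => tau _; rewrite -mulrA.
rewrite (total_integralZ Fw Fz); last first.
  by apply: (z_approximable_sum Fw Fz) => tau; exact: (z_approximableZ Fw Fz).
rewrite (total_integral_sum Fw Fz); last by move=> tau; exact: (z_approximableZ Fw Fz).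
by congr (_ * _); apply: eq_bigr => tau _; rewrite (total_integralZ Fw Fz) // bethe_fun_integral.
Qed.
End CurrentFormula.

Lemma exists_natS_ge (R : realType) (x : R) : exists n : nat, x <= n.+1%:R.
Proof.
exists (Num.bound `|x|); apply: le_trans (ler_norm x) _.
apply: ltW; apply: lt_trans (archi_boundP (normr_ge0 x)) _.
by rewrite ltr_nat.
Qed.

Section ExponentialLimit.
Variables (R : realType) (N L : nat) (r e1 e2 e : R) (zeta : R[i]).
Local Notation C := R[i].
Hypotheses (r_ge2 : 2 <= r) (e1_gt0 : 0 < e1) (e1_le : e1 <= 4^-1).
Hypotheses (e2_gt0 : 0 < e2) (e2_le : e2 <= 4^-1).
Hypotheses (e_gt0 : 0 < e) (e_le : e <= 4^-1).
Hypotheses (N_gt0 : (0 < N)%N) (ltNL : (N < L)%N) (zeta_neq0 : zeta != 0).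
Let c : C := (-1) ^+ N.+1 * zeta ^+ L.

Local Notation onw := (on_w r e1 e2).
Local Notation onz := (on_z e^-1 e).
Local Notation app := (z_approximable onw (adm_w r e1 e2) onz (adm_z e^-1 e)).
Local Notation Tot := (total_integral (mean_w r e1 e2) (mean_z e^-1 e)).

Hypothesis q_dominated : forall z w, onz z -> onw w -> dominated (is_big r w) (q_ratio N L z w).
Hypothesis p_dominated : forall z (ws : N.-tuple C), onz z -> on_power onw ws ->
  dominated (p_branch e2 e^-1 z ws) (p_ratio L c z ws).

Let R'_ge2 : 2 <= e^-1. Proof. exact: inv_small_ge2. Qed.

Variables (x y : config L N) (p q : C) (t : R).
Hypothesis t_ge0 : 0 <= t.
Local Notation E := (@energy R N p q).
Local Notation u n := (bethe_sum zeta (coord y)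
  (bethe_fun L c r e1 e2 e^-1 e (t / n.+1%:R)%:C p q n.+1) (coord x)).

(** E is bounded on the contours, so (1 + (t/(n+1)) E)^(n+1) approaches e^{tE} uniformly at rate
    1/n, and the integral is a bounded functional. A single constant A serves as error constant and
    as threshold for n. *)
Lemma exponential_limit : exists2 A, 0 <= A & forall n, A <= n.+1%:R ->
  normc (Tot (fun z ws => bethe_integrand zeta x y z ws * cexp (t%:C * E ws)) - u n)
    <= A / n.+1%:R.
Proof.
have [Kw Fw] := functional_w r_ge2 e1_gt0 e2_gt0 e2_le.
have [Kz Fz] := functional_z R'_ge2 e_gt0.
have G_app : app (bethe_integrand zeta x y) by exact: bethe_integrand_approximable.
have [B B_ge0 GB] := z_approximable_bdd Fw Fz G_app.
have E_app := energy_approximable N r_ge2 e1_gt0 e1_le e2_gt0 e2_le R'_ge2 e_gt0 p q.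
have [M0 M0_ge0 EM] := z_approximable_bdd Fw Fz E_app.
pose M := t * M0; have M_ge0 : 0 <= M by exact: mulr_ge0.
pose D := 8 * M ^+ 2 * expR M.
have D_ge0 : 0 <= D by rewrite !mulr_ge0 ?sqr_ge0 ?expR_ge0.
pose step n (ws : N.-tuple C) := (1 + (t / n.+1%:R)%:C * E ws) ^+ n.+1.
have step_app n : app (fun _ ws => step n ws).
  exact: (step_approximable N r_ge2 e1_gt0 e1_le e2_gt0 e2_le R'_ge2 e_gt0).
have step_error n z ws : 2 * M <= n.+1%:R -> onz z -> on_power onw ws ->
    normc (cexp (t%:C * E ws) - step n ws) <= D / n.+1%:R.
  move=> n_ge hz hw; have -> : step n ws = (1 + (t%:C * E ws) / n.+1%:R) ^+ n.+1.
    rewrite /step; congr ((1 + _) ^+ _).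
    by rewrite rmorphM fmorphV rmorph_nat mulrAC.
  apply: cexp_limit => //; rewrite normcM normc_real ger0_norm // ler_wpM2l //.
  exact: EM hz hw.
(* The exponential is a uniform limit of polynomials in E, hence approximable. *)
have exp_app : app (fun _ ws => cexp (t%:C * E ws)).
  apply: z_approximable_lim => d d_gt0.
  have [n] := exists_natS_ge (2 * M + D / d).
  move=> n_gt; exists (fun _ ws => step n ws) => // z ws hz hw.
  have Dd_ge0 : 0 <= D / d by rewrite divr_ge0 // ltW.
  have M2_ge0 : 0 <= 2 * M by rewrite mulr_ge0.
  apply: le_trans (step_error n z ws _ hz hw) _; first by move: n_gt; lra.
  rewrite ler_pdivrMr // mulrC -ler_pdivrMr //; move: n_gt; lra.
pose A0 := Kz * (Kw ^+ N * (B * D)).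
have A0_ge0 : 0 <= A0.
  by rewrite mulr_ge0 ?(cf_ge0 Fz) // mulr_ge0 ?exprn_ge0 ?(cf_ge0 Fw) // mulr_ge0.
exists (A0 + 2 * M); first by rewrite addr_ge0 // mulr_ge0.
move=> n n_ge; have n_gt0 : 0 < n.+1%:R :> R by [].
rewrite -bethe_integrand_step //.
set F := (fun z ws => _ * cexp _); set S := (fun z ws => _ * _ ^+ _).
have F_app : app F by exact: (z_approximableM Fw Fz).
have S_app : app S by apply: (z_approximableM Fw Fz) => //; exact: step_app.
have -> : Tot F - Tot S = Tot (fun z ws => - 1 * S z ws + F z ws).
  by rewrite (total_integral_linear Fw Fz) // mulN1r addrC.
apply: le_trans (_ : A0 / n.+1%:R <= _).
  have -> : A0 / n.+1%:R = Kz * (Kw ^+ N * (B * (D / n.+1%:R))).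
    by rewrite /A0 !mulrA.
  apply: (total_integral_bound Fw Fz) => [|z ws hz hw].
    by apply: z_approximableD => //; exact: (z_approximableZ Fw Fz).
  have -> : - 1 * S z ws + F z ws
      = bethe_integrand zeta x y z ws * (cexp (t%:C * E ws) - step n ws).
    by rewrite mulN1r addrC /F /S /step -mulrBr.
  rewrite normcM; apply: ler_pM; rewrite ?normc_ge0 ?GB //.
  by apply: (step_error n z) => //; apply: le_trans n_ge; rewrite lerDr.
by rewrite ler_wpM2r ?invr_ge0 ?ler0n // lerDl mulr_ge0.
Qed.
End ExponentialLimit.

(** * Summation over the current and conclusion *)

Lemma has_sumP (R : realType) (J : choiceType) (f : J -> R[i]) (S : R[i]) :
  (forall d : R, 0 < d -> exists A : seq J, forall B, uniq B -> {subset A <= B} ->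
     normc (\sum_(j <- B) f j - S) <= d) ->
  has_sum f S.
Proof.
move=> h; have F : Filter (@totally J) := @totally_filter J.
apply/cvgrPdist_le => d d_gt0.
have dE : d = (complex.Re d)%:C.
  by case: d d_gt0 => a b; rewrite ltcE /= => /andP[/eqP -> _].
have Re_gt0 : 0 < complex.Re d by rewrite -ltcR -dE.
have [A hA] := h _ Re_gt0; exists [fset j in A]%fset => // B /fsubsetP AB.
have -> : partial_sum (f : J -> R[i]^o) B = \sum_(j <- B) f j by rewrite big_seq_fsetE.
rewrite distrC.
rewrite normr_normc dE lecR; apply: hA; first exact: fset_uniq.
by move=> j jA; apply: AB; rewrite inE.
Qed.

Theorem theorem1p1 (R : realType) (L N : nat) (hL : (1 <= L)%N)
    (hN : (1 <= N)%N) (hLN : (2 * N < L)%N)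
    (beta beta1 beta2 : R) (hbeta : contour_exponents L N beta beta1 beta2) :
  exists2 eps0 : R, 0 < eps0 &
  forall eps' : R, 0 < eps' < eps0 ->
  let R' := eps'^-1 in
  let r := R' `^ beta in
  let eps1 := eps' `^ beta1 in
  let eps2 := eps' `^ beta2 in
  forall (p q : R), 0 <= p -> 0 <= q -> p + q = 1 ->
  forall (Y : config L N)
    (d : measure_display) (T : measurableType d) (Pr : probability T R)
    (X : R -> T -> config L N) (Qloc : R -> T -> {ffun 'I_L -> int}),
  is_pushASEP p q Y Pr X Qloc ->
  forall (t : R) (x : config L N) (zeta : R[i]), 0 <= t -> `|zeta| = 1 ->
  has_sum
    (fun Q : int => zeta ^ Q *
      (fine (Pr [set omega | X t omega = x /\
                             total_current (Qloc t) omega = Q]))%:C)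
    (oint_z R' eps' (fun z => z^-1 *
      iter_oint (fun f => oint_w r eps1 eps2 (fun w => w^-1 * f w))
        (fun w : N.-tuple R[i] =>
          G_fun z w Y zeta * u_fun w x zeta * cexp (t%:C * E_fun p q w)))).
Proof.
have ltNL : (N < L)%N by lia.
have [eps0 eps0_gt0 radii] := contour_radii hN hLN hbeta.
exists eps0 => // e e_lt R' r e1 e2 p q p_ge0 q_ge0 pq1 Y d T Pr X Qloc pushASEP t x zeta t_ge0 zeta1.
have [e_le [r_ge2 e1_le e2_le] [big_small zero_small] [one_small far_small] near_small]
  := radii e e_lt.
have e_gt0 : 0 < e by case/andP: e_lt.
have e1_gt0 : 0 < e1 by exact: powR_gt0.
have e2_gt0 : 0 < e2 by exact: powR_gt0.
have R'_ge2 : 2 <= e^-1 := inv_small_ge2 e_gt0 e_le.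
have zeta_neq0 : zeta != 0 by rewrite -normr_eq0 zeta1 oner_neq0.
have normc_zeta : normc zeta = 1 by move: zeta1; rewrite normr_normc => /complexI.
pose c : R[i] := (-1) ^+ N.+1 * zeta ^+ L.
have normc_c : normc c = 1 by rewrite normcM !normcX normcN normc1 normc_zeta !expr1n mulr1.
have c_neq0 : c != 0 by rewrite -normc_gt0 normc_c.
have q_dom := q_ratio_dominated r_ge2 e1_gt0 e1_le e2_gt0 e2_le e_gt0 e_le ltNL
  big_small zero_small one_small.
have p_dom := p_ratio_dominated r_ge2 e1_gt0 e1_le e2_gt0 e2_le e_gt0 e_le hN normc_c
  one_small far_small near_small.
have [A A_ge0 A_lim] := exponential_limit r_ge2 e1_gt0 e1_le e2_gt0 e2_le e_gt0 e_le hN ltNL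
  zeta_neq0 q_dom p_dom x Y p%:C q%:C t_ge0.
apply: has_sumP => eta eta_gt0.
(* The integral of the statement is [ring_integral] by conversion. *)
rewrite -[oint_z _ _ _]/(ring_integral r e1 e2 e (fun z w =>
  bethe_integrand zeta x Y z w * cexp (t%:C * energy p%:C q%:C w))) ring_integralE.
pose K := 2 * (N%:R * t) ^+ 2 + A; have K_ge0 : 0 <= K.
  by rewrite addr_ge0 // mulr_ge0 ?sqr_ge0.
have Nt_ge0 : 0 <= N%:R * t by rewrite mulr_ge0.
(* One n for three purposes: the Euler step is at most 1/N, A <= n + 1, and the total error K/(n+1)
   is at most eta. *)
have [n n_ge] := exists_natS_ge (N%:R * t + A + K / eta).
have Ke_ge0 : 0 <= K / eta by rewrite divr_ge0 // ltW.
have n_gt0 : 0 < n.+1%:R :> R by [].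
pose U m := bethe_sum zeta (coord Y)
  (bethe_fun L c r e1 e2 e^-1 e (t / n.+1%:R)%:C p%:C q%:C m).
have [|||||J0 hJ0] := @current_law_error _ _ _ _ _ hN hL ltNL p_ge0 pq1 _ _ _ _ _ _ pushASEP
  t t_ge0 zeta U n x zeta1.
- by rewrite mulrA ler_pdivrMr // mul1r; move: n_ge; lra.
- move=> m y; apply: (bethe_sum_rotate _ hN zeta_neq0) => a b i a0.
  by apply: bethe_fun_rotate => //; rewrite a0.
- move=> m y j j' jj' yj; apply: (bethe_sum_boundary _ hN zeta_neq0 _ jj' yj) => a b i.
  exact: bethe_fun_boundary.
- by move=> m y; apply: bethe_sum_evolution.
(* At time 0 the alternating sum is the indicator of x0 = Y, where the prefactor is zeta^0 = 1. *)
- move=> x0; rewrite /U /bethe_sum kernel_integral_initial //; do ?[exact: coord_cyclic];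
    do ?[exact: coord_bound].
  case: eqP => [->|x0_neq].
    by rewrite subrr expr0z mul1r; case: forallP => // -[] i.
  rewrite (_ : [forall i, _] = false) ?mulr0 //; apply/forallP => x0_eq; apply: x0_neq.
  apply: val_inj; apply: eq_from_tnth => i; apply: val_inj; apply/eqP.
  by rewrite eq_sym; exact: x0_eq i.
exists J0 => J J_uniq J0_J; have := hJ0 J J_uniq J0_J; rewrite normr_normc lecR.
set S := \sum_(Q <- J) _; set I := total_integral _ _ _ => h.
have -> : S - I = (S - U n.+1 (coord x)) - (I - U n.+1 (coord x)) 
  by clear h; move: (S) (I) (U _ _) => u v w; ring.
apply: le_trans (le_normcD _ _) _; rewrite normcN.
apply: le_trans (lerD h (A_lim n _)) _; first by move: n_ge; lra.
rewrite -mulrDl -/K ler_pdivrMr // mulrC -ler_pdivrMr //; move: n_ge; lra.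
Qed.
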